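(* Let $H(x,y)$ be a (real-valued) harmonic function defined in the upper half plane $\mathbb{H}=\{(x,y):x\in\mathbb R,\ y>0\}$. Suppose that $\lim_{(x,y)\to\infty}H(x,y)=0$. Suppose also that the distributional limit of $H(x,y)$ as $y\to0^+$ exists and equals $\mathsf f\in\mathcal E'(\mathbb R)$, and that $\mathsf f=\mathsf F'$ where $\mathsf F$ is a Łojasiewicz distribution. If $$\limsup_{y\to0^+}H(x,y)\ge0\quad\text{for almost every }x\in\mathbb R,$$ and there exist a countable set $E$ and constants $M_x<\infty$ for $x\in\mathbb R\setminus E$ such that $$\liminf_{y\to0^+}H(x,y)\ge -M_x,\qquad x\in\mathbb R\setminus E,$$ then $\mathsf f$ is a measure and $H(x,y)\ge0$ for all $(x,y)\in\mathbb H$.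
   Context: $\mathcal E'(\mathbb R)$ is the space of compactly supported distributions. The distributional limit of $H(x,y)$ as $y\to0^+$ equals $\mathsf f$ if $\lim_{y\to0^+}\int_{-\infty}^\infty H(x,y)\rho(x)\,dx=\langle\mathsf f,\rho\rangle$ for every $\rho\in\mathcal D(\mathbb R)$. For $\mathsf g\in\mathcal D'(\mathbb R)$, the distributional (Łojasiewicz) point value $\mathsf g(x_0)$ exists and equals $\gamma\in\mathbb R$ if $\lim_{\varepsilon\to0}\langle \mathsf g(x_0+\varepsilon y),\phi(y)\rangle=\gamma\int_{-\infty}^\infty\phi(y)\,dy$ for every $\phi\in\mathcal D(\mathbb R)$, where $\langle \mathsf g(x_0+\varepsilon y),\phi(y)\rangle:=|\varepsilon|^{-1}\langle \mathsf g(y),\phi((y-x_0)/\varepsilon)\rangle$. A Łojasiewicz distribution is a distribution having a distributional point value at every point of $\mathbb R$. ''Measure'' means positive Radon measure. *)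

(* Defs.v *)
From mathcomp Require Import all_boot all_order all_algebra.
From mathcomp Require Import all_classical all_reals all_analysis.

Set Implicit Arguments.
Unset Strict Implicit.
Unset Printing Implicit Defensive.

Import Order.TTheory GRing.Theory Num.Theory.
Import numFieldNormedType.Exports.

Local Open Scope classical_set_scope.
Local Open Scope ring_scope.

Section Distributions.
Context {R : realType}.
Implicit Types (phi psi : R -> R) (T : (R -> R) -> R) (K : set R).

Definition supp phi : set R := closure [set x | phi x != 0].

Definition smooth phi := forall (n : nat) (x : R), derivable (derive1n n phi) x 1.

(* The space D(R) of real test functions. *)
Definition test_function phi := smooth phi /\ compact (supp phi).

Definition sup_norm phi : R := sup (range (fun x => `|phi x|)).

(* Membership in D'(R).  The functional T takes an arbitrary function as
   argument, but only its values on test functions are constrained, and only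
   those values are ever used below. *)
Definition distribution T :=
  (forall (a : R) phi psi, test_function phi -> test_function psi ->
     T (fun x => a * phi x + psi x) = a * T phi + T psi) /\
  (forall K, compact K -> exists (C : R) (N : nat),
     forall phi, test_function phi -> supp phi `<=` K ->
       `|T phi| <= C * \sum_(k < N.+1) sup_norm (derive1n k phi)).

Definition compactly_supported T :=
  exists2 K : set R, compact K &
    forall phi, test_function phi -> supp phi `&` K = set0 -> T phi = 0.

(* E'(R) *)
Definition compact_distribution T := distribution T /\ compactly_supported T.

(* f = F' in D'(R) *)
Definition is_distr_derivative (F f : (R -> R) -> R) :=
  forall phi, test_function phi -> f phi = - F (derive1 phi).

(* Integrals of real functions are the real-valued Lebesgue integrals
   ([Rintegral]); every integrand below is continuous with compact support. *)
Definition has_point_value T (x0 gamma : R) :=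
  forall phi, test_function phi ->
    `|e|^-1 * T (fun y => phi ((y - x0) / e)) @[e --> (0 : R)^'] -->
      gamma * \int[lebesgue_measure]_y phi y.

Definition Lojasiewicz_distribution T :=
  distribution T /\ forall x0 : R, exists gamma : R, has_point_value T x0 gamma.

(* On the real line, a positive Radon measure is the same as a positive Borel
   measure that is finite on compact sets. *)
Definition is_Radon_measure (mu : {measure set (measurableTypeR R) -> \bar R}) :=
  forall K, compact K -> (mu K < +oo)%E.

Definition is_measure_distribution T :=
  exists2 mu : {measure set (measurableTypeR R) -> \bar R}, is_Radon_measure mu &
    forall phi, test_function phi -> T phi = \int[mu]_x phi x.

End Distributions.

Section HalfPlane.
Context {R : realType}.
Implicit Types (H : R * R -> R) (p : R * R) (U : set (R * R)).

Definition upper_half_plane : set (R * R) := [set p | 0 < p.2].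

Definition dirx : R * R := (1, 0).
Definition diry : R * R := (0, 1).

Definition C2_on U H :=
  (forall p, U p -> {for p, continuous H}) /\
  (forall v, v = dirx \/ v = diry -> forall p, U p ->
     derivable H p v /\ {for p, continuous ('D_v H)}) /\
  (forall v w, v = dirx \/ v = diry -> w = dirx \/ w = diry -> forall p, U p ->
     derivable ('D_v H) p w /\ {for p, continuous ('D_w ('D_v H))}).

Definition harmonic_on U H :=
  C2_on U H /\ forall p, U p -> 'D_dirx ('D_dirx H) p + 'D_diry ('D_diry H) p = 0.

Definition vanishes_at_infinity_on U H :=
  forall e : R, 0 < e -> exists r : R,
    forall p, U p -> r < `|p| -> `|H p| < e.

Definition has_distr_boundary_limit H (f : (R -> R) -> R) :=
  forall rho : R -> R, test_function rho ->
    \int[lebesgue_measure]_x (H (x, y) * rho x) @[y --> (0 : R)^'+] --> f rho.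

Definition limsup_boundary H (x : R) : \bar R :=
  limf_esup (fun y : R => (H (x, y))%:E) (0 : R)^'+.

Definition liminf_boundary H (x : R) : \bar R :=
  limf_einf (fun y : R => (H (x, y))%:E) (0 : R)^'+.

End HalfPlane.

(* Main.v *)
Require Import Defs.
From HB Require Import structures.
From mathcomp Require Import all_boot all_order all_algebra ring lra.
From mathcomp Require Import all_classical all_reals all_analysis measurable_realfun.
Import Order.TTheory GRing.Theory Num.Theory.
Import numFieldNormedType.Exports.
Local Open Scope classical_set_scope.
Local Open Scope ring_scope.

Set Implicit Arguments.
Unset Strict Implicit.
Unset Printing Implicit Defensive.

(* Call a boundary point regular if [f >= 0] on test functions supported near it, and let [S]
   be the closed set of the other points.  Suppose that [S] is not empty.  By Baire, either [S]
   has an isolated point, or some interval around a point of [S] carries a bound [H >= -n] on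
   all verticals above [S], up to a fixed height.

   Since [f] is the derivative of a Lojasiewicz distribution, [f (phi ((t - a) / e))] tends to
   [0] with [e] for every test function [phi]; a gliding hump argument makes this uniform over
   compact families of [phi].  Hence a point at which [f] is locally positive on both sides is
   regular, which excludes isolated points of [S].  For the same reason [r H] tends to [0] at
   distance [r] from an end point of a gap of [S], so a Phragmen-Lindelof argument with the
   barrier [Re ((1 + i) / z)] carries the lower bound from the verticals above [S] across the
   gaps: [H >= -C], hence [f >= -C], on an interval [I].

   Where [f >= -C], the measure [f + C] has mass at least [C r / 8] in arbitrarily small
   intervals of radius [r] around almost every point, as otherwise the upper limit of [H]
   would be negative.  By a covering argument [f + C >= C / 96] on [I].  Iterating,
   [f >= -C (95 / 96)^n] for all [n], so [f >= 0] on [I], a contradiction.  Thus [f >= 0];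
   it is a measure, and [H] is its Poisson integral. *)

(** * Smooth functions *)

(** The model obstruction is [f = - delta_a]: then [H] is minus a Poisson kernel, tends to [0] on
    every vertical except the one above [a], and satisfies all the conditions on [H] with [E = {a}].
    Only the scaling limit at [a] excludes it, since [delta_a] sends [phi ((t - a) / e)] to [phi 0].
    The kernel grows like [1 / r] at [a], just as the barrier does; so [r H -> 0] is exactly what
    lets the barrier be used with an arbitrarily small coefficient. The condition on the upper limit
    has another role: it excludes densities such as [- C]. The scaling limit is given for one test
    function at a time, whereas the kernel at distance [r] from [a] depends on the direction of
    approach, has a tail, and nearly a pole on the side of the gap. The tail is cut dyadically, the
    directions are handled by uniformity over compact families, and the pole by the positivity of
    [f] inside the gap. *)

Lemma is_derive_affine {R : realType} (a k t : R) :
  is_derive t (1 : R) (fun s : R => a + k * s) k.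
Proof.
have h := is_deriveD (is_derive_cst a t (1 : R)) (is_deriveZ k (is_derive_id t (1 : R))).
have e : 0 + k%:A = k :> R by rewrite add0r /GRing.scale/= mulr1.
by rewrite e in h.
Qed.

(** * Families of smooth functions with uniform local bounds on all derivatives *)

Section SmoothFamilies.
Context {R : realType} {I : Type}.
Implicit Types (W : set I) (psi phi : I -> R -> R) (n : nat).

Definition loc_bounded W psi := forall A : R, exists C : R,
  forall i, W i -> forall t, `|t| <= A -> `|psi i t| <= C.

(** The derivative is a witness rather than [derive1 (psi i)], so the closure properties below
    follow by induction on [n] without formulas for higher derivatives. Bounds uniform in [i] stand
    for compactness of the family. *)
Fixpoint diff_family W n psi : Prop :=
  loc_bounded W psi /\
  if n is m.+1 then exists psi' : I -> R -> R,
    (forall i, W i -> forall t : R, is_derive t 1 (psi i) (psi' i t)) /\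
    diff_family W m psi'
  else True.

Definition smooth_family W psi := forall n, diff_family W n psi.

Lemma diff_family_loc W n psi : diff_family W n psi -> loc_bounded W psi.
Proof. by case: n => [|n] []. Qed.

Lemma diff_familyW W n psi : diff_family W n.+1 psi -> diff_family W n psi.
Proof.
elim: n psi => [|n IH] psi [lb [psi' [dpsi Hpsi']]]; first by [].
by split=> //; exists psi'; split=> //; exact: IH.
Qed.

Lemma loc_bounded_cst W (c : I -> R) (C : R) : (forall i, W i -> `|c i| <= C) ->
  loc_bounded W (fun i _ => c i).
Proof. by move=> h A; exists C => i Wi t _; exact: h. Qed.

Lemma smooth_family_cst W (c : I -> R) (C : R) : (forall i, W i -> `|c i| <= C) ->
  smooth_family W (fun i _ => c i).
Proof.
move=> h n; elim: n c C h => [|n IH] c C h.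
  by split=> //; exact: (loc_bounded_cst h).
split; first exact: (loc_bounded_cst h).
exists (fun _ _ => 0); split=> [i _ t|]; first exact: is_derive_cst.
by apply: (IH (fun _ => 0) 0) => i _; rewrite normr0.
Qed.

Lemma smooth_family_id W : smooth_family W (fun _ t => t).
Proof.
have lb : loc_bounded W (fun _ t => t) by move=> A; exists A.
case=> [|n]; split=> //; exists (fun _ _ => 1); split=> [i _ t|].
  exact: is_derive_id.
by apply: (@smooth_family_cst _ (fun=> 1) 1) => i _; rewrite normr1.
Qed.

Lemma diff_familyD W n psi phi : diff_family W n psi -> diff_family W n phi ->
  diff_family W n (fun i t => psi i t + phi i t).
Proof.
have lbD p q : loc_bounded W p -> loc_bounded W q ->
    loc_bounded W (fun i t => p i t + q i t).
  move=> lp lq A; have [C hC] := lp A; have [D hD] := lq A; exists (C + D).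
  by move=> i Wi t tA; rewrite (le_trans (ler_normD _ _))// lerD ?hC ?hD.
elim: n psi phi => [|n IH] psi phi [lp hp] [lq hq]; first by split=> //; exact: lbD.
split; first exact: lbD.
case: hp => psi' [dpsi hp]; case: hq => phi' [dphi hq].
exists (fun i t => psi' i t + phi' i t); split; last exact: IH.
move=> i Wi t; have := dpsi i Wi t; have := dphi i Wi t => h1 h2.
exact: is_deriveD.
Qed.

Lemma diff_familyM W n psi phi : diff_family W n psi -> diff_family W n phi ->
  diff_family W n (fun i t => psi i t * phi i t).
Proof.
have lbM p q : loc_bounded W p -> loc_bounded W q ->
    loc_bounded W (fun i t => p i t * q i t).
  move=> lp lq A; have [C hC] := lp A; have [D hD] := lq A; exists (C * D).
  by move=> i Wi t tA; rewrite normrM ler_pM// ?hC ?hD.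
elim: n psi phi => [|n IH] psi phi hp hq.
  by split=> //; apply: lbM; [case: hp|case: hq].
have lp := diff_family_loc hp; have lq := diff_family_loc hq.
split; first exact: lbM.
have hp0 := diff_familyW hp; have hq0 := diff_familyW hq.
case: hp => _ [psi' [dpsi hp]]; case: hq => _ [phi' [dphi hq]].
exists (fun i t => psi i t * phi' i t + phi i t * psi' i t); split.
  move=> i Wi t; have h1 := dpsi i Wi t; have h2 := dphi i Wi t.
  exact: is_deriveM.
by apply: diff_familyD; exact: IH.
Qed.

Lemma diff_familyV W n psi (c : R) : 0 < c -> (forall i, W i -> forall t, c <= psi i t) ->
  diff_family W n psi -> diff_family W n (fun i t => (psi i t)^-1).
Proof.
move=> c0 hc.
have lbV : loc_bounded W (fun i t => (psi i t)^-1).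
  move=> A; exists c^-1 => i Wi t _.
  by rewrite ger0_norm ?invr_ge0 ?lef_pV2 ?posrE ?hc// ?(lt_le_trans c0)// ?(le_trans (ltW c0)) ?hc.
elim: n => [|n IH] hp; first by split.
split=> //; have hp0 := diff_familyW hp.
case: hp => _ [psi' [dpsi hp]].
(* The derivative is written with products of inverses only, so that [diff_familyM] and the
   induction hypothesis apply to it. *)
exists (fun i t => (-1 * ((psi i t)^-1 * (psi i t)^-1)) * psi' i t); split.
  move=> i Wi t; have h1 := dpsi i Wi t.
  have p0 : psi i t != 0 by rewrite gt_eqF// (lt_le_trans c0)// hc.
  have := @is_deriveV R (psi i) t (psi' i t) 1 p0 h1.
  move=> h; apply: is_derive_eq; rewrite -exprVn expr2 mulN1r.
  by [].
apply: diff_familyM => //; apply: diff_familyM.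
  by apply: (@smooth_family_cst _ (fun=> -1) 1) => i _; rewrite normrN normr1.
by apply: diff_familyM; exact: IH.
Qed.

Lemma diff_family_ext W n psi phi : (forall i, W i -> psi i = phi i) ->
  diff_family W n psi -> diff_family W n phi.
Proof.
have lbE p q : (forall i, W i -> p i = q i) -> loc_bounded W p -> loc_bounded W q.
  by move=> e lp A; have [C hC] := lp A; exists C => i Wi t tA; rewrite -e// hC.
case: n => [|n] e [lp h]; first by split=> //; exact: lbE lp.
split; first exact: lbE lp.
by case: h => psi' [d h]; exists psi'; split=> // i Wi t; rewrite -e//; exact: d.
Qed.

Lemma smooth_familyD W psi phi : smooth_family W psi -> smooth_family W phi ->
  smooth_family W (fun i t => psi i t + phi i t).
Proof. by move=> h1 h2 n; exact: diff_familyD. Qed.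

Lemma smooth_familyM W psi phi : smooth_family W psi -> smooth_family W phi ->
  smooth_family W (fun i t => psi i t * phi i t).
Proof. by move=> h1 h2 n; exact: diff_familyM. Qed.

Lemma smooth_familyV W psi (c : R) : 0 < c -> (forall i, W i -> forall t, c <= psi i t) ->
  smooth_family W psi -> smooth_family W (fun i t => (psi i t)^-1).
Proof. by move=> c0 h1 h2 n; exact: (diff_familyV c0). Qed.

Lemma smooth_family_ext W psi phi : (forall i, W i -> psi i = phi i) ->
  smooth_family W psi -> smooth_family W phi.
Proof. by move=> e h n; exact: (diff_family_ext e). Qed.

Lemma smooth_familyN W psi : smooth_family W psi ->
  smooth_family W (fun i t => - psi i t).
Proof.
move=> h; apply: (@smooth_family_ext _ (fun i t => -1 * psi i t)).
  by move=> i _; apply/funext => t; rewrite mulN1r.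
apply: smooth_familyM => //.
by apply: (@smooth_family_cst _ (fun=> -1) 1) => i _; rewrite normrN normr1.
Qed.

Lemma smooth_familyB W psi phi : smooth_family W psi -> smooth_family W phi ->
  smooth_family W (fun i t => psi i t - phi i t).
Proof. by move=> h1 h2; apply: smooth_familyD => //; exact: smooth_familyN. Qed.

Lemma is_derive1E (g : R -> R) (t d : R) : is_derive t 1 g d -> derive1 g t = d.
Proof. by move=> h; rewrite derive1E derive_val. Qed.

Lemma diff_family_bound W n psi : diff_family W n psi ->
  loc_bounded W (fun i => derive1n n (psi i)).
Proof.
elim: n psi => [|n IH] psi; first by case.
move=> [lb [psi' [d /IH h]]] A; have [C hC] := h A; exists C => i Wi t tA.
have e : derive1 (psi i) = psi' i.
  by apply/funext => s; apply: is_derive1E; exact: d.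
by rewrite derive1Sn e; exact: hC.
Qed.

Lemma smooth_family_bound W psi n : smooth_family W psi ->
  loc_bounded W (fun i => derive1n n (psi i)).
Proof. by move=> h; exact: diff_family_bound. Qed.

Lemma smooth_family_smooth W psi i : smooth_family W psi -> W i -> smooth (psi i).
Proof.
move=> h Wi n t; elim: n psi {h}(h n.+1) t => [|n IH] psi.
  by move=> [_ [psi' [d _]]] t; have := d i Wi t => -[].
move=> [_ [psi' [d /IH {}IH]]] t; rewrite derive1Sn.
have -> : derive1 (psi i) = psi' i.
  by apply/funext => s; apply: is_derive1E; exact: d.
exact: IH.
Qed.

Lemma smooth_family_comp_affine W psi (a k : I -> R) (K : R) :
  (forall i, W i -> `|a i| <= K /\ `|k i| <= K) -> smooth_family W psi ->
  smooth_family W (fun i t => psi i (a i + k i * t)).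
Proof.
move=> aK h n; move: (h n) => {h}.
have lbC p : loc_bounded W p -> loc_bounded W (fun i t => p i (a i + k i * t)).
  move=> lp A; have [C hC] := lp (K + K * A); exists C => i Wi t tA; apply: hC => //.
  have [ha hk] := aK _ Wi.
  by rewrite (le_trans (ler_normD _ _))// lerD// normrM ler_pM.
elim: n psi => [|n IH] psi [lp h]; first by split=> //; exact: lbC.
split; first exact: lbC.
case: h => psi' [d h]; exists (fun i t => psi' i (a i + k i * t) * k i); split.
  move=> i Wi t; have h1 := d i Wi (a i + k i * t).
  have h2 : is_derive t (1:R) (fun s => a i + k i * s) (k i).
    exact: is_derive_affine.
  exact: (@is_derive1_comp _ (psi i) (fun s => a i + k i * s) t _ _ h1 h2).
apply: diff_familyM; first exact: IH.
by apply: (@smooth_family_cst _ k K) => i /aK[].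
Qed.

End SmoothFamilies.

Section Smooth.
Context {R : realType}.
Implicit Types (phi psi : R -> R).

Lemma smooth_derive1 phi : smooth phi -> smooth (derive1 phi).
Proof. by move=> h n x; rewrite -derive1Sn; exact: h. Qed.

Lemma smooth_is_derive phi (t : R) : smooth phi -> is_derive t 1 phi (derive1 phi t).
Proof.
move=> h; have := h 0%N t; rewrite derive1n0 => d.
by apply: DeriveDef => //; rewrite derive1E.
Qed.

Lemma smooth_continuous phi : smooth phi -> continuous phi.
Proof.
move=> h x; apply: differentiable_continuous; apply/derivable1_diffP.
exact: (h 0%N x).
Qed.

Lemma continuous_bounded_on phi (A : R) : continuous phi ->
  exists C : R, forall t, `|t| <= A -> `|phi t| <= C.
Proof.
move=> cphi; have [A0|A0] := ltP A 0.
  by exists 0 => t; rewrite leNgt (lt_le_trans A0).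
have AA : - A <= A by lra.
have cn : {within `[- A, A], continuous (fun t => `|phi t|)}.
  by apply: continuous_subspaceT => x; apply: continuous_comp; [exact: cphi|exact: norm_continuous].
have [c _ hc] := EVT_max AA cn.
exists `|phi c| => t tA; apply: hc; rewrite in_itv/=.
by rewrite -ler_norml.
Qed.

Lemma smooth_smooth_family I (W : set I) phi : smooth phi -> smooth_family W (fun _ => phi).
Proof.
move=> h n.
have lb (p : R -> R) : smooth p -> loc_bounded W (fun _ => p).
  move=> sp A; have [C hC] := continuous_bounded_on A (smooth_continuous sp).
  by exists C => i _; exact: hC.
elim: n phi h => [|n IH] phi h; first by split=> //; exact: lb.
split; first exact: lb.
exists (fun _ => derive1 phi); split; first by move=> _ _ t; exact: smooth_is_derive.
exact/IH/smooth_derive1.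
Qed.

(** A single function is a family over a one-point index set, so the closure properties of [smooth]
    are read off those of [smooth_family]. *)
Let T1 : set unit := setT.

Lemma smooth_cst (c : R) : smooth (fun _ => c).
Proof. by apply: (smooth_family_smooth (W := T1) (i := tt) (smooth_family_cst (c := fun=> c) (C := `|c|) _)). Qed.

Lemma smooth_id : smooth (fun t : R => t).
Proof. exact: (smooth_family_smooth (W := T1) (i := tt) (@smooth_family_id _ _ _)). Qed.

Lemma smoothD phi psi : smooth phi -> smooth psi -> smooth (fun t => phi t + psi t).
Proof.
by move=> h1 h2; apply: (smooth_family_smooth (W := T1) (i := tt)
  (smooth_familyD (smooth_smooth_family _ h1) (smooth_smooth_family _ h2))).
Qed.

Lemma smoothM phi psi : smooth phi -> smooth psi -> smooth (fun t => phi t * psi t).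
Proof.
by move=> h1 h2; apply: (smooth_family_smooth (W := T1) (i := tt)
  (smooth_familyM (smooth_smooth_family _ h1) (smooth_smooth_family _ h2))).
Qed.

Lemma smoothZ (a : R) phi : smooth phi -> smooth (fun t => a * phi t).
Proof. by move=> h; apply: (@smoothM (fun=> a) phi); [exact: smooth_cst|exact: h]. Qed.

Lemma smoothN phi : smooth phi -> smooth (fun t => - phi t).
Proof.
move=> h; have -> : (fun t => - phi t) = (fun t => -1 * phi t).
  by apply/funext => t; rewrite mulN1r.
exact: smoothZ.
Qed.

Lemma smoothB phi psi : smooth phi -> smooth psi -> smooth (fun t => phi t - psi t).
Proof. by move=> h1 h2; exact: (smoothD h1 (smoothN h2)). Qed.

Lemma smoothV phi (c : R) : 0 < c -> (forall t, c <= phi t) -> smooth phi ->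
  smooth (fun t => (phi t)^-1).
Proof.
move=> c0 hc h; apply: (smooth_family_smooth (W := T1) (i := tt)
  (smooth_familyV c0 _ (smooth_smooth_family _ h))) => //.
Qed.

Lemma smooth_comp_affine phi (a k : R) : smooth phi -> smooth (fun t => phi (a + k * t)).
Proof.
move=> h; apply: (smooth_family_smooth (W := T1) (i := tt)
  (@smooth_family_comp_affine _ _ _ _ (fun=> a) (fun=> k) (Num.max `|a| `|k|) _ (smooth_smooth_family _ h))) => //.
by move=> _ _; rewrite !le_max !lexx orbT.
Qed.

End Smooth.

Arguments smooth_cst {R} c.

(** * Smooth steps and plateaus built from [exp(-1/x)] *)

Section SmoothStep.
Context {R : realType}.

(* [flat k] is [x^-k exp(-1/x)] for [x > 0], extended by [0]; these functions are
   closed under differentiation up to linear combinations. *)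
Definition flat (k : nat) (x : R) : R := if 0 < x then x^-1 ^+ k * expR (- x^-1) else 0.

Lemma flat_ge0 k x : 0 <= flat k x.
Proof.
rewrite /flat; case: ifP => // x0; apply: mulr_ge0; last exact: expR_ge0.
by rewrite exprn_ge0// invr_ge0 ltW.
Qed.

Lemma flat_le0 k x : x <= 0 -> flat k x = 0.
Proof. by rewrite /flat leNgt => /negbTE ->. Qed.

(** From [exp u >= u^(k+1) / (k+1)!] at [u = 1/x]. The factor [|x|] gives continuity at [0], and
    through [flatM] the derivative there. *)
Lemma flat_le (k : nat) (x : R) : flat k x <= (k.+1)`!%:R * `|x|.
Proof.
have [x0|x0] := leP x 0; first by rewrite flat_le0// mulr_ge0// ?ler0n.
rewrite gtr0_norm// /flat x0 expRN.
have u0 : 0 < x^-1 by rewrite invr_gt0.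
have f0 : 0 < (k.+1)`!%:R :> R by rewrite ltr0n fact_gt0.
have h : x^-1 ^+ k.+1 / (k.+1)`!%:R <= expR x^-1.
  by rewrite (le_trans _ (expR_ge1Dxn k (ltW u0)))// lerDr ler01.
rewrite ler_pdivrMr ?expR_gt0//.
have -> : x^-1 ^+ k = (k.+1)`!%:R * x * (x^-1 ^+ k.+1 / (k.+1)`!%:R).
  rewrite exprS; field; apply/andP; split; last by rewrite gt_eqF.
  by rewrite gt_eqF.
by rewrite ler_pM2l// mulr_gt0.
Qed.

Lemma flatM k x : flat k x = flat k.+1 x * x.
Proof.
rewrite /flat; case: ifP => x0; last by rewrite mul0r.
by rewrite exprS; field; rewrite gt_eqF.
Qed.

Lemma is_derive_flat (k : nat) (x : R) :
  is_derive x 1 (flat k) (flat k.+2 x + (- k%:R) * flat k.+1 x).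
Proof.
have [x0|x0|->] := ltgtP x 0.
- rewrite !flat_le0 ?ltW// mulr0 addr0.
  have hc := is_derive_cst (0 : R) x (1 : R).
  apply: (near_eq_is_derive _ hc).
  by near=> y; rewrite flat_le0// ltW//; near: y; exact: lt_nbhsl.
- have u0 : x != 0 by rewrite gt_eqF.
  have hV : is_derive x 1 (fun y : R => y^-1) (- x^-1 ^+ 2).
    have := @is_deriveV R id x 1 1 u0 (is_derive_id x 1).
    by rewrite -exprVn /GRing.scale/= mulr1.
  have hX := @is_deriveX _ _ (fun y : R => y^-1) k x 1 _ hV.
  have hE : is_derive x 1 (fun y : R => expR (- y^-1)) (expR (- x^-1) * - (- x^-1 ^+ 2)).
    have hN := is_deriveN hV.
    exact: (@is_derive1_comp _ expR (fun y : R => - y^-1) x _ _ (is_derive_expR _) hN).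
  have hM := is_deriveM hX hE.
  have eX n (y : R) : ((fun y : R => y^-1) ^+ n) y = y^-1 ^+ n.
    by elim: n => [//|n IH]; rewrite !exprS -IH.
  suff <- : ((fun y : R => y^-1) ^+ k) x *: (expR (- x^-1) * - (- x^-1 ^+ 2)) +
      expR (- x^-1) *: ((k%:R * x^-1 ^+ k.-1) *: (- x^-1 ^+ 2)) =
      flat k.+2 x + - k%:R * flat k.+1 x.
    apply: (near_eq_is_derive _ hM); near=> y.
    have y0 : 0 < y by near: y; exact: lt_nbhsr.
    by rewrite /flat y0 -eX.
  rewrite /flat x0 /GRing.scale/= eX.
  case: (k) => [|n]; first by rewrite mul0r/= expr0; ring.
  rewrite /= !exprS; ring.
- rewrite !flat_le0// mulr0 addr0; apply/is_derive1_caratheodory.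
  exists (flat k.+1); split; last by rewrite flat_le0.
    by move=> z; rewrite (flat_le0 k (lexx 0)) !subr0 flatM.
  apply/cvgrPdist_lt => e e0; near=> y.
  rewrite (flat_le0 _ (lexx 0)) sub0r normrN ger0_norm ?flat_ge0//.
  apply: (le_lt_trans (flat_le _ _)).
  have f0 : 0 < (k.+2)`!%:R :> R by rewrite ltr0n fact_gt0.
  rewrite mulrC -ltr_pdivlMr//; near: y.
  exists (e / (k.+2)`!%:R) => /=; first by rewrite divr_gt0.
  by move=> y /=; rewrite sub0r normrN.
Unshelve. all: by end_near. Qed.

Lemma smooth_flat k : smooth (flat k).
Proof.
suff h n : forall k, diff_family (setT : set unit) n (fun=> flat k).
  by apply: (smooth_family_smooth (W := setT) (i := tt) (psi := fun=> flat k)).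
have lb j : loc_bounded (setT : set unit) (fun=> flat j).
  move=> A; exists ((j.+1)`!%:R * A) => _ _ t tA.
  rewrite ger0_norm ?flat_ge0// (le_trans (flat_le _ _))//.
  by rewrite ler_wpM2l// ler0n.
elim: n => [|n IH] j; first by split.
split=> //; exists (fun=> fun x => flat j.+2 x + (- j%:R) * flat j.+1 x).
split=> [_ _ t|]; first exact: is_derive_flat.
apply: diff_familyD => //; apply: diff_familyM => //.
by apply: (@smooth_family_cst _ _ _ (fun=> - j%:R) `|- j%:R|).
Qed.

Lemma flat0_ge (x : R) : 1 / 2 <= x -> expR (- 2) <= flat 0 x.
Proof.
move=> hx; have x0 : 0 < x by lra.
rewrite /flat x0 expr0 mul1r ler_expR lerN2.
by rewrite -[leRHS]invrK lef_pV2 ?posrE ?invr_gt0//; lra.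
Qed.

(** One of [x] and [1 - x] is at least [1/2]. A positive constant below the denominator of [ustep]
    is what [smoothV] asks for. *)
Let den_ge (x : R) : expR (- 2) <= flat 0 x + flat 0 (1 - x).
Proof.
have [h|h] := leP (1 / 2) x.
  by rewrite (le_trans (flat0_ge h))// lerDl flat_ge0.
have h' : 1 / 2 <= 1 - x by lra.
by rewrite (le_trans (flat0_ge h'))// lerDr flat_ge0.
Qed.

Definition ustep (x : R) : R := flat 0 x / (flat 0 x + flat 0 (1 - x)).

Definition step (u v t : R) : R := ustep ((t - u) / (v - u)).

Lemma step_ge0 u v t : 0 <= step u v t.
Proof. by rewrite /step /ustep divr_ge0 ?addr_ge0 ?flat_ge0. Qed.

Lemma step_le1 u v t : step u v t <= 1.
Proof.
rewrite /step /ustep; set x := _ / (v - u).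
have d0 : 0 < flat 0 x + flat 0 (1 - x) by rewrite (lt_le_trans _ (den_ge x))// expR_gt0.
by rewrite ler_pdivrMr// mul1r lerDl flat_ge0.
Qed.

Lemma step0 u v t : u < v -> t <= u -> step u v t = 0.
Proof.
move=> uv tu; rewrite /step /ustep flat_le0 ?mul0r//.
by rewrite pmulr_lle0 ?invr_gt0 ?subr_gt0// subr_le0.
Qed.

Lemma step1 u v t : u < v -> v <= t -> step u v t = 1.
Proof.
move=> uv vt; rewrite /step /ustep; set x := _ / (v - u).
have x1 : 1 <= x by rewrite ler_pdivlMr ?subr_gt0// mul1r lerD2r.
have -> : flat 0 (1 - x) = 0 by rewrite flat_le0// subr_le0.
have d0 : 0 < flat 0 x + flat 0 (1 - x) by rewrite (lt_le_trans _ (den_ge x))// expR_gt0.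
have e : flat 0 (1 - x) = 0 by rewrite flat_le0// subr_le0.
by rewrite e addr0 in d0; rewrite addr0 divff// gt_eqF.
Qed.

Lemma smooth_step u v : smooth (step u v).
Proof.
have hs : smooth (fun x => flat 0 x + flat 0 (1 - x)).
  apply: smoothD; first exact: smooth_flat.
  have -> : (fun x : R => flat 0 (1 - x)) = (fun x => flat 0 (1 + (-1) * x)).
    by apply/funext => x; rewrite mulN1r.
  exact/smooth_comp_affine/smooth_flat.
have hu : smooth ustep.
  apply: smoothM; first exact: smooth_flat.
  by apply: (smoothV (c := expR (- 2))) => //; exact: expR_gt0.
have -> : step u v = (fun t => ustep (- u / (v - u) + (v - u)^-1 * t)).
  by apply/funext => t; rewrite /step; congr ustep; ring.
exact: smooth_comp_affine.
Qed.

Definition plateau (a b c d t : R) : R := step a b t * (1 - step c d t).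

Lemma plateau_ge0 a b c d t : 0 <= plateau a b c d t.
Proof. by rewrite mulr_ge0 ?step_ge0// subr_ge0 step_le1. Qed.

Lemma plateau_le1 a b c d t : plateau a b c d t <= 1.
Proof. by rewrite mulr_ile1 ?step_ge0 ?step_le1 ?subr_ge0 ?step_le1// gerBl step_ge0. Qed.

Lemma plateau1 a b c d t : a < b -> c < d -> b <= t <= c -> plateau a b c d t = 1.
Proof. by move=> ab cd /andP[bt tc]; rewrite /plateau step1// step0// subr0 mulr1. Qed.

Lemma plateau0l a b c d t : a < b -> t <= a -> plateau a b c d t = 0.
Proof. by move=> ab ta; rewrite /plateau step0// mul0r. Qed.

Lemma plateau0r a b c d t : c < d -> d <= t -> plateau a b c d t = 0.
Proof. by move=> cd dt; rewrite /plateau [X in 1 - X]step1// subrr mulr0. Qed.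

Lemma smooth_plateau a b c d : smooth (plateau a b c d).
Proof.
apply: smoothM; first exact: smooth_step.
by apply: smoothB; [exact: smooth_cst|exact: smooth_step].
Qed.

End SmoothStep.

Arguments smooth_step {R} u v.
Arguments smooth_plateau {R} a b c d.

(** * Test functions and distributions *)

Section TestFunctions.
Context {R : realType}.
Implicit Types (phi psi : R -> R) (T : (R -> R) -> R).

Definition vanishes_off (a b : R) phi := forall t, ~~ (a <= t <= b) -> phi t = 0.

Lemma vanishes_offP a b phi : (forall t, t < a -> phi t = 0) ->
  (forall t, b < t -> phi t = 0) -> vanishes_off a b phi.
Proof. by move=> h1 h2 t; rewrite negb_and -!ltNge => /orP[/h1|/h2]. Qed.

Lemma vanishes_offl a b phi t : vanishes_off a b phi -> t < a -> phi t = 0.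
Proof. by move=> h ta; apply: h; rewrite negb_and -ltNge ta. Qed.

Lemma vanishes_offr a b phi t : vanishes_off a b phi -> b < t -> phi t = 0.
Proof. by move=> h ta; apply: h; rewrite negb_and -!ltNge ta orbT. Qed.

Lemma vanishes_offS a b a' b' phi : a' <= a -> b <= b' -> vanishes_off a b phi ->
  vanishes_off a' b' phi.
Proof.
move=> aa bb h; apply: vanishes_offP => t ht.
  by apply: (vanishes_offl h); exact: lt_le_trans aa.
by apply: (vanishes_offr h); exact: le_lt_trans ht.
Qed.

Lemma vanishes_offMl a b phi psi : vanishes_off a b phi ->
  vanishes_off a b (fun t => phi t * psi t).
Proof. by move=> h t ht; rewrite h// mul0r. Qed.

Lemma vanishes_offMr a b phi psi : vanishes_off a b psi ->
  vanishes_off a b (fun t => phi t * psi t).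
Proof. by move=> h t ht; rewrite h// mulr0. Qed.

Lemma vanishes_off_plateau a b c d : a < b -> c < d ->
  vanishes_off a d (plateau a b c d).
Proof.
move=> ab cd; apply: vanishes_offP => t ht; first by rewrite plateau0l ?ltW.
by rewrite plateau0r ?ltW.
Qed.

Lemma vanishes_off_supp a b phi : vanishes_off a b phi -> supp phi `<=` `[a, b].
Proof.
move=> h; apply: (@subset_trans _ (closure `[a, b])); last first.
  by rewrite -(iffLR (closure_id _))//; exact: interval_closed.
apply: closure_subset => t /= t0; rewrite in_itv/=; apply/negPn/negP => /h.
exact/eqP.
Qed.

Lemma supp_vanishes_off a b phi : supp phi `<=` `[a, b] -> vanishes_off a b phi.
Proof.
move=> h t ht; apply/eqP/negPn/negP => t0.
have : supp phi t by exact: subset_closure.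
by move/h => /=; rewrite in_itv/=; apply/negP.
Qed.

Lemma vanishes_off_test a b phi : smooth phi -> vanishes_off a b phi -> test_function phi.
Proof.
move=> sphi h; split=> //; apply: (subclosed_compact _ (@segment_compact _ a b)).
  exact: closed_closure.
exact: vanishes_off_supp.
Qed.

Lemma compact_in_segment (K : set R) : compact K ->
  exists A : R, 0 < A /\ K `<=` `[- A, A].
Proof.
move=> /compact_bounded/ex_strict_bound_gt0[A A0 hA]; exists A; split=> //.
by move=> x /hA /= xA; rewrite in_itv/= -ler_norml ltW.
Qed.

Lemma test_vanishes_off phi : test_function phi ->
  exists A : R, 0 < A /\ vanishes_off (- A) A phi.
Proof.
move=> [_ /compact_in_segment[A [A0 hA]]]; exists A; split=> //.
exact: supp_vanishes_off.
Qed.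

Lemma vanishes_off_derive1 a b phi : vanishes_off a b phi ->
  vanishes_off a b (derive1 phi).
Proof.
move=> h; apply: vanishes_offP => t ht; rewrite derive1E.
  rewrite (@near_eq_derive _ _ _ _ (cst 0)) ?derive_cst//; near=> s.
  by apply: (vanishes_offl h); near: s; exact: lt_nbhsl.
rewrite (@near_eq_derive _ _ _ _ (cst 0)) ?derive_cst//; near=> s.
by apply: (vanishes_offr h); near: s; exact: lt_nbhsr.
Unshelve. all: by end_near. Qed.

Lemma vanishes_off_derive1n a b phi n : vanishes_off a b phi ->
  vanishes_off a b (derive1n n phi).
Proof. by elim: n => [//|n IH] h; exact/vanishes_off_derive1/IH. Qed.

Definition dilate (a e : R) phi : R -> R := fun t => phi ((t - a) / e).

Lemma smooth_dilate phi (a e : R) : smooth phi -> smooth (dilate a e phi).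
Proof.
move=> h; have -> : dilate a e phi = (fun t => phi (- a / e + e^-1 * t)).
  by apply/funext => t; rewrite /dilate; congr phi; ring.
exact: smooth_comp_affine.
Qed.

Lemma vanishes_off_dilate phi (a e A : R) : e != 0 -> vanishes_off (- A) A phi ->
  vanishes_off (a - `|e| * A) (a + `|e| * A) (dilate a e phi).
Proof.
move=> e0 h t ht; apply: h; apply: contra ht; rewrite -ler_norml -ler_distl distrC.
rewrite normrM normfV ler_pdivrMr ?normr_gt0// mulrC.
by rewrite distrC.
Qed.

Lemma test_smooth phi : test_function phi -> smooth phi.
Proof. by case. Qed.

Lemma testM phi psi : test_function phi -> smooth psi ->
  test_function (fun t => phi t * psi t).
Proof.
move=> tphi spsi; have [A [_ v]] := test_vanishes_off tphi.
apply: (@vanishes_off_test (- A) A); last exact: vanishes_offMl.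
exact: smoothM (test_smooth tphi) spsi.
Qed.

Lemma testMr phi psi : test_function phi -> smooth psi ->
  test_function (fun t => psi t * phi t).
Proof.
move=> tphi spsi; have -> : (fun t => psi t * phi t) = (fun t => phi t * psi t).
  by apply/funext => t; rewrite mulrC.
exact: testM.
Qed.

Lemma testD phi psi : test_function phi -> test_function psi ->
  test_function (fun t => phi t + psi t).
Proof.
move=> tphi tpsi; have [A [_ v1]] := test_vanishes_off tphi.
have [B [_ v2]] := test_vanishes_off tpsi.
apply: (@vanishes_off_test (- (Num.max A B)) (Num.max A B)).
  exact: smoothD (test_smooth tphi) (test_smooth tpsi).
have w1 : vanishes_off (- (Num.max A B)) (Num.max A B) phi.
  by apply: vanishes_offS v1; rewrite ?lerN2 le_max lexx.
have w2 : vanishes_off (- (Num.max A B)) (Num.max A B) psi.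
  by apply: vanishes_offS v2; rewrite ?lerN2 le_max lexx orbT.
by move=> t ht; rewrite w1// w2// addr0.
Qed.

Lemma testZ (a : R) phi : test_function phi -> test_function (fun t => a * phi t).
Proof. by move=> h; apply: testMr => //; exact: smooth_cst. Qed.

Lemma testB phi psi : test_function phi -> test_function psi ->
  test_function (fun t => phi t - psi t).
Proof.
move=> h1 h2; have -> : (fun t => phi t - psi t) = (fun t => phi t + (-1) * psi t).
  by apply/funext => t; rewrite mulN1r.
exact: testD h1 (testZ (-1) h2).
Qed.

Lemma test_plateau (a b c d : R) : a < b -> c < d -> test_function (plateau a b c d).
Proof.
move=> ab cd; apply: (@vanishes_off_test a d); first exact: smooth_plateau.
exact: vanishes_off_plateau.
Qed.

Lemma test_dilate (a e : R) phi : e != 0 -> test_function phi ->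
  test_function (dilate a e phi).
Proof.
move=> e0 tphi; have [A [_ v]] := test_vanishes_off tphi.
apply: (vanishes_off_test _ (vanishes_off_dilate (a := a) e0 v)).
exact: smooth_dilate (test_smooth tphi).
Qed.

Section DistributionBasics.
Variable T : (R -> R) -> R.
Hypothesis dT : Defs.distribution T.

Lemma distr_lin a phi psi : test_function phi -> test_function psi ->
  T (fun x => a * phi x + psi x) = a * T phi + T psi.
Proof. by case: dT => h _; exact: h. Qed.

Lemma test0 : test_function (fun _ : R => 0 : R).
Proof. by apply: (@vanishes_off_test 0 0) => //; exact: smooth_cst. Qed.

Lemma distr0 : T (fun=> 0) = 0.
Proof.
have := distr_lin 1 test0 test0.
have -> : (fun _ : R => 1 * 0 + 0) = (fun=> 0 : R) by apply/funext => t; rewrite mulr0 addr0.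
by rewrite mul1r => /eqP; rewrite -subr_eq0 opprD addrA subrr sub0r oppr_eq0 => /eqP.
Qed.

Lemma distrD phi psi : test_function phi -> test_function psi ->
  T (fun x => phi x + psi x) = T phi + T psi.
Proof.
move=> h1 h2; rewrite -[T phi]mul1r -distr_lin//; congr T.
by apply/funext => t; rewrite mul1r.
Qed.

Lemma distrZ a phi : test_function phi -> T (fun x => a * phi x) = a * T phi.
Proof.
move=> h1; rewrite -[RHS]addr0 -distr0 -distr_lin//; last exact: test0.
by congr T; apply/funext => t; rewrite addr0.
Qed.

Lemma distrB phi psi : test_function phi -> test_function psi ->
  T (fun x => phi x - psi x) = T phi - T psi.
Proof.
move=> h1 h2; rewrite addrC -mulN1r -distr_lin//; congr T.
by apply/funext => t; rewrite mulN1r addrC.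
Qed.

(** Continuity for one fixed sequence [K] of bounds on the derivatives, homogeneous in [s]. In
    [uniform_boundedness] the tail of a series satisfies it with a small [s]. *)
Lemma distr_bound (A : R) (K : nat -> R) : exists B : R, 0 <= B /\
  forall (s : R) phi, 0 <= s -> smooth phi -> vanishes_off (- A) A phi ->
  (forall n t, `|derive1n n phi t| <= s * K n) -> `|T phi| <= s * B.
Proof.
case: dT => _ /(_ _ (@segment_compact _ (- A) A))[C [N hC]].
exists (`|C| * \sum_(k < N.+1) `|K k|); split.
  by rewrite mulr_ge0// sumr_ge0.
move=> s phi s0 sphi vphi hphi.
apply: (le_trans (hC _ (vanishes_off_test sphi vphi) (vanishes_off_supp vphi))).
have sn k : 0 <= sup_norm (derive1n k phi) <= s * `|K k|.
  have le t : `|derive1n k phi t| <= s * `|K k|.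
    by rewrite (le_trans (hphi _ _))// ler_wpM2l// ler_norm.
  apply/andP; split.
    apply: (@le_trans _ _ `|derive1n k phi 0|) => //.
    apply: ub_le_sup; last by exists 0.
    by exists (s * `|K k|) => _ [t _ <-].
  apply: ge_sup; first by exists `|derive1n k phi 0|; exists 0.
  by move=> _ [t _ <-].
apply: (@le_trans _ _ (`|C| * \sum_(k < N.+1) sup_norm (derive1n k phi))).
  apply: ler_wpM2r; last exact: ler_norm.
  by apply: sumr_ge0 => k _; case/andP: (sn k).
rewrite mulrCA ler_wpM2l// mulr_sumr; apply: ler_sum => k _.
by case/andP: (sn k).
Qed.

(** Derivatives vanish off [[- A, A]] too, so the local bounds become global. *)
Lemma smooth_family_bound_off I (W : set I) (psi : I -> R -> R) (A : R) :
  smooth_family W psi -> (forall i, W i -> vanishes_off (- A) A (psi i)) ->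
  exists K : nat -> R, forall i, W i -> forall n t, `|derive1n n (psi i) t| <= K n.
Proof.
move=> hs hv.
have h n : exists C : R, forall i, W i -> forall t, `|derive1n n (psi i) t| <= C.
  have [C hC] := smooth_family_bound n hs A; exists (Num.max C 0) => i Wi t.
  have [tA|tA] := leP `|t| A; first by rewrite le_max hC.
  rewrite (vanishes_off_derive1n n (hv i Wi)) ?normr0 ?le_max ?lexx ?orbT//.
  by rewrite -ler_norml -ltNge.
by exists (fun n => projT1 (cid (h n))) => i Wi n t; case: cid => C /=; exact.
Qed.

Lemma distr_family_bound I (W : set I) (psi : I -> R -> R) (A : R) :
  smooth_family W psi -> (forall i, W i -> vanishes_off (- A) A (psi i)) ->
  exists B : R, 0 <= B /\ forall i, W i -> `|T (psi i)| <= B.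
Proof.
move=> hs hv; have [K hK] := smooth_family_bound_off hs hv.
have [B [B0 hB]] := distr_bound A K; exists B; split=> // i Wi.
rewrite -[B]mul1r; apply: hB => //; first exact: smooth_family_smooth hs Wi.
  exact: hv.
by move=> n t; rewrite mul1r; exact: hK.
Qed.

End DistributionBasics.

(** The radius is enlarged by [1] because [supp] is a closure: [phi] has to vanish in a
    neighbourhood of [K], not just on it. *)
Lemma compactly_supportedP T : compactly_supported T ->
  exists A : R, 0 < A /\ forall phi, test_function phi ->
    (forall t, `|t| < A -> phi t = 0) -> T phi = 0.
Proof.
case=> K /compact_in_segment[A [A0 hA]] hT.
exists (A + 1); split; first by rewrite ltr_wpDl// ltW.
move=> phi tphi h; apply: hT => //; apply/seteqP; split=> // x [sx /hA/=].
rewrite in_itv/= -ler_norml => xA.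
have : nbhs x [set t : R | `|t| < A + 1].
  exists 1 => //= y /= xy; have := ler_normB x (x - y); rewrite opprB addrC subrK => h1.
  by rewrite (le_lt_trans h1)// ler_ltD.
move/sx => -[t [/= t0 ht]]; move: t0; rewrite h//.
by rewrite eqxx.
Qed.

Definition pos_on T (c d : R) := forall phi, smooth phi -> (forall t, 0 <= phi t) ->
  vanishes_off c d phi -> 0 <= T phi.

Lemma pos_onS T c d c' d' : c <= c' -> d' <= d -> pos_on T c d -> pos_on T c' d'.
Proof. by move=> cc dd h phi h1 h2 h3; apply: h => //; exact: vanishes_offS h3. Qed.

(** A smooth step splits a nonnegative test function into two nonnegative ones, so positivity on
    [[c, s1]] extends across an overlapping good interval ([ext]). Hence the supremum of the [s]
    with [pos_on T c s] cannot stop before [d]. *)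
Lemma pos_on_glue T (c d : R) : Defs.distribution T ->
  (forall x, c <= x <= d -> exists2 e : R, 0 < e & pos_on T (x - e) (x + e)) -> pos_on T c d.
Proof.
move=> dT hx; have [cd|cd] := ltP d c.
  move=> phi sphi _ vphi; have -> : phi = (fun=> 0); last by rewrite (distr0 dT).
  apply/funext => t; apply: vphi; apply/negP => /andP[ct td].
  by move: cd; rewrite ltNge (le_trans ct).
pose P := [set s | c <= s <= d /\ pos_on T c s].
have ext (x e s1 : R) : c <= x <= d -> 0 < e -> pos_on T (x - e) (x + e) -> x - e < s1 ->
    pos_on T c s1 -> pos_on T c (x + e).
  move=> xcd e0 pe s1x p1 phi sphi phi0 vphi.
  have sst := smooth_step (x - e) s1.
  have s1st : smooth (fun t => 1 - step (x - e) s1 t).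
    exact (smoothB (smooth_cst 1) sst).
  have v1 : vanishes_off c s1 (fun t => phi t * (1 - step (x - e) s1 t)).
    apply: vanishes_offP => t ht; first by rewrite (vanishes_offl vphi)// mul0r.
    by rewrite step1 ?subrr ?mulr0// ltW.
  have v2 : vanishes_off (x - e) (x + e) (fun t => phi t * step (x - e) s1 t).
    apply: vanishes_offP => t ht; first by rewrite step0 ?mulr0// ltW.
    by rewrite (vanishes_offr vphi)// mul0r.
  have sm1 := smoothM sphi s1st; have sm2 := smoothM sphi sst.
  have -> : phi = (fun t => phi t * (1 - step (x - e) s1 t) + phi t * step (x - e) s1 t).
    by apply/funext => t; rewrite -mulrDr subrK mulr1.
  rewrite (distrD dT); last 2 first.
    exact: vanishes_off_test sm1 v1.
    exact: vanishes_off_test sm2 v2.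
  apply: addr_ge0.
    by apply: p1 => // t; rewrite mulr_ge0// subr_ge0 step_le1.
  by apply: pe => // t; rewrite mulr_ge0// step_ge0.
have Pc : P c.
  split; first by rewrite lexx cd.
  move=> phi sphi phi0 vphi.
  have [e e0 pe] := hx c (introT andP (conj (lexx c) cd)).
  by apply: pe => //; apply: vanishes_offS vphi; rewrite ?gerBl ?lerDl ltW.
have bP : has_sup P by split; [exists c|exists d => s [/andP[]]].
set s := sup P.
have scd : c <= s <= d.
  apply/andP; split; first by apply: ub_le_sup => //; case: bP.
  by apply: ge_sup; [exists c|move=> u [/andP[]]].
have [e e0 pe] := hx s scd.
have [s1 [s1cd p1] ss1] := sup_adherent e0 bP.
have pse : pos_on T c (s + e) by exact: (ext s e s1).
have [dse|sed] := leP d (s + e); first exact: pos_onS pse.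
have : P (s + e).
  split=> //; rewrite (ltW sed) andbT; case/andP: scd => cs _.
  by rewrite (le_trans cs)// lerDl ltW.
have [_ ubP] := bP; move=> /(ub_le_sup ubP).
by rewrite -/s gerDl leNgt e0.
Qed.

End TestFunctions.

(** * Uniform boundedness on test functions *)

Section GlidingHump.
Context {R : realType}.
Implicit Types (phi g : R -> R).

Lemma mvt_between g (g' : R -> R) (s t : R) : (forall u, is_derive u (1 : R) g (g' u)) ->
  exists2 u, `|u - t| <= `|s - t| & g s - g t = g' u * (s - t).
Proof.
move=> dg.
have cg : continuous g.
  by move=> x; apply: differentiable_continuous; apply/derivable1_diffP; case: (dg x).
have [st|ts] := leP t s.
  have [u] := @MVT_segment R g g' t s st (fun x _ => dg x) (continuous_subspaceT cg).
  rewrite in_itv/= => /andP[tu us] e; exists u => //.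
  by rewrite !ger0_norm ?subr_ge0// lerD2r.
have [u] := @MVT_segment R g g' s t (ltW ts) (fun x _ => dg x) (continuous_subspaceT cg).
rewrite in_itv/= => /andP[su ut] e; exists u; last by rewrite -opprB e -mulrN opprB.
by rewrite !ler0_norm ?subr_le0 ?(ltW ts)// !opprB lerD2l lerN2.
Qed.

Lemma taylor_bound g (g' g'' : R -> R) (K s t : R) :
  (forall u, is_derive u (1 : R) g (g' u)) -> (forall u, is_derive u (1 : R) g' (g'' u)) ->
  (forall u, `|g'' u| <= K) -> `|g s - g t - (s - t) * g' t| <= K * `|s - t| ^+ 2.
Proof.
move=> d1 d2 hK; have [u us ->] := mvt_between s t d1.
have [w wu e] := mvt_between u t d2.
rewrite mulrC -mulrBr e normrM normrM mulrC expr2 mulrA ler_wpM2r//.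
by rewrite ler_pM.
Qed.

(** Second-order error bounds add up over the terms of a series, so this criterion gives
    term-by-term differentiation in [is_derive_fast_series]. *)
Lemma is_derive_quadratic g (t d K : R) :
  (forall s, `|g s - g t - (s - t) * d| <= K * `|s - t| ^+ 2) -> is_derive t 1 g d.
Proof.
move=> h; apply/is_derive1_caratheodory.
exists (fun s => if s == t then d else (g s - g t) / (s - t)); split; last by rewrite eqxx.
  move=> s; case: eqP => [->|/eqP st]; first by rewrite !subrr mulr0.
  by rewrite divfK// subr_eq0.
apply/cvgrPdist_lt => e e0; rewrite eqxx.
have K0 : 0 < `|K| + 1 by rewrite ltr_wpDl.
exists (e / (`|K| + 1)) => /=; first by rewrite divr_gt0.
move=> s /= st; case: eqP => [_|/eqP sneq]; first by rewrite subrr normr0.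
have st0 : 0 < `|s - t| by rewrite normr_gt0 subr_eq0.
have -> : d - (g s - g t) / (s - t) = - (g s - g t - (s - t) * d) / (s - t).
  by field; rewrite subr_eq0.
rewrite normrM normrN normfV ltr_pdivrMr//; apply: (le_lt_trans (h s)).
rewrite expr2 mulrA ltr_pM2r// distrC.
apply: (@le_lt_trans _ _ (`|K| * `|t - s|)); first by rewrite ler_wpM2r ?ler_norm.
apply: (@le_lt_trans _ _ ((`|K| + 1) * `|t - s|)).
  by rewrite ler_wpM2r// lerDl.
by rewrite mulrC -ltr_pdivlMr.
Qed.

Lemma cvg_norm_le (u : nat -> R) (l C : R) : u @ \oo --> l -> (forall m, `|u m| <= C) ->
  `|l| <= C.
Proof.
move=> ul uC; have h : (fun m => `|u m|) @ \oo --> `|l| by exact: cvg_norm.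
by rewrite -(cvg_lim _ h)//; apply: limr_le; [by apply/cvg_ex; exists (`|l|)|exact: nearW].
Qed.

(** * Rapidly convergent series of test functions, and the gliding hump *)

Section Series.
Variables (K : nat -> R).
Implicit Types (c : nat -> R) (psi : nat -> R -> R).

Let fast c := (forall j, 0 <= c j) /\ (forall j, c j.+1 <= c j / 2).
Let cls phi := smooth phi /\ (forall n t, `|derive1n n phi t| <= K n).

Let fastS c : fast c -> fast (fun j => c j.+1).
Proof. by case=> h1 h2; split=> j. Qed.

Let K_ge0 phi n : cls phi -> 0 <= K n.
Proof. by case=> _ /(_ n 0); apply: le_trans. Qed.

Let term c psi n t := fun j => c j * derive1n n (psi j) t.

(** The formal [n]-th derivative of the sum of the [c j * psi j]; [derive1n_fast_series] shows that
    it is the actual one. *)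
Definition fast_series c psi n (t : R) : R := limn (series (term c psi n t)).

Let series_fast c m : fast c -> \sum_(0 <= j < m) c j <= 2 * c 0%N.
Proof.
move=> fc; suff : \sum_(0 <= j < m) c j + 2 * c m <= 2 * c 0%N.
  by apply: le_trans; rewrite lerDl mulr_ge0//; case: fc.
elim: m => [|m IH]; first by rewrite big_nil add0r.
rewrite big_nat_recr//= (le_trans _ IH)// -addrA lerD2l.
by have [_ /(_ m)] := fc; lra.
Qed.

Let series_term_le c psi n t m : fast c -> (forall j, cls (psi j)) ->
  \sum_(0 <= j < m) `|term c psi n t j| <= 2 * c 0%N * K n.
Proof.
move=> fc hpsi; apply: (@le_trans _ _ (\sum_(0 <= j < m) c j * K n)).
  apply: ler_sum => j _; rewrite /term normrM (ger0_norm (fc.1 j)) ler_wpM2l//.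
    exact: fc.1.
  by case: (hpsi j).
by rewrite -mulr_suml ler_wpM2r ?series_fast// (K_ge0 _ (hpsi 0%N)).
Qed.

Let cvg_fast c psi n t : fast c -> (forall j, cls (psi j)) ->
  series (term c psi n t) @ \oo --> fast_series c psi n t.
Proof.
move=> fc hpsi; have : cvgn (series (term c psi n t)); last by [].
apply: normed_cvg; apply: nondecreasing_is_cvgn.
  by apply: nondecreasing_series => j _ /=.
by exists (2 * c 0%N * K n) => _ [m _ <-]; exact: series_term_le.
Qed.

Lemma fast_series_le c psi n t : fast c -> (forall j, cls (psi j)) ->
  `|fast_series c psi n t| <= 2 * c 0%N * K n.
Proof.
move=> fc hpsi; apply: (cvg_norm_le (@cvg_fast c psi n t fc hpsi)) => m.
by apply: (le_trans (ler_norm_sum _ _ _)); exact: series_term_le.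
Qed.

Lemma fast_seriesS c psi n t : fast c -> (forall j, cls (psi j)) ->
  fast_series c psi n t = c 0%N * derive1n n (psi 0%N) t +
    fast_series (fun j => c j.+1) (fun j => psi j.+1) n t.
Proof.
move=> fc hpsi.
have h1 := @cvg_fast c psi n t fc hpsi.
have h2 := @cvg_fast _ (fun j => psi j.+1) n t (fastS fc) (fun j => hpsi j.+1).
have h3 : series (term c psi n t) @ \oo --> c 0%N * derive1n n (psi 0%N) t +
    fast_series (fun j => c j.+1) (fun j => psi j.+1) n t.
  rewrite -(cvg_shiftn 1%N).
  have -> : (fun m => series (term c psi n t) (m + 1)%N) = (fun m => term c psi n t 0%N +
      series (term (fun j => c j.+1) (fun j => psi j.+1) n t) m).
    by apply/funext => m; rewrite addn1 /series/= big_nat_recl.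
  by apply: cvgD => //; exact: cvg_cst.
by rewrite -(cvg_lim _ h1)//; apply: cvg_lim.
Qed.

Lemma is_derive_fast_series c psi n (t : R) : fast c -> (forall j, cls (psi j)) ->
  is_derive t (1 : R) (fast_series c psi n) (fast_series c psi n.+1 t).
Proof.
move=> fc hpsi; apply: (@is_derive_quadratic _ _ _ (2 * c 0%N * K n.+2)) => s.
have h := cvgB (cvgB (@cvg_fast c psi n s fc hpsi) (@cvg_fast c psi n t fc hpsi))
  (cvgMl_tmp (a := s - t) (@cvg_fast c psi n.+1 t fc hpsi)).
apply: (cvg_norm_le (h _ _ _)) => m.
have -> : (series (term c psi n s) - series (term c psi n t) -
    (fun x : nat => (s - t) * series (term c psi n.+1 t) x)) m =
    \sum_(0 <= j < m) (term c psi n s j - term c psi n t j - (s - t) * term c psi n.+1 t j).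
  by rewrite sumrB -mulr_sumr sumrB.
apply: (le_trans (ler_norm_sum _ _ _)).
apply: (@le_trans _ _ (\sum_(0 <= j < m) c j * (K n.+2 * `|s - t| ^+ 2))).
  apply: ler_sum => j _; rewrite /term.
  have -> : c j * derive1n n (psi j) s - c j * derive1n n (psi j) t -
      (s - t) * (c j * derive1n n.+1 (psi j) t) =
      c j * (derive1n n (psi j) s - derive1n n (psi j) t - (s - t) * derive1n n.+1 (psi j) t).
    by ring.
  have [sp Kp] := hpsi j.
  rewrite normrM (ger0_norm (fc.1 j)) ler_wpM2l//; first exact: fc.1.
  have d k u : is_derive u (1 : R) (derive1n k (psi j)) (derive1n k.+1 (psi j) u).
    by apply: DeriveDef; [exact: sp|rewrite derive1nS derive1E].
  by apply: (taylor_bound s t (d n) (d n.+1)) => u; exact: Kp.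
rewrite -mulr_suml mulrA ler_wpM2r ?exprn_ge0// -mulrA mulrA.
by rewrite ler_wpM2r ?series_fast// (K_ge0 _ (hpsi 0%N)).
Qed.

Lemma derive1n_fast_series c psi n : fast c -> (forall j, cls (psi j)) ->
  derive1n n (fast_series c psi 0) = fast_series c psi n.
Proof.
move=> fc hpsi; elim: n => [//|n IH]; rewrite derive1nS IH.
by apply/funext => t; apply: is_derive1E; exact: is_derive_fast_series.
Qed.

Lemma smooth_fast_series c psi : fast c -> (forall j, cls (psi j)) ->
  smooth (fast_series c psi 0).
Proof.
move=> fc hpsi n x; rewrite derive1n_fast_series//.
by have [] := @is_derive_fast_series c psi n x fc hpsi.
Qed.

Lemma vanishes_off_fast_series c psi a b : fast c -> (forall j, cls (psi j)) ->
  (forall j, vanishes_off a b (psi j)) -> vanishes_off a b (fast_series c psi 0).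
Proof.
move=> fc hpsi hv t ht; have h := @cvg_fast c psi 0 t fc hpsi.
have e : series (term c psi 0 t) = (fun=> 0).
  apply/funext => m; rewrite /series/= big1// => j _.
  by rewrite /term derive1n0 (hv j)// mulr0.
by rewrite -(cvg_lim _ h)// e; apply: lim_cst.
Qed.

(* Gliding hump: otherwise a rapidly convergent sum of test functions, chosen one after
   the other, would contradict pointwise boundedness. *)
Lemma uniform_boundedness (I : Type) (L : I -> (R -> R) -> R) (A : R) :
  (forall i (a : R) phi (psi : R -> R), test_function phi -> test_function psi ->
     L i (fun x => a * phi x + psi x) = a * L i phi + L i psi) ->
  (forall i, exists B : R, 0 <= B /\ forall (s : R) phi, 0 <= s -> smooth phi -> vanishes_off (- A) A phi ->
     (forall n t, `|derive1n n phi t| <= s * K n) -> `|L i phi| <= s * B) ->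
  (forall phi, smooth phi -> vanishes_off (- A) A phi ->
     exists M : R, forall i, `|L i phi| <= M) ->
  exists M : R, forall i phi, smooth phi -> vanishes_off (- A) A phi ->
    (forall n t, `|derive1n n phi t| <= K n) -> `|L i phi| <= M.
Proof.
move=> Llin Lcont Lbdd; apply: contrapT => unbdd.
pose ok phi := [/\ smooth phi, vanishes_off (- A) A phi &
  forall n t, `|derive1n n phi t| <= K n].
have big (M : R) : {ip : I * (R -> R) | ok ip.2 /\ M < `|L ip.1 ip.2|}.
  apply: cid; apply: contrapT => no; apply: unbdd; exists M => i phi h1 h2 h3.
  by rewrite leNgt; apply/negP => h; apply: no; exists (i, phi).
pose B i := sval (cid (Lcont i)).
have B0 i : 0 <= B i by rewrite /B; case: cid => b [].
have hB i (s : R) phi : 0 <= s -> smooth phi -> vanishes_off (- A) A phi ->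
    (forall n t, `|derive1n n phi t| <= s * K n) -> `|L i phi| <= s * B i.
  by rewrite /B; case: cid => b []/= _; apply.
have /choice[Mf hMf] : forall phi, exists M : R, ok phi -> forall i, `|L i phi| <= M.
  move=> phi; have [[h1 h2 h3]|no] := pselect (ok phi); last by exists 0.
  by have [M hM] := Lbdd _ h1 h2; exists M.
(* The state is [(c k, m k)]: the next coefficient, and a bound, valid for every [L i], on the
   contribution of the earlier humps. The new hump has to exceed [m k], the tail, which will be at
   most [1], and still [k + 1] more. *)
pose nxt k (s : R * R) := sval (big ((k.+2%:R + s.2) / s.1)).
(* Dividing by [2 * (1 + B)] makes the later terms contribute at most [2 * c k.+1 * B <= 1] to the
   functional just chosen, and halves the coefficients, as [fast] requires. *)
pose st := fix st k : R * R := if k is k'.+1 then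
  let ip := nxt k' (st k') in
  ((st k').1 / (2 * (1 + B ip.1)), (st k').2 + (st k').1 * Mf ip.2) else (1, 0).
pose c k := (st k).1; pose m k := (st k).2.
pose ii k := (nxt k (st k)).1; pose pp k := (nxt k (st k)).2.
have cS k : c k.+1 = c k / (2 * (1 + B (ii k))) by [].
have mS k : m k.+1 = m k + c k * Mf (pp k) by [].
have Bp i : 0 < 1 + B i by rewrite ltr_pwDl.
have c_gt0 k : 0 < c k.
  elim: k => [|k IH]; first exact: ltr01.
  by rewrite cS divr_gt0// mulr_gt0.
have [okp bigp] : (forall k, ok (pp k)) /\ (forall k, (k.+2%:R + m k) / c k < `|L (ii k) (pp k)|).
  by split=> k; have [] := svalP (big ((k.+2%:R + (st k).2) / (st k).1)).
have clsp k : cls (pp k) by case: (okp k).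
have cle k : c k.+1 <= c k / 2.
  rewrite cS ler_wpM2l ?(ltW (c_gt0 k))// lef_pV2 ?posrE ?mulr_gt0//.
  by rewrite ler_peMr// lerDl.
have c_le1 k : c k <= 1.
  by elim: k => [//|k IH]; rewrite (le_trans (cle k))//; have := c_gt0 k; lra.
pose ck k := fun j => c (k + j)%N; pose pk k := fun j => pp (k + j)%N.
have fk k : fast (ck k) by split=> j; [exact/ltW/c_gt0|rewrite /ck addnS].
have hk k j : cls (pk k j) by exact: clsp.
pose S k := fast_series (ck k) (pk k) 0.
have sS k : smooth (S k) by exact: smooth_fast_series.
have vS k : vanishes_off (- A) A (S k).
  by apply: vanishes_off_fast_series => // j; case: (okp (k + j)%N).
have tS k : test_function (S k) by exact: vanishes_off_test (sS k) (vS k).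
have tp k : test_function (pp k) by case: (okp k) => h1 h2 _; exact: vanishes_off_test h1 h2.
have LS i k : L i (S k) = c k * L i (pp k) + L i (S k.+1).
  rewrite -Llin//; congr (L i _); apply/funext => t.
  rewrite /S fast_seriesS//; congr (_ + _); first by rewrite /ck /pk addn0.
  by congr fast_series; apply/funext => j; rewrite /ck /pk addnS addSn.
have L0 i k : `|L i (S 0%N) - L i (S k)| <= m k.
  elim: k => [|k IH]; first by rewrite subrr normr0.
  rewrite mS; have -> : L i (S 0%N) - L i (S k.+1) =
      (L i (S 0%N) - L i (S k)) + c k * L i (pp k) by rewrite (LS i k); ring.
  rewrite (le_trans (ler_normD _ _))// lerD// normrM (gtr0_norm (c_gt0 k)).
  by rewrite ler_wpM2l ?(ltW (c_gt0 k))//; exact: hMf.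
have tail k : `|L (ii k) (S k.+1)| <= 1.
  have h : `|L (ii k) (S k.+1)| <= (2 * c k.+1) * B (ii k).
    apply: hB => //; first by rewrite mulr_ge0// ltW.
    move=> n t; rewrite /S derive1n_fast_series//.
    by have := @fast_series_le (ck k.+1) (pk k.+1) n t (fk _) (hk _); rewrite /ck addn0.
  apply: (le_trans h); rewrite cS.
  have -> : 2 * (c k / (2 * (1 + B (ii k)))) * B (ii k) = c k * (B (ii k) / (1 + B (ii k))).
    by field; rewrite gt_eqF.
  rewrite mulr_ile1 ?(ltW (c_gt0 k))//; first by rewrite divr_ge0// ltW.
  by rewrite ler_pdivrMr// mul1r lerDr.
have [M hM] := Lbdd _ (sS 0%N) (vS 0%N).
(* At this index the hump is larger than [k + 2 + m k], although it is at most [M + m k + 1]. *)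
pose k := (Num.truncn `|M|).+1.
have hk1 : `|M| < k%:R by rewrite truncnS_gt.
have big1 : k.+2%:R + m k < c k * `|L (ii k) (pp k)|.
  by have := bigp k; rewrite ltr_pdivrMr// mulrC.
have := L0 (ii k) k; rewrite (LS (ii k) k) => h1.
have h2 := tail k; have h3 := hM (ii k).
have h4 : c k * `|L (ii k) (pp k)| = `|c k * L (ii k) (pp k)| by rewrite normrM (gtr0_norm (c_gt0 k)).
have h5 : `|c k * L (ii k) (pp k)| <= `|L (ii k) (S 0%N) - (c k * L (ii k) (pp k) + L (ii k) (S k.+1))| +
    `|L (ii k) (S 0%N)| + `|L (ii k) (S k.+1)|.
  have -> : c k * L (ii k) (pp k) = - (L (ii k) (S 0%N) - (c k * L (ii k) (pp k) + L (ii k) (S k.+1)))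
    + L (ii k) (S 0%N) - L (ii k) (S k.+1) by ring.
  rewrite (le_trans (ler_normB _ _))// lerD2r (le_trans (ler_normD _ _))// normrN.
  by have -> : - (L (ii k) (S 0%N) - (c k * L (ii k) (pp k) + L (ii k) (S k.+1))) + L (ii k) (S 0%N) - L (ii k) (S k.+1) = c k * L (ii k) (pp k) by ring.
have h6 : k.+2%:R = k%:R + 2 :> R by rewrite -addn2 natrD.
have h7 := ler_norm M.
lra.
Qed.

End Series.
End GlidingHump.

(** * Uniform consequences of the scaling limit at a point *)

Section Dilations.
Context {R : realType}.
Implicit Types (phi psi : R -> R).

Lemma derive1n_dilate (a e : R) phi n : smooth phi ->
  derive1n n (dilate a e phi) = fun t => e^-1 ^+ n * derive1n n phi ((t - a) / e).
Proof.
move=> sphi; elim: n => [|n IH]; first by apply/funext => t; rewrite expr0 mul1r.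
rewrite derive1nS IH; apply/funext => t; apply: is_derive1E.
have d1 : is_derive ((t - a) / e) (1 : R) (derive1n n phi) (derive1n n.+1 phi ((t - a) / e)).
  by apply: DeriveDef; [exact: sphi|rewrite derive1nS derive1E].
have d2 : is_derive t (1 : R) (fun s => (s - a) / e) e^-1.
  have -> : (fun s => (s - a) / e) = (fun s => - a / e + e^-1 * s).
    by apply/funext => s; ring.
  exact: is_derive_affine.
have d3 := @is_derive1_comp _ (derive1n n phi) (fun s => (s - a) / e) t _ _ d1 d2.
have d4 := is_deriveZ (e^-1 ^+ n) d3.
have e4 : e^-1 ^+ n *: (derive1n n.+1 phi ((t - a) / e) * e^-1) =
    e^-1 ^+ n.+1 * derive1n n.+1 phi ((t - a) / e).
  by rewrite /GRing.scale/= exprSr; ring.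
by rewrite e4 in d4.
Qed.

Section ScalingLimit.
Variables (f : (R -> R) -> R) (a : R).
Hypothesis f_distr : Defs.distribution f.
Hypothesis f_compact : compactly_supported f.
Hypothesis f_scaling : forall phi, test_function phi ->
  f (dilate a e phi) @[e --> (0 : R)^'] --> (0 : R).

(** [uniform_boundedness] for the functionals [f (dilate a e _)] over all [e != 0]. For one [phi]
    they are bounded: the scaling limit covers small [e]. For [|e| >= d], multiplying by a cutoff
    [chi] does not change the value, as [f] has compact support, and [1 / e] stays bounded, so the
    functions form a bounded family. *)
Lemma dilation_bounded (A : R) (K : nat -> R) : exists M : R, 0 <= M /\
  forall e phi, e != 0 -> smooth phi -> vanishes_off (- A) A phi ->
    (forall n t, `|derive1n n phi t| <= K n) -> `|f (dilate a e phi)| <= M.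
Proof.
pose I := {e : R | e != 0}; pose L (i : I) phi := f (dilate a (sval i) phi).
have [|||M hM] := @uniform_boundedness R K I L A.
- move=> [e e0] c phi psi tphi tpsi; rewrite /L /=.
  by rewrite -(distr_lin f_distr)//; exact: test_dilate.
- move=> [e e0]; rewrite /L /=.
  have [B [B0 hB]] := distr_bound f_distr (`|a| + `|e| * A) (fun n => `|e^-1 ^+ n| * K n).
  exists B; split=> [//|s phi s0 sphi vphi hphi]; apply: hB; first exact: s0.
  + exact: smooth_dilate.
  + apply: vanishes_offS (vanishes_off_dilate (a := a) e0 vphi).
      by have := ler_norm (- a); rewrite normrN; lra.
    by have := ler_norm a; lra.
  + move=> n t; rewrite derive1n_dilate// normrM mulrCA ler_wpM2l//.
- move=> phi sphi vphi.
  have [A0 [A00 hA0]] := compactly_supportedP f_compact.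
  have /cvgrPdist_le/(_ 1 ltr01)[d /= d0 hd] := f_scaling (vanishes_off_test sphi vphi).
  pose chi := plateau (- A0 - 1) (- A0) A0 (A0 + 1) : R -> R.
  have c1 : - A0 - 1 < - A0 by lra.
  have c2 : A0 < A0 + 1 by lra.
  have schi : smooth chi := smooth_plateau _ _ _ _.
  have [B [B0 hB]] : exists B : R, 0 <= B /\ forall e, [set e : R | d <= `|e|] e ->
      `|f (fun t => chi t * dilate a e phi t)| <= B.
    apply: (@distr_family_bound _ _ f_distr _ _ _ (A0 + 1)).
      apply: smooth_familyM; first exact: smooth_smooth_family.
      apply: (@smooth_family_ext _ _ _ (fun e t => phi (- a / e + e^-1 * t))).
        by move=> e _; apply/funext => t; rewrite /dilate; congr phi; ring.
      apply: (@smooth_family_comp_affine _ _ _ (fun=> phi) _ _ (`|a| * d^-1 + d^-1)); last first.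
        exact: smooth_smooth_family.
      move=> e /= de.
      have h : `|e^-1| <= d^-1.
        by rewrite normfV lef_pV2 ?posrE// (lt_le_trans d0).
      split; last by rewrite (le_trans h)// lerDr mulr_ge0// invr_ge0 ltW.
      rewrite normrM normrN (@le_trans _ _ (`|a| / d))// ?ler_wpM2l// lerDl invr_ge0 ltW//.
    move=> e _; apply: vanishes_offMl; have := vanishes_off_plateau c1 c2.
    by apply: vanishes_offS; lra.
  exists (Num.max 1 B) => -[e e0]; rewrite /L /= le_max.
  have [de|ed] := leP d `|e|.
    have tdil := test_dilate a e0 (vanishes_off_test sphi vphi).
    have tcd : test_function (fun t => chi t * dilate a e phi t).
      exact: testMr tdil schi.
    suff -> : f (dilate a e phi) = f (fun t => chi t * dilate a e phi t) by rewrite hB ?orbT.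
    apply/eqP; rewrite -subr_eq0 -(distrB f_distr)//; apply/eqP/hA0; first exact: testB.
    move=> t tA; rewrite /chi plateau1 ?mul1r ?subrr//.
    by rewrite -ler_norml ltW.
  apply/orP; left; have := hd e; rewrite /= !sub0r normrN => /(_ ed e0).
  by rewrite normrN.
exists (Num.max M 0); split; first by rewrite le_max lexx orbT.
move=> e phi e0 h1 h2 h3; rewrite le_max; apply/orP; left.
exact: (hM (exist _ e e0)).
Qed.

Lemma dilation_family_bounded I (W : set I) (psi : I -> R -> R) (A : R) :
  smooth_family W psi -> (forall i, W i -> vanishes_off (- A) A (psi i)) ->
  exists M : R, 0 <= M /\ forall e i, e != 0 -> W i -> `|f (dilate a e (psi i))| <= M.
Proof.
move=> hs hv; have [K hK] := smooth_family_bound_off hs hv.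
have [M [M0 hM]] := dilation_bounded A K; exists M; split=> // e i e0 Wi.
apply: hM => //; [exact: smooth_family_smooth hs Wi|exact: hv|exact: hK].
Qed.

(** With [t = a + e * u] one has [phi t = phi a + e * g e u]. The first term tends to [0] by
    scaling. The difference quotients [g e] form a smooth family, since the derivative of [g e] is
    [phi'] at [a + e * u]; so the second term is [O(e)]. *)
Lemma cutoff_vanishing phi chi : smooth phi -> test_function chi ->
  f (fun t => phi t * dilate a e chi t) @[e --> (0 : R)^'] --> (0 : R).
Proof.
move=> sphi tchi; have [A [A0 vchi]] := test_vanishes_off tchi.
pose g e u := (phi (a + e * u) - phi a) / e.
pose W := [set e : R | e != 0 /\ `|e| <= 1].
have sg : smooth_family W g.
  have lbphi := smooth_smooth_family W (smooth_derive1 sphi).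
  have comp : smooth_family W (fun e u => derive1 phi (a + e * u)).
    apply: (@smooth_family_comp_affine _ _ _ (fun=> derive1 phi) (fun=> a) id (Num.max `|a| 1)) => //.
    by move=> e [_ e1]; rewrite !le_max lexx e1 orbT.
  have lb : loc_bounded W g.
    move=> B; have [C hC] := diff_family_loc (lbphi 0%N) (`|a| + B).
    exists (C * B) => e [e0 e1] t tB; rewrite /g.
    have [u us ->] := mvt_between (a + e * t) a (fun u => smooth_is_derive u sphi).
    rewrite addrAC subrr add0r mulrA mulrAC mulfK// normrM ler_pM//.
    apply: (hC e) => //; move: us; rewrite addrAC subrr add0r normrM => us.
    have -> : u = a + (u - a) by ring.
    rewrite (le_trans (ler_normD _ _))// lerD2l (le_trans us)//.
    by rewrite (le_trans _ tB)// ler_piMl.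
  case=> [|n]; split=> //; exists (fun e u => derive1 phi (a + e * u)); split; last exact: comp.
  move=> e [e0 e1] t; rewrite /g.
  have d2 := is_derive_affine a e t.
  have d3 := @is_derive1_comp _ phi (fun s => a + e * s) t _ _ (smooth_is_derive (a + e * t) sphi) d2.
  have d4 := is_deriveZ e^-1 (is_deriveB d3 (is_derive_cst (phi a) t (1 : R))).
  have e4 : e^-1 *: (derive1 phi (a + e * t) * e - 0) = derive1 phi (a + e * t).
    by rewrite /GRing.scale/= subr0 mulrCA mulVf// mulr1.
  rewrite e4 in d4.
  have -> : (fun u => (phi (a + e * u) - phi a) / e) =
    (e^-1 \*: ((phi \o (fun s => a + e * s)) - cst (phi a))); last exact: d4.
  by apply/funext => u /=; rewrite [RHS]mulrC.
have [M [M0 hM]] := @dilation_family_bounded _ W (fun e u => g e u * chi u) A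
  (smooth_familyM sg (smooth_smooth_family _ (test_smooth tchi))) (fun e _ => @vanishes_offMr _ _ _ (g e) chi vchi).
have h1 : (fun e => phi a * f (dilate a e chi)) @ (0 : R)^' --> (0 : R).
  rewrite -[X in _ --> X](mulr0 (phi a)); apply: cvgMl_tmp; exact: f_scaling.
apply/cvgrPdist_le => eta eta0.
have eta2 : 0 < eta / 2 by rewrite divr_gt0.
have etaM : 0 < eta / 2 / (M + 1) by rewrite divr_gt0// ltr_wpDl.
have e1 : \forall e \near (0 : R)^', `|e| < Num.min 1 (eta / 2 / (M + 1)).
  apply: (@dnbhs0_lt _ R); rewrite lt_min ltr01//.
have h1' : \forall e \near (0 : R)^', `|0 - phi a * f (dilate a e chi)| <= eta / 2.
  exact: (iffLR (cvgrPdist_le _ _) h1 _ eta2).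
near=> e; rewrite sub0r normrN.
have e0 : e != 0 by near: e; exact: nbhs_dnbhs_neq.
have : `|e| < Num.min 1 (eta / 2 / (M + 1)) by near: e.
rewrite lt_min => /andP[elt1 elt].
have tg : test_function (fun u => g e u * chi u).
  have We : W e by split=> //; exact: ltW.
  exact: (testMr tchi (smooth_family_smooth sg We)).
have -> : (fun t => phi t * dilate a e chi t) =
    (fun t => phi a * dilate a e chi t + e * dilate a e (fun u => g e u * chi u) t).
  apply/funext => t; rewrite /dilate /g.
  have -> : a + e * ((t - a) / e) = t by field.
  by field.
rewrite (distr_lin f_distr); [|exact: test_dilate|exact/testZ/test_dilate].
rewrite (distrZ f_distr); last exact: test_dilate.
rewrite (le_trans (ler_normD _ _))// (splitr eta) lerD//.
  suff : `|0 - phi a * f (dilate a e chi)| <= eta / 2 by rewrite sub0r normrN.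
  by near: e.
rewrite normrM (@le_trans _ _ (`|e| * M))// ?ler_wpM2l ?hM//; first by split=> //; exact: ltW.
rewrite (@le_trans _ _ (`|e| * (M + 1)))// ?ler_wpM2l ?lerDl//.
by rewrite -ler_pdivlMr ?ltr_wpDl// ltW.
Unshelve. all: by end_near. Qed.

(** A finite grid of parameters is handled by the scaling limit. Between a parameter and its grid
    point, [psi] changes by the increments times the divided differences [D1] and [D2], whose
    dilates are bounded by [M1] and [M2]; the mesh [1 / N] makes this at most [eta / 2]. *)
Lemma dilation_uniform (psi : R * R -> R -> R) (D1 D2 : (R * R) * (R * R) -> R -> R) (A : R) :
  let Q := [set s : R * R | (0 <= s.1 <= 1) /\ (0 <= s.2 <= 1)] in
  (forall s, Q s -> smooth (psi s) /\ vanishes_off (- A) A (psi s)) ->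
  smooth_family (Q `*` Q) D1 -> smooth_family (Q `*` Q) D2 ->
  (forall p, (Q `*` Q) p -> vanishes_off (- A) A (D1 p) /\ vanishes_off (- A) A (D2 p)) ->
  (forall s s', Q s -> Q s' -> forall t,
     psi s t - psi s' t = (s.1 - s'.1) * D1 (s, s') t + (s.2 - s'.2) * D2 (s, s') t) ->
  forall eta : R, 0 < eta ->
  \forall e \near (0 : R)^', forall s, Q s -> `|f (dilate a e (psi s))| <= eta.
Proof.
move=> Q hpsi sD1 sD2 vD psiD eta eta0.
have [M1 [M10 hM1]] := dilation_family_bounded sD1 (fun p hp => (vD p hp).1).
have [M2 [M20 hM2]] := dilation_family_bounded sD2 (fun p hp => (vD p hp).2).
pose N := (Num.truncn ((M1 + M2) / (eta / 2))).+1.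
have N0 : 0 < N%:R :> R by rewrite ltr0n.
have hN : (M1 + M2) / N%:R <= eta / 2.
  rewrite ler_pdivrMr// mulrC -ler_pdivrMr ?divr_gt0// ltW//.
  by rewrite /N; have := truncnS_gt ((M1 + M2) / (eta / 2)).
pose pt (ij : 'I_N.+1 * 'I_N.+1) : R * R := (ij.1%:R / N%:R, ij.2%:R / N%:R).
have Qpt ij : Q (pt ij).
  split=> /=; rewrite divr_ge0//= ler_pdivrMr// mul1r ler_nat -ltnS; exact: ltn_ord.
have tpsi s : Q s -> test_function (psi s).
  by move=> /hpsi[h1 h2]; exact: vanishes_off_test h1 h2.
have eta2 : 0 < eta / 2 by rewrite divr_gt0.
have grid : \forall e \near (0 : R)^', forall ij, `|0 - f (dilate a e (psi (pt ij)))| <= eta / 2.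
  apply: filter_forall => ij.
  exact: (iffLR (cvgrPdist_le _ _) (f_scaling (tpsi _ (Qpt ij)))).
near=> e => s Qs.
have e0 : e != 0 by near: e; exact: nbhs_dnbhs_neq.
have round (x : R) : 0 <= x <= 1 -> exists i : 'I_N.+1, `|x - i%:R / N%:R| <= 1 / N%:R.
  move=> /andP[x0 x1]; have xN0 : 0 <= x * N%:R by rewrite mulr_ge0.
  have /andP[h1 h2] := truncn_itv xN0.
  have h3 : (Num.truncn (x * N%:R) < N.+1)%N.
    rewrite ltnS -(ler_nat R) (le_trans h1)//.
    by rewrite ler_piMl.
  exists (Ordinal h3) => /=.
  have -> : x - (Num.truncn (x * N%:R))%:R / N%:R = (x * N%:R - (Num.truncn (x * N%:R))%:R) / N%:R.
    by field; rewrite gt_eqF.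
  rewrite normrM normfV (gtr0_norm N0) ler_wpM2r ?invr_ge0 ?(ltW N0)//.
  rewrite ger0_norm ?subr_ge0// lerBlDr addrC; move: h2; rewrite -natr1 => /ltW.
  by [].
case: (Qs) => /round[i hi] /round[j hj]; pose ij := (i, j).
have Qp := Qpt ij.
have QQ : (Q `*` Q) (s, pt ij) by [].
have tD1 : test_function (D1 (s, pt ij)).
  by apply: vanishes_off_test (vD _ QQ).1; exact: smooth_family_smooth sD1 QQ.
have tD2 : test_function (D2 (s, pt ij)).
  by apply: vanishes_off_test (vD _ QQ).2; exact: smooth_family_smooth sD2 QQ.
have -> : dilate a e (psi s) = (fun t => dilate a e (psi (pt ij)) t +
    ((s.1 - (pt ij).1) * dilate a e (D1 (s, pt ij)) t +
     (s.2 - (pt ij).2) * dilate a e (D2 (s, pt ij)) t)).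
  by apply/funext => t; rewrite /dilate -psiD//; ring.
have tz1 := testZ (s.1 - (pt ij).1) (test_dilate a e0 tD1).
have tz2 := testZ (s.2 - (pt ij).2) (test_dilate a e0 tD2).
rewrite (distrD f_distr); [|exact/test_dilate/tpsi|exact: testD].
rewrite (distrD f_distr)// (distrZ f_distr); last exact: test_dilate.
rewrite (distrZ f_distr); last exact: test_dilate.
rewrite (le_trans (ler_normD _ _))// (splitr eta) lerD//.
  suff : `|0 - f (dilate a e (psi (pt ij)))| <= eta / 2 by rewrite sub0r normrN.
  by move: ij {Qp QQ tD1 tD2 tz1 tz2}; near: e.
rewrite (le_trans (ler_normD _ _))// (le_trans _ hN)// !normrM.
rewrite [leRHS]mulrDl; apply: lerD; rewrite mulrC ler_pM//; try exact: hM1; try exact: hM2.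
  by rewrite -div1r.
by rewrite -div1r.
Unshelve. all: by end_near. Qed.

End ScalingLimit.
End Dilations.

(** * Harmonic functions and the Poisson kernel *)

Section DiscreteLaplacian.
Context {R : realType}.
Implicit Types (w u : R * R -> R) (z : R * R).

Definition lap5 w z (h : R) : R :=
  w (z.1 + h, z.2) + w (z.1 - h, z.2) + w (z.1, z.2 + h) + w (z.1, z.2 - h) - 4 * w z.

(* Superharmonicity in a weak sense, stable under integration over a parameter without
   differentiating under the integral sign. *)
Definition superharmonic_at w z :=
  forall eps : R, 0 < eps -> \forall h \near (0 : R)^'+, lap5 w z h <= eps * h ^+ 2.

Lemma superharmonicD w u z : superharmonic_at w z -> superharmonic_at u z ->
  superharmonic_at (fun p => w p + u p) z.
Proof.
move=> hw hu eps eps0; have e2 : 0 < eps / 2 by rewrite divr_gt0.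
have := hw _ e2; have := hu _ e2; apply: filterS2 => h h1 h2.
by move: h1 h2; rewrite /lap5; lra.
Qed.

Lemma superharmonicZ w z (c : R) : 0 <= c -> superharmonic_at w z ->
  superharmonic_at (fun p => c * w p) z.
Proof.
move=> c0 hw eps eps0; have c1 : 0 < c + 1 by rewrite ltr_wpDl.
have e2 : 0 < eps / (c + 1) by rewrite divr_gt0.
have := hw _ e2; apply: filterS => h h1.
have -> : lap5 (fun p => c * w p) z h = c * lap5 w z h by rewrite /lap5; ring.
apply: (le_trans (ler_wpM2l c0 h1)); rewrite mulrA ler_wpM2r ?sqr_ge0//.
by rewrite mulrA ler_pdivrMr// mulrC ler_wpM2l ?ltW// ltrDl.
Qed.

Lemma superharmonic_cst z (c : R) : superharmonic_at (fun=> c) z.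
Proof.
move=> eps eps0; apply: nearW => h.
by have -> : lap5 (fun=> c) z h = 0 by [rewrite /lap5; ring]; rewrite mulr_ge0 ?sqr_ge0 ?ltW.
Qed.

Lemma near_pair (P : set (R * R)) z : nbhs z P -> \forall h \near (0 : R)^'+,
  [/\ P (z.1 + h, z.2), P (z.1 - h, z.2), P (z.1, z.2 + h) & P (z.1, z.2 - h)].
Proof.
move=> /nbhs_ballP[r /= r0 hr]; near=> h.
have h0 : 0 < h by near: h; exact: nbhs_right_gt.
have hr' : h < r by near: h; exact: nbhs_right_lt.
have nh : `|h| < r by rewrite gtr0_norm.
by split; apply: hr; split=> /=; rewrite /ball/= ?subrr ?normr0// ?opprD ?addrA ?subrr
  ?sub0r ?normrN ?opprK//.
Unshelve. all: by end_near. Qed.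

(** If [w] were negative somewhere, the conditions at the boundary and at infinity would make [C]
    compact. Subtracting [del * x^2] lowers the five-point Laplacian by [2 * del * h^2], which
    contradicts weak superharmonicity at a minimum of [u]. *)
Lemma min_principle (D : set (R * R)) w : open D ->
  (forall z, D z -> {for z, continuous w}) -> (forall z, D z -> superharmonic_at w z) ->
  (forall p, closure D p -> ~ D p -> forall eta : R, 0 < eta ->
     \forall z \near p, D z -> - eta <= w z) ->
  (forall eta : R, 0 < eta -> exists r : R, forall z, D z -> r < `|z| -> - eta <= w z) ->
  forall z, D z -> 0 <= w z.
Proof.
move=> oD cw sw bw iw z0 Dz0; rewrite leNgt; apply/negP => wz0.
pose eta := - w z0 / 2; have eta0 : 0 < eta by rewrite /eta; lra.
have [r0 hr0] := iw _ (divr_gt0 eta0 (ltr0Sn _ 1)).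
pose r := Num.max `|r0| 1; have r1 : 0 < r by rewrite lt_max ltr01 orbT.
pose C := [set z | D z /\ w z <= - eta].
have Cr z : C z -> `|z| <= r.
  move=> [Dz wz]; rewrite leNgt; apply/negP => rz.
  have := hr0 z Dz; rewrite (le_lt_trans _ rz) ?le_max ?ler_norm// => /(_ isT).
  by move: eta0 wz; lra.
have clC : closed C.
  move=> p Cp; have clD : closure D p by apply: closure_subset Cp => z [].
  have [Dp|nDp] := pselect (D p); last first.
    have e2 : 0 < eta / 2 by lra.
    have [z [[Dz wz] /(_ Dz)]] := Cp _ (bw p clD nDp _ e2).
    by move: eta0 wz; lra.
  split=> //; rewrite leNgt; apply/negP => wp.
  have nb : nbhs p [set z | - eta < w z] by exact: (cvgr_gt (w p) (cw p Dp)).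
  have [z [[_ wz] /=]] := Cp _ nb.
  by rewrite ltNge wz.
have cpC : compact C.
  apply: (@subclosed_compact _ C (`[- r, r] `*` `[- r, r])) => //.
    exact: (compact_setX (@segment_compact _ _ _) (@segment_compact _ _ _)).
  move=> [x y] /Cr; rewrite prod_normE/= ge_max => /andP[hx hy].
  by split=> /=; rewrite in_itv/= -ler_norml.
(* Then [del * x^2 <= eta] on [|z| <= r + 1], so near [C] but outside it [u > - 2 * eta >= u z1]:
   the minimum over [C] is a local minimum. *)
pose del := eta / (r + 1) ^+ 2.
have r10 : 0 < (r + 1) ^+ 2 by rewrite exprn_gt0// addr_gt0.
have del0 : 0 < del by rewrite divr_gt0.
pose u z := w z - del * z.1 ^+ 2.
have Cz0 : C z0 by split=> //; rewrite /eta; lra.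
have [|z1] := @compact_EVT_min _ R u C (ex_intro _ z0 Cz0) cpC.
  apply: continuous_in_subspaceT => z; rewrite inE => -[Dz _].
  apply: cvgB; first exact: cw.
  apply: cvgMl_tmp; rewrite expr2; apply: cvgM; exact: cvg_fst.
rewrite inE => -[Dz1 wz1] min1.
have u1 : u z1 <= - (2 * eta).
  rewrite (le_trans (min1 z0 (mem_set Cz0)))// /u.
  have : 0 <= del * z0.1 ^+ 2 by rewrite mulr_ge0 ?sqr_ge0 ?ltW.
  by rewrite /eta; lra.
have loc : \forall z \near z1, u z1 <= u z.
  have h1 : \forall z \near z1, D z by exact: open_nbhs_nbhs.
  have h2 : \forall z \near z1, `|z| < r + 1.
    have := @cvg_norm _ _ _ (nbhs z1) _ id z1 cvg_id => /(_ _)/cvgr_lt; apply.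
    by rewrite (le_lt_trans (Cr z1 _))// ltrDl.
  move: h1 h2; apply: filterS2 => z Dz zr.
  have [wz|wz] := leP (w z) (- eta); first by apply: min1; rewrite inE.
  rewrite (le_trans u1)// /u.
  have hz : z.1 ^+ 2 <= (r + 1) ^+ 2.
    rewrite -(real_normK (num_real z.1)) lerXn2r ?nnegrE ?addr_ge0 ?(ltW r1)//.
    by rewrite (le_trans _ (ltW zr))// prod_normE le_max lexx.
  have : del * z.1 ^+ 2 <= eta.
    by rewrite (le_trans (ler_wpM2l (ltW del0) hz))// /del divfK// gt_eqF.
  by lra.
have [h [/= h0 [[l1 l2 l3 l4] lap]]] := @filter_ex _ ((0 : R)^'+) _ _
  (filterI (nbhs_right_gt (0 : R)) (filterI (near_pair loc) (sw z1 Dz1 _ del0))).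
have hh : 0 < del * h ^+ 2 by rewrite mulr_gt0// exprn_gt0.
by move: l1 l2 l3 l4 lap; rewrite /lap5 /u/=; lra.
Qed.

Definition rker (X Y : R) : R := Y / (X ^+ 2 + Y ^+ 2).

Definition lap_rker (X Y h : R) : R :=
  rker (X + h) Y + rker (X - h) Y + rker X (Y + h) + rker X (Y - h) - 4 * rker X Y.

(* With [z = X + iY], [rker X Y = - Im (1/z)], and the five-point Laplacian of [1/z] is
   [4 h^4 / (z (z^4 - h^4))]. *)
Lemma lap_rker_le (X Y h : R) : let q := X ^+ 2 + Y ^+ 2 in
  0 < q -> 2 * h ^+ 4 <= q ^+ 2 -> (lap_rker X Y h) ^+ 2 <= 64 * h ^+ 8 / q ^+ 5.
Proof.
move=> q q0 hq.
(* [Re + i Im = z (z^4 - h^4)] and [A] is the real part of [z^4]. [eN] and [eF] are two forms of the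
   squared modulus; [eF] shows the factors [z + h], [z - h], [z + ih], [z - ih], which are the
   denominators in [lap_rker]. *)
pose Im := 5 * X ^+ 4 * Y - 10 * X ^+ 2 * Y ^+ 3 + Y ^+ 5 - h ^+ 4 * Y.
pose Re := X ^+ 5 - 10 * X ^+ 3 * Y ^+ 2 + 5 * X * Y ^+ 4 - h ^+ 4 * X.
pose A := X ^+ 4 - 6 * X ^+ 2 * Y ^+ 2 + Y ^+ 4.
have eN : Re ^+ 2 + Im ^+ 2 = q * (q ^+ 4 - 2 * A * h ^+ 4 + h ^+ 8).
  by rewrite /Re /Im /A /q; ring.
have eF : Re ^+ 2 + Im ^+ 2 = q * (((X + h) ^+ 2 + Y ^+ 2) * ((X - h) ^+ 2 + Y ^+ 2) *
    ((X ^+ 2 + (Y + h) ^+ 2) * (X ^+ 2 + (Y - h) ^+ 2))).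
  by rewrite /Re /Im /q; ring.
have Aq : A <= q ^+ 2.
  have -> : q ^+ 2 = A + 8 * (X * Y) ^+ 2 by rewrite /A /q; ring.
  by rewrite lerDl mulr_ge0// sqr_ge0.
have h40 : 0 <= h ^+ 4 by have -> : h ^+ 4 = (h ^+ 2) ^+ 2 by [ring]; rewrite sqr_ge0.
have big : q ^+ 5 / 4 <= Re ^+ 2 + Im ^+ 2.
  have -> : q ^+ 5 / 4 = q * (q ^+ 2 / 2) ^+ 2 by field.
  rewrite eN ler_wpM2l ?(ltW q0)//.
  have s1 : (q ^+ 2 / 2) ^+ 2 <= (q ^+ 2 - h ^+ 4) ^+ 2.
    have q2 : 0 <= q ^+ 2 / 2 by rewrite divr_ge0 ?sqr_ge0.
    have s2 : q ^+ 2 / 2 <= q ^+ 2 - h ^+ 4 by lra.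
    by rewrite lerXn2r ?nnegrE ?(le_trans q2 s2).
  apply: (le_trans s1).
  have -> : (q ^+ 2 - h ^+ 4) ^+ 2 = q ^+ 4 - 2 * q ^+ 2 * h ^+ 4 + h ^+ 8 by ring.
  by rewrite lerD2r lerD2l lerN2 ler_wpM2r// ler_pM2l.
have N0 : 0 < Re ^+ 2 + Im ^+ 2 by rewrite (lt_le_trans _ big)// divr_gt0// exprn_gt0.
have nz : Re ^+ 2 + Im ^+ 2 != 0 by rewrite gt_eqF.
have eS : lap_rker X Y h = 4 * h ^+ 4 * Im / (Re ^+ 2 + Im ^+ 2).
  move: (nz); rewrite eF; rewrite !mulf_eq0 !negb_or => /and3P[n0 /andP[n1 n2] /andP[n3 n4]].
  rewrite /q in n0 *; rewrite /lap_rker /rker /Im; field.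
  by rewrite n0 n1 n2 n3 n4.
have -> : (lap_rker X Y h) ^+ 2 = 16 * h ^+ 8 * (Im ^+ 2 / (Re ^+ 2 + Im ^+ 2)) / (Re ^+ 2 + Im ^+ 2).
  by rewrite eS; field.
have h80 : 0 <= h ^+ 8 by have -> : h ^+ 8 = (h ^+ 4) ^+ 2 by [ring]; rewrite sqr_ge0.
have f1 : Im ^+ 2 / (Re ^+ 2 + Im ^+ 2) <= 1.
  by rewrite ler_pdivrMr// mul1r lerDr sqr_ge0.
have q50 : 0 < q ^+ 5 by rewrite exprn_gt0.
have -> : 64 * h ^+ 8 / q ^+ 5 = 16 * h ^+ 8 * (q ^+ 5 / 4)^-1 by field; rewrite gt_eqF.
apply: ler_pM.
- by apply: mulr_ge0; [exact: mulr_ge0|rewrite divr_ge0 ?sqr_ge0 ?(ltW N0)].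
- by rewrite invr_ge0 ltW.
- by rewrite -[leRHS]mulr1 ler_wpM2l// mulr_ge0.
- by rewrite lef_pV2 ?posrE// divr_gt0.
Qed.

Lemma lap_rker_small (X Y : R) : 0 < X ^+ 2 + Y ^+ 2 -> forall eps : R, 0 < eps ->
  \forall h \near (0 : R)^'+, `|lap_rker X Y h| <= eps * h ^+ 2.
Proof.
set q := X ^+ 2 + Y ^+ 2 => q0 eps eps0.
have q50 : 0 < q ^+ 5 by rewrite exprn_gt0.
pose c := Num.min (q ^+ 2 / 2) (eps ^+ 2 * q ^+ 5 / 64).
have c0 : 0 < c by rewrite lt_min !divr_gt0 ?mulr_gt0 ?exprn_gt0.
near=> h.
have h0 : 0 < h by near: h; exact: nbhs_right_gt.
have h1 : h < Num.min c 1 by near: h; apply: nbhs_right_lt; rewrite lt_min c0 ltr01.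
move: h1; rewrite lt_min => /andP[hc h1].
have h41 : h ^+ 4 <= h by rewrite -[leRHS]expr1; apply: ler_wiXn2l => //; exact: ltW.
have h4c : h ^+ 4 <= c by rewrite (le_trans h41)// ltW.
move: h4c; rewrite le_min => /andP[c1 c2].
have hq : 2 * h ^+ 4 <= q ^+ 2 by lra.
have := @lap_rker_le X Y h q0 hq => le.
have -> : eps * h ^+ 2 = `|eps * h ^+ 2| by rewrite ger0_norm// mulr_ge0 ?sqr_ge0 ?ltW.
rewrite -ler_sqr ?nnegrE// !real_normK ?num_real// (le_trans le)// -/q.
rewrite ler_pdivrMr// exprMn.
have -> : 64 * h ^+ 8 = 64 * h ^+ 4 * h ^+ 4 by ring.
have -> : eps ^+ 2 * (h ^+ 2) ^+ 2 * q ^+ 5 = (eps ^+ 2 * q ^+ 5) * h ^+ 4 by ring.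
have h40 : 0 <= h ^+ 4 by rewrite exprn_ge0// ltW.
rewrite ler_wpM2r//; lra.
Unshelve. all: by end_near. Qed.

End DiscreteLaplacian.

(** * From partial derivatives to second differences *)

Section HarmonicFunctions.
Context {R : realType}.
Implicit Types (g : R -> R) (H : R * R -> R).

Lemma mvt_local g (g' : R -> R) (a b : R) : a < b ->
  (forall x, a <= x <= b -> is_derive x (1 : R) g (g' x)) ->
  exists2 c, a < c < b & g b - g a = g' c * (b - a).
Proof.
move=> ab dg.
have [||c] := @MVT R g g' a b ab.
- by move=> x; rewrite in_itv/= => /andP[ax xb]; apply: dg; rewrite !ltW.
- apply: continuous_in_subspaceT => x; rewrite inE/= in_itv/= => xab.
  by apply: differentiable_continuous; apply/derivable1_diffP; case: (dg x xab).
by rewrite in_itv/= => h e; exists c.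
Qed.

(** The mean value theorem, applied to [m] and then to [g'] between [- xi] and [xi], gives the error
    [2 * xi * h * (g'' zeta - c)]. Continuity of [g''] at [0] alone makes it [o(h^2)]. *)
Lemma second_difference g (g' g'' : R -> R) (r : R) : 0 < r ->
  (forall s, `|s| < r -> is_derive s (1 : R) g (g' s)) ->
  (forall s, `|s| < r -> is_derive s (1 : R) g' (g'' s)) ->
  {for 0, continuous g''} -> forall eps : R, 0 < eps ->
  \forall h \near (0 : R)^'+, `|g h + g (- h) - 2 * g 0 - h ^+ 2 * g'' 0| <= eps * h ^+ 2.
Proof.
move=> r0 d1 d2 cg eps eps0; set c := g'' 0.
have e2 : 0 < eps / 2 by rewrite divr_gt0.
have /cvgrPdist_lt/(_ _ e2)/nbhs_ballP[del /= del0 hdel] := cg.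
near=> h.
have h0 : 0 < h by near: h; exact: nbhs_right_gt.
have hr : h < r by near: h; exact: nbhs_right_lt.
have hd : h < del by near: h; exact: nbhs_right_lt.
(* [- s] is written in the form that [is_derive_affine] differentiates. *)
pose m s := g s + g (0 + (-1) * s) - (c * s ^+ 2).
pose m' s := g' s - g' (0 + (-1) * s) - 2 * c * s.
have dm s : 0 <= s <= h -> is_derive s (1 : R) m (m' s).
  move=> /andP[s0 sh]; have sr : `|s| < r by rewrite ger0_norm// (le_lt_trans sh).
  have sr' : `|0 + (-1) * s| < r by rewrite add0r mulN1r normrN.
  have k1 := d1 s sr; have k2 := d1 _ sr'.
  have k3 := @is_derive1_comp _ g (fun s => 0 + (-1) * s) s _ _ k2 (is_derive_affine 0 (-1) s).
  have k4 := is_deriveZ c (@is_deriveX _ _ id 2 s 1 1 (is_derive_id s (1 : R))).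
  have k5 := is_deriveB (is_deriveD k1 k3) k4.
  have ev : (g' s + g' (0 + (-1) * s) * -1) - c *: ((2%:R * s ^+ 2.-1) *: (1 : R)) = m' s.
    by rewrite /m' /GRing.scale/= expr1; ring.
  by rewrite ev in k5.
have [xi /andP[xi0 xih] e1] := mvt_local h0 dm.
have [zeta /andP[z1 z2] e3] : exists2 z, (0 + (-1) * xi) < z < xi &
    g' xi - g' (0 + (-1) * xi) = g'' z * (xi - (0 + (-1) * xi)).
  apply: mvt_local; first by lra.
  move=> x /andP[x1 x2]; apply: d2; rewrite ltr_norml; apply/andP; split; lra.
have zdel : `|c - g'' zeta| < eps / 2.
  apply: hdel; rewrite /ball/= sub0r normrN ltr_norml; apply/andP; split; lra.
have -> : g h + g (- h) - 2 * g 0 - h ^+ 2 * c = m h - m 0.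
  have e4 : 0 + (-1) * h = - h by ring.
  have e5 : 0 + (-1) * 0 = 0 :> R by ring.
  by rewrite /m e4 e5; ring.
have -> : m h - m 0 = 2 * xi * h * (g'' zeta - c).
  by rewrite e1 /m' e3; ring.
rewrite normrM distrC (ger0_norm (mulr_ge0 (mulr_ge0 (ler0n _ 2) (ltW xi0)) (ltW h0))).
apply: (@le_trans _ _ (2 * h * h * (eps / 2))); last by rewrite le_eqVlt; apply/orP; left; apply/eqP; field.
apply: ler_pM => //; [by rewrite !mulr_ge0// ltW| |exact: ltW].
by rewrite ler_wpM2r ?(ltW h0)// ler_wpM2l// ltW.
Unshelve. all: by end_near. Qed.

Lemma is_derive_line H (p v : R * R) (s : R) : derivable H (p + s *: v) v ->
  is_derive s (1 : R) (fun s => H (p + s *: v)) ('D_v H (p + s *: v)).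
Proof.
move=> d.
have e : (fun h : R => h^-1 *: (((fun s => H (p + s *: v)) \o shift s) (h *: (1 : R)) -
      H (p + s *: v))) =
    (fun h : R => h^-1 *: ((H \o shift (p + s *: v)) (h *: v) - H (p + s *: v))).
  apply/funext => h /=; congr (_ *: (H _ - _)).
  rewrite scalerDl; have -> : h *: (1 : R) = h by rewrite /GRing.scale/= mulr1.
  by rewrite addrCA.
apply: DeriveDef; first by rewrite /derivable e.
by rewrite /derive e.
Qed.

Lemma C2_second_difference (U : set (R * R)) H p v : open U -> C2_on U H -> U p ->
  v = dirx \/ v = diry -> forall eps : R, 0 < eps ->
  \forall h \near (0 : R)^'+,
    `|H (p + h *: v) + H (p - h *: v) - 2 * H p - h ^+ 2 * 'D_v ('D_v H) p| <= eps * h ^+ 2.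
Proof.
move=> oU [cH [dH ddH]] Up vv eps eps0.
have cl : {for (0 : R), continuous (fun s : R => p + s *: v)}.
  apply: cvgD; first exact: cvg_cst.
  by apply: cvgZr_tmp; exact: cvg_id.
have p0 : p + (0 : R) *: v = p by rewrite scale0r addr0.
have nU : nbhs (0 : R) [set s : R | U (p + s *: v)].
  by apply: cl; rewrite p0; apply: open_nbhs_nbhs; split.
have /nbhs_ballP[r /= r0 hr] := nU.
have inU (s : R) : `|s| < r -> U (p + s *: v).
  by move=> sr; apply: hr; rewrite /ball/= sub0r normrN.
pose g (s : R) := H (p + s *: v); pose g' (s : R) := 'D_v H (p + s *: v).
pose g'' (s : R) := 'D_v ('D_v H) (p + s *: v).
have A1 s : `|s| < r -> is_derive s (1 : R) g (g' s).
  by move=> sr; apply: is_derive_line; case: (dH v vv _ (inU s sr)).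
have A2 s : `|s| < r -> is_derive s (1 : R) g' (g'' s).
  by move=> sr; apply: is_derive_line; case: (ddH v v vv vv _ (inU s sr)).
have A3 : {for (0 : R), continuous g''}.
  apply: (@continuous_comp _ _ _ (fun s : R => p + s *: v) ('D_v ('D_v H))); first exact: cl.
  by rewrite p0; case: (ddH v v vv vv p Up).
have := @second_difference g g' g'' r r0 A1 A2 A3 eps eps0; apply: filterS => h.
by rewrite /g /g'' p0 scaleNr.
Qed.

Lemma harmonic_superharmonic (U : set (R * R)) H z : open U -> harmonic_on U H -> U z ->
  superharmonic_at H z /\ superharmonic_at (fun p => - H p) z.
Proof.
move=> oU [C2 lap0] Uz.
suff main : forall eps : R, 0 < eps -> \forall h \near (0 : R)^'+, `|lap5 H z h| <= eps * h ^+ 2.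
  split=> eps eps0; have := main eps eps0; apply: filterS => h; rewrite ler_norml => /andP[h1 h2] //.
  have -> : lap5 (fun p => - H p) z h = - lap5 H z h by rewrite /lap5; ring.
  by rewrite lerNl.
move=> eps eps0; have e2 : 0 < eps / 2 by rewrite divr_gt0.
have := C2_second_difference oU C2 Uz (or_introl erefl) e2.
have := C2_second_difference oU C2 Uz (or_intror erefl) e2.
apply: filterS2 => h h1 h2.
have E1 : z + h *: dirx = (z.1 + h, z.2).
  by apply: injective_projections; rewrite /= /GRing.scale/= ?(mulr1, mulr0, addr0).
have E2 : z - h *: dirx = (z.1 - h, z.2).
  by apply: injective_projections; rewrite /= /GRing.scale/= ?(mulr1, mulr0, oppr0, addr0).
have E3 : z + h *: diry = (z.1, z.2 + h).
  by apply: injective_projections; rewrite /= /GRing.scale/= ?(mulr1, mulr0, addr0).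
have E4 : z - h *: diry = (z.1, z.2 - h).
  by apply: injective_projections; rewrite /= /GRing.scale/= ?(mulr1, mulr0, oppr0, addr0).
rewrite E1 E2 in h2; rewrite E3 E4 in h1.
rewrite /lap5; move: (lap0 z Uz) h1 h2.
move: ('D_dirx ('D_dirx H) z) ('D_diry ('D_diry H) z) => a b.
move: (H (z.1, z.2 + h)) (H (z.1, z.2 - h)) (H (z.1 + h, z.2)) (H (z.1 - h, z.2)) (H z).
move=> A1 A2 A3 A4 A0 /eqP; rewrite addr_eq0 => /eqP -> h1 h2.
have -> : A3 + A4 + A1 + A2 - 4 * A0 = (A1 + A2 - 2 * A0 - h ^+ 2 * b) +
   (A3 + A4 - 2 * A0 - h ^+ 2 * - b) by ring.
by rewrite (le_trans (ler_normD _ _))//; lra.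
Qed.

Lemma open_upper_half_plane : open (@upper_half_plane R).
Proof.
have -> : @upper_half_plane R = snd @^-1` [set y | 0 < y] by [].
apply: open_comp; last exact: open_gt.
by move=> z _; exact: cvg_snd.
Qed.

End HarmonicFunctions.

(** * Poisson integrals of continuous functions *)

Section PoissonKernel.
Context {R : realType}.
Notation mu := (@lebesgue_measure R).
Implicit Types (z : R * R) (k g : R -> R).

(* [pi] times the Poisson kernel of the half-plane. *)
Definition pker z (t : R) : R := rker (t - z.1) z.2.

Lemma pker_den z t : 0 < z.2 -> 0 < (t - z.1) ^+ 2 + z.2 ^+ 2.
Proof. by move=> y0; rewrite ltr_wpDl ?sqr_ge0// exprn_gt0. Qed.

Lemma pker_gt0 z t : 0 < z.2 -> 0 < pker z t.
Proof. by move=> y0; rewrite divr_gt0// pker_den. Qed.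

Lemma pker_le z t : 0 < z.2 -> pker z t <= z.2^-1.
Proof.
move=> y0; rewrite /pker /rker ler_pdivrMr ?pker_den// -ler_pdivrMl ?invr_gt0// invrK.
by rewrite -expr2 lerDr sqr_ge0.
Qed.

Lemma continuous_pker z : 0 < z.2 -> continuous (pker z).
Proof.
move=> y0 t; apply: cvgM; first exact: cvg_cst.
apply: cvgV; first by rewrite gt_eqF// pker_den.
apply: cvgD; last exact: cvg_cst.
by rewrite expr2; apply: cvgM; (apply: cvgB; [exact: cvg_id|exact: cvg_cst]).
Qed.

Lemma integral_pker z : 0 < z.2 -> (\int[mu]_t (pker z t)%:E = pi%:E)%E.
Proof.
move=> y0; pose G := (fun x : R => (oneDsqr x)^-1).
have cG : continuous G by move=> x; exact: continuous_oneDsqrV.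
have G0 x : 0 <= G x by rewrite /G/= invr_ge0 /oneDsqr addr_ge0 ?sqr_ge0.
have e1 : (\int[mu]_t (G t)%:E = pi%:E)%E.
  rewrite ge0_symfun_integralT//; last by move=> x; rewrite /G/= /oneDsqr sqrrN.
  rewrite (_ : [set x | _] = `[0, +oo[%classic); last first.
    by apply/seteqP; split => x/=; rewrite in_itv/= andbT.
  by rewrite integral0y_oneDsqr -EFinM mulrCA divff// mulr1.
pose F (t : R) := - z.1 / z.2 + z.2^-1 * t.
have dF t : is_derive t (1 : R) F z.2^-1 by exact: is_derive_affine.
have F' : F^`()%classic = fun=> z.2^-1 by apply/funext => t; exact: is_derive1E.
rewrite -e1 (@increasing_ge0_integration_by_substitutionT _ F G)//.
- apply: eq_integral => t _; rewrite F'; congr EFin.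
  have -> : ((G \o F) * (fun=> z.2^-1)) t = (oneDsqr (F t))^-1 * z.2^-1 by [].
  rewrite /pker /rker /F /oneDsqr.
  have y1 : z.2 != 0 by rewrite gt_eqF.
  have -> : 1 + (- z.1 / z.2 + z.2^-1 * t) ^+ 2 = ((t - z.1) ^+ 2 + z.2 ^+ 2) / z.2 ^+ 2 by field.
  by rewrite invf_div; field; rewrite y1 gt_eqF ?pker_den.
- by move=> s t st; rewrite /F ltrD2l ltr_pM2l// invr_gt0.
- by rewrite F' => t; exact: cvg_cst.
- by rewrite F'; apply/cvg_ex; exists z.2^-1; exact: cvg_cst.
- by rewrite F'; apply/cvg_ex; exists z.2^-1; exact: cvg_cst.
- apply/cvgrNyPle => A; near=> t; rewrite /F.
  have : t <= (A + z.1 / z.2) * z.2 by near: t; exact: (nbhs_ninfty_le (num_real _)).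
  rewrite -ler_pdivrMr// => h; rewrite mulNr addrC lerBlDr mulrC.
  exact: h.
- apply/cvgryPge => A; near=> t; rewrite /F.
  have : (A + z.1 / z.2) * z.2 <= t by near: t; exact: (nbhs_pinfty_ge (num_real _)).
  rewrite -ler_pdivlMr// => h; rewrite mulNr addrC lerBrDr [_ * t]mulrC.
  exact: h.
Unshelve. all: by end_near. Qed.

Lemma measurable_pker z : 0 < z.2 -> measurable_fun setT (pker z).
Proof. by move=> y0; apply: continuous_measurable_fun; exact: continuous_pker. Qed.

Lemma integrable_pker z : 0 < z.2 -> mu.-integrable setT (EFin \o pker z).
Proof.
move=> y0; apply/integrableP; split.
  by apply/measurable_EFinP; exact: measurable_pker.
under eq_integral => t _ do rewrite /= ger0_norm ?(ltW (pker_gt0 _ y0))//.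
by rewrite integral_pker// ltry.
Qed.

Lemma Rintegral_pker z : 0 < z.2 -> \int[mu]_t pker z t = pi.
Proof. by move=> y0; rewrite /Rintegral integral_pker. Qed.

(** Two kernels, because in [poisson_boundary] and [poisson_infty] one part of the integral is
    compared with the kernel at the moving point, and the other with a small multiple of a kernel at
    a fixed point of height [1]. *)
Lemma pker_dominated k (c1 c2 : R) z1 z2 : 0 < z1.2 -> 0 < z2.2 ->
  measurable_fun setT k -> (forall t, `|k t| <= c1 * pker z1 t + c2 * pker z2 t) ->
  mu.-integrable setT (EFin \o k) /\ `|\int[mu]_t k t| <= (c1 + c2) * pi.
Proof.
move=> y1 y2 mk hk.
have i1 := integrable_pker y1; have i2 := integrable_pker y2.
have i3 : mu.-integrable setT (EFin \o (fun t => c1 * pker z1 t)).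
  by have := integrableZl measurableT c1 i1; apply: eq_integrable.
have i4 : mu.-integrable setT (EFin \o (fun t => c2 * pker z2 t)).
  by have := integrableZl measurableT c2 i2; apply: eq_integrable.
have i5 : mu.-integrable setT (EFin \o (fun t => c1 * pker z1 t + c2 * pker z2 t)).
  by have := integrableD measurableT i3 i4; apply: eq_integrable.
have ik : mu.-integrable setT (EFin \o k).
  apply: (le_integrable measurableT _ _ i5); first exact/measurable_EFinP.
  move=> t _ /=; rewrite lee_fin (le_trans (hk t))// ler_norm//.
split=> //; apply: (le_trans (le_normr_Rintegral measurableT ik)).
apply: (@le_trans _ _ (\int[mu]_t (c1 * pker z1 t + c2 * pker z2 t))).
  apply: le_Rintegral => //.
  by have := integrable_norm ik; apply: eq_integrable.
rewrite RintegralD// (RintegralZl _ measurableT i1) (RintegralZl _ measurableT i2).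
by rewrite !Rintegral_pker// mulrDl.
Qed.

Section PoissonIntegral.
Variables (g : R -> R) (M : R).
Hypothesis cont_g : continuous g.
Hypothesis g_le : forall t, `|g t| <= M.

Let M0 : 0 <= M. Proof. exact: le_trans (normr_ge0 _) (g_le 0). Qed.

Definition poisson z := \int[mu]_t (g t * pker z t).

Let mg : measurable_fun setT g. Proof. exact: continuous_measurable_fun. Qed.

Lemma integrable_poisson z : 0 < z.2 -> mu.-integrable setT (EFin \o (fun t => g t * pker z t)).
Proof.
move=> y0; have [] // := @pker_dominated (fun t => g t * pker z t) M 0 z z y0 y0.
  by apply: measurable_funM => //; exact: measurable_pker.
move=> t; rewrite mul0r addr0 normrM [X in _ * X]gtr0_norm ?pker_gt0//.
by rewrite ler_wpM2r// ltW// pker_gt0.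
Qed.

(** The kernels at [z] and at a nearby point differ by at most [O(del)] times the kernel at [z],
    uniformly in [t], where [del] is the distance of the points. *)
Lemma poisson_continuous z : 0 < z.2 -> {for z, continuous poisson}.
Proof.
move=> y0; apply/cvgrPdist_le => eta eta0.
(* Chosen for [cq]: the denominators satisfy [|q' - q| <= del * (s^2 + 5 + 4 * z.2) <= del * c *
   q]. *)
pose c := 1 + 5 * z.2 ^- 2 + 4 * z.2 ^- 1.
have c0 : 1 <= c by rewrite /c -addrA lerDl addr_ge0// mulr_ge0// invr_ge0 ?sqr_ge0 ?ltW.
pose K := M * (2 * z.2 ^- 1 + 4 * c) * pi.
have K0 : 0 <= K.
  rewrite mulr_ge0 ?pi_ge0// mulr_ge0// addr_ge0// mulr_ge0// ?invr_ge0 ?(ltW y0)//.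
  exact: le_trans ler01 c0.
pose d := Num.min (Num.min 1 (z.2 / 2)) (Num.min (c^-1 / 2) (eta / (K + 1))).
have c1 : 0 < c by exact: lt_le_trans c0.
have d0 : 0 < d by rewrite !lt_min ltr01 !divr_gt0 ?invr_gt0// ltr_wpDl.
have nd : \forall z' \near z, ball z d z' by exact: nbhsx_ballx.
near=> z'; have [] : ball z d z' by near: z'.
rewrite /ball/= => + +; set x' := z'.1; set y' := z'.2.
rewrite !lt_min => /andP[/andP[x1 x2] /andP[x3 x4]] /andP[/andP[y1 y2] /andP[y3 y4]].
pose del := Num.max `|z.1 - x'| `|z.2 - y'|.
have xdel : `|z.1 - x'| <= del by rewrite le_max lexx.
have ydel : `|z.2 - y'| <= del by rewrite le_max lexx orbT.
have del0 : 0 <= del by exact: le_trans xdel.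
have delc : del * c <= 1 / 2.
  have : del <= c^-1 / 2 by rewrite ge_max !ltW.
  by move=> h; rewrite (le_trans (ler_wpM2r (ltW c1) h))// mulrAC mulVf ?gt_eqF.
have delK : del * (K + 1) <= eta.
  by rewrite -ler_pdivlMr ?ltr_wpDl// ge_max !ltW.
have del1 : del <= 1 by rewrite ge_max !ltW.
have y'0 : 0 < y' by move: y2; rewrite ltr_norml => /andP[]; lra.
have y'2 : y' <= 2 * z.2 by move: y2; rewrite ltr_norml => /andP[]; lra.
have i1 := @integrable_poisson z y0; have i2 := @integrable_poisson z' y'0.
rewrite /poisson -RintegralB//.
have [] // := @pker_dominated (fun t => g t * pker z t - g t * pker z' t)
  (M * (del * (2 * z.2 ^- 1 + 4 * c))) 0 z z y0 y0.
- by apply: measurable_funB; apply: measurable_funM => //; exact: measurable_pker.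
- move=> t; rewrite mul0r addr0 -mulrBr normrM -mulrA ler_pM//.
  set s := t - z.1; set q := s ^+ 2 + z.2 ^+ 2.
  set q' := (t - x') ^+ 2 + y' ^+ 2; pose a := z.1 - x'.
  have q0 : 0 < q := pker_den t y0.
  have eq : q' - q = 2 * a * s + a ^+ 2 + (y' ^+ 2 - z.2 ^+ 2).
    by rewrite /q' /q /a /s; ring.
  have h1 : `|2 * a * s| <= del * (1 + s ^+ 2).
    have -> : `|2 * a * s| = `|a| * (2 * `|s|) by rewrite !normrM (@ger0_norm _ 2)//; ring.
    apply: ler_pM => //.
    have := sqr_ge0 (`|s| - 1); rewrite sqrrB real_normK ?num_real//; lra.
  have h2 : `|a ^+ 2| <= del.
    rewrite normrX; apply: (@le_trans _ _ (del * 1)); last by rewrite mulr1.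
    by rewrite expr2 ler_pM// (le_trans xdel).
  have h3 : `|y' ^+ 2 - z.2 ^+ 2| <= del * (3 * z.2).
    rewrite subr_sqr normrM distrC ler_pM// ger0_norm; lra.
  have cq : s ^+ 2 + 5 + 4 * z.2 <= c * q.
    have e5 : 5 * z.2 ^- 2 * q = 5 + 5 * z.2 ^- 2 * s ^+ 2 by rewrite /q; field; rewrite gt_eqF.
    have e4 : 4 * z.2 ^- 1 * q = 4 * z.2 + 4 * z.2 ^- 1 * s ^+ 2.
      by rewrite /q expr1; field; rewrite gt_eqF.
    have p5 : 0 <= 5 * z.2 ^- 2 * s ^+ 2.
      by apply: mulr_ge0; [apply: mulr_ge0; rewrite ?invr_ge0 ?sqr_ge0|exact: sqr_ge0].
    have p4 : 0 <= 4 * z.2 ^- 1 * s ^+ 2.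
      by apply: mulr_ge0; [apply: mulr_ge0; rewrite ?invr_ge0 ?expr1 ?(ltW y0)|exact: sqr_ge0].
    have p3 : s ^+ 2 <= q by rewrite lerDl sqr_ge0.
    have -> : c * q = q + 5 * z.2 ^- 2 * q + 4 * z.2 ^- 1 * q by rewrite /c; ring.
    rewrite e5 e4; lra.
  have hq : `|q' - q| <= del * c * q.
    rewrite eq (le_trans (ler_normD _ _))// (le_trans (lerD (ler_normD _ _) (lexx _)))//.
    apply: (@le_trans _ _ (del * (s ^+ 2 + 5 + 4 * z.2))); last by rewrite -mulrA ler_wpM2l.
      rewrite (le_trans (lerD (lerD h1 h2) h3))// -subr_ge0.
      have -> : del * (s ^+ 2 + 5 + 4 * z.2) - (del * (1 + s ^+ 2) + del + del * (3 * z.2)) =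
        del * (3 + z.2) by ring.
    by rewrite mulr_ge0// addr_ge0// ltW.
  have q'q : q / 2 <= q'.
    have h4 : del * c * q <= 1 / 2 * q by rewrite ler_wpM2r// ltW.
    by move: hq; rewrite ler_norml => /andP[h5 h6]; clear -h4 h5 h6; lra.
  have q'0 : 0 < q' by apply: lt_le_trans q'q; rewrite divr_gt0.
  have -> : pker z t - pker z' t = (z.2 * (q' - q) + (z.2 - y') * q) / (q * q').
    rewrite /pker /rker -/s -/q -/x' -/y' -/q'; field; by rewrite !gt_eqF.
  rewrite normrM normfV (gtr0_norm (mulr_gt0 q0 q'0)) ler_pdivrMr ?mulr_gt0//.
  apply: (@le_trans _ _ (z.2 * (del * c * q) + del * q)).
    rewrite (le_trans (ler_normD _ _))// !normrM (gtr0_norm y0) (gtr0_norm q0) lerD//.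
      by rewrite ler_wpM2l// ltW.
    by rewrite ler_wpM2r// ltW.
  have -> : del * (2 * z.2 ^- 1 + 4 * c) * pker z t * (q * q') =
      (2 * (del + 2 * (z.2 * (del * c)))) * q'.
    by rewrite /pker /rker -/s -/q expr1; field; rewrite !gt_eqF.
  apply: (@le_trans _ _ (2 * (del + 2 * (z.2 * (del * c))) * (q / 2))); last first.
    rewrite ler_wpM2l// mulr_ge0// addr_ge0// mulr_ge0// mulr_ge0 ?(ltW y0)// mulr_ge0// ltW//.
  rewrite -subr_ge0; have -> : 2 * (del + 2 * (z.2 * (del * c))) * (q / 2) -
    (z.2 * (del * c * q) + del * q) = z.2 * (del * c * q) by field.
  by rewrite !mulr_ge0// ltW.
move=> _ /le_trans; apply; rewrite addr0 (le_trans _ delK)//.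
have -> : M * (del * (2 * z.2 ^- 1 + 4 * c)) * pi = del * K by rewrite /K; ring.
by rewrite ler_wpM2l// lerDl.
Unshelve. all: by end_near. Qed.

(** The bound is relative to the kernel itself, so it can be integrated against [g] with no
    differentiation under the integral sign. *)
Lemma lap_pker_le z (t h : R) : 0 < z.2 -> 2 * h ^+ 4 <= z.2 ^+ 4 ->
  `|lap5 (fun p => pker p t) z h| <= 8 * h ^+ 4 / z.2 ^+ 4 * pker z t.
Proof.
move=> y0 hh; have -> : lap5 (fun p => pker p t) z h = lap_rker (t - z.1) z.2 h.
  rewrite /lap5 /lap_rker /pker /=.
  have -> : t - (z.1 + h) = t - z.1 - h by ring.
  have -> : t - (z.1 - h) = t - z.1 + h by ring.
  ring.
set X := t - z.1; set q := X ^+ 2 + z.2 ^+ 2.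
have q0 : 0 < q := pker_den t y0.
have qy : z.2 ^+ 2 <= q by rewrite lerDr sqr_ge0.
have y20 : 0 < z.2 ^+ 2 by rewrite exprn_gt0.
have q2 : z.2 ^+ 4 <= q ^+ 2.
  have -> : z.2 ^+ 4 = (z.2 ^+ 2) ^+ 2 by ring.
  by rewrite lerXn2r ?nnegrE ?(ltW y20) ?(ltW q0).
have := @lap_rker_le R X z.2 h q0 (le_trans hh q2); rewrite -/q => le.
have -> : 8 * h ^+ 4 / z.2 ^+ 4 * pker z t = `|8 * h ^+ 4 / z.2 ^+ 4 * pker z t|.
  rewrite ger0_norm// mulr_ge0 ?(ltW (pker_gt0 _ _))// divr_ge0 ?exprn_ge0 ?(ltW y0)//.
  by rewrite mulr_ge0// (_ : h ^+ 4 = (h ^+ 2) ^+ 2) ?sqr_ge0//; ring.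
rewrite -ler_sqr ?nnegrE// !real_normK ?num_real// (le_trans le)//.
have -> : (8 * h ^+ 4 / z.2 ^+ 4 * pker z t) ^+ 2 = 64 * h ^+ 8 * (z.2 ^+ 6 * q ^+ 2)^-1.
  by rewrite /pker /rker -/X -/q; field; rewrite !gt_eqF.
rewrite ler_wpM2l//.
  by rewrite mulr_ge0// (_ : h ^+ 8 = (h ^+ 4) ^+ 2) ?sqr_ge0//; ring.
have -> : q ^+ 5 = q ^+ 3 * q ^+ 2 by ring.
have -> : z.2 ^+ 6 = (z.2 ^+ 2) ^+ 3 by ring.
rewrite lef_pV2 ?posrE ?mulr_gt0 ?exprn_gt0// ler_wpM2r ?sqr_ge0//.
by rewrite lerXn2r ?nnegrE ?(ltW y20) ?(ltW q0).
Qed.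

Lemma lap_poisson z : 0 < z.2 -> forall eps : R, 0 < eps ->
  \forall h \near (0 : R)^'+, `|lap5 poisson z h| <= eps * h ^+ 2.
Proof.
move=> y0 eps eps0.
have y40 : 0 < z.2 ^+ 4 by rewrite exprn_gt0.
pose K := M * 8 / z.2 ^+ 4 * pi.
have K0 : 0 <= K by rewrite mulr_ge0 ?pi_ge0// divr_ge0 ?(ltW y40)// mulr_ge0.
pose d := Num.min (Num.min 1 (z.2 / 2)) (eps / (K + 1)).
have d0 : 0 < d by rewrite !lt_min ltr01 !divr_gt0// ltr_wpDl.
near=> h.
have h0 : 0 < h by near: h; exact: nbhs_right_gt.
have : h < d by near: h; exact: nbhs_right_lt.
rewrite !lt_min => /andP[/andP[h1 hy] hK].
have hh : 2 * h ^+ 4 <= z.2 ^+ 4.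
  have : h ^+ 4 <= (z.2 / 2) ^+ 4 by rewrite lerXn2r ?nnegrE ?divr_ge0 ?ltW.
  have -> : (z.2 / 2) ^+ 4 = z.2 ^+ 4 / 16 by field.
  by lra.
have y1 : 0 < z.2 + h by rewrite addr_gt0.
have y2 : 0 < z.2 - h by lra.
have i0 := @integrable_poisson z y0.
have i1 := @integrable_poisson (z.1 + h, z.2) y0.
have i2 := @integrable_poisson (z.1 - h, z.2) y0.
have i3 := @integrable_poisson (z.1, z.2 + h) y1.
have i4 := @integrable_poisson (z.1, z.2 - h) y2.
have iD (k l : R -> R) : mu.-integrable setT (EFin \o k) -> mu.-integrable setT (EFin \o l) ->
    mu.-integrable setT (EFin \o (fun t => k t + l t)).
  by move=> hk hl; have := integrableD measurableT hk hl; apply: eq_integrable.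
have i12 := iD _ _ i1 i2; have i123 := iD _ _ i12 i3; have i1234 := iD _ _ i123 i4.
have i00 : mu.-integrable setT (EFin \o (fun t => 4 * (g t * pker z t))).
  by have := integrableZl measurableT 4 i0; apply: eq_integrable.
have -> : lap5 poisson z h = \int[mu]_t (g t * lap5 (fun p => pker p t) z h).
  rewrite /lap5 /poisson -!RintegralD// -RintegralZl// -RintegralB//.
  by apply: eq_Rintegral => t _ /=; ring.
have [] // := @pker_dominated (fun t => g t * lap5 (fun p => pker p t) z h)
  (M * (8 * h ^+ 4 / z.2 ^+ 4)) 0 z z y0 y0.
- apply: measurable_funM => //; rewrite /lap5.
  have m1 (p : R * R) : 0 < p.2 -> measurable_fun setT (fun t => pker p t) by exact: measurable_pker.
  apply: measurable_funB; last by apply: measurable_funM => //; exact: m1.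
  by do ?apply: measurable_funD; exact: m1.
- move=> t; rewrite mul0r addr0 normrM -mulrA ler_pM//.
  exact: lap_pker_le.
move=> _ /le_trans; apply; rewrite addr0.
have -> : M * (8 * h ^+ 4 / z.2 ^+ 4) * pi = K * h ^+ 2 * h ^+ 2.
  by rewrite /K; field; rewrite gt_eqF.
rewrite ler_wpM2r ?sqr_ge0//.
apply: (@le_trans _ _ ((K + 1) * h)).
  by apply: ler_pM; rewrite ?sqr_ge0 ?lerDl// -[leRHS]expr1; apply: ler_wiXn2l => //; exact: ltW.
by rewrite mulrC -ler_pdivlMr ?ltr_wpDl// ltW.
Unshelve. all: by end_near. Qed.

(** Near [x1] the oscillation of [g] is small; at distance [del] or more the kernel at [z] is at
    most [K * z.2] times the kernel at [(x1, 1)]. *)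
Lemma poisson_boundary (x1 : R) : forall eta : R, 0 < eta ->
  \forall z \near (x1, 0 : R), 0 < z.2 -> `|poisson z - pi * g x1| <= eta.
Proof.
move=> eta eta0; have pi1 := pi_gt0 R.
have eta1 : 0 < eta / 2 / pi by rewrite !divr_gt0.
have /cvgrPdist_lt/(_ _ eta1)/nbhs_ballP[del /= del0 hdel] := @cont_g x1.
(* For [s = t - x1] with [|s| >= del], and [z.1] within [del / 2] of [x1], the kernel is at most
   [4 * z.2 / s^2], and [(s^2 + 1) / s^2 <= 1 + del^-2]. *)
pose K := 4 * (1 + del ^- 2).
have K0 : 0 < K by rewrite mulr_gt0// ltr_pwDl// invr_ge0 sqr_ge0.
pose e2 := eta / 2 / (2 * M * K * pi + 1).
have MK : 0 <= 2 * M * K * pi.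
  by apply: mulr_ge0; [apply: mulr_ge0; [exact: mulr_ge0|exact: ltW]|exact: pi_ge0].
have e20 : 0 < e2 by rewrite !divr_gt0// ltr_wpDl.
pose d := Num.min (del / 2) e2.
have d0 : 0 < d by rewrite lt_min divr_gt0.
have nd : \forall z \near (x1, 0 : R), ball (x1, 0 : R) d z by exact: nbhsx_ballx.
near=> z => y0; have [] : ball (x1, 0 : R) d z by near: z.
rewrite /ball/= sub0r normrN (gtr0_norm y0) !lt_min => /andP[hx _] /andP[_ hy].
have ig := integrable_poisson y0; have ip := integrable_pker y0.
have ip1 : mu.-integrable setT (EFin \o (fun t => g x1 * pker z t)).
  by have := integrableZl measurableT (g x1) ip; apply: eq_integrable.
have -> : poisson z - pi * g x1 = \int[mu]_t (g t * pker z t - g x1 * pker z t).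
  by rewrite RintegralB// (RintegralZl _ measurableT ip) Rintegral_pker// mulrC.
have [] // := @pker_dominated (fun t => g t * pker z t - g x1 * pker z t)
  (eta / 2 / pi) (2 * M * K * z.2) z (x1, 1) y0 ltr01.
- by apply: measurable_funB; apply: measurable_funM => //; exact: measurable_pker.
- have cK0 : 0 <= 2 * M * K * z.2.
    by apply: mulr_ge0; [apply: mulr_ge0; [exact: mulr_ge0|exact: ltW]|exact: ltW].
  move=> t; rewrite -mulrBl normrM (gtr0_norm (pker_gt0 _ y0)).
  have p1 := pker_gt0 t y0; have p2 := @pker_gt0 (x1, 1) t ltr01.
  have [tdel|tdel] := ltP `|x1 - t| del.
    rewrite -[leLHS]addr0 lerD//; last exact: mulr_ge0 cK0 (ltW p2).
    by rewrite ler_wpM2r ?(ltW p1)// distrC ltW//; exact: hdel.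
  rewrite -[leLHS]add0r lerD//; first by rewrite mulr_ge0// ltW.
  have -> : 2 * M * K * z.2 * pker (x1, 1) t = (2 * M) * (K * z.2 * pker (x1, 1) t) by ring.
  apply: ler_pM => //; first exact: ltW.
    by rewrite (le_trans (ler_normB _ _))//; have := g_le t; have := g_le x1; lra.
  rewrite /pker /rker/= expr1n.
  set s := t - x1; have s2 : del ^+ 2 <= s ^+ 2.
    rewrite -[s ^+ 2]real_normK ?num_real// lerXn2r ?nnegrE ?(ltW del0)//.
    by rewrite /s distrC.
  have den : s ^+ 2 / 4 <= (t - z.1) ^+ 2 + z.2 ^+ 2.
    apply: (@le_trans _ _ ((t - z.1) ^+ 2)); last by rewrite lerDl sqr_ge0.
    have -> : s ^+ 2 / 4 = (`|s| / 2) ^+ 2 by rewrite exprMn real_normK ?num_real//; field.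
    rewrite -[(t - z.1) ^+ 2]real_normK ?num_real// lerXn2r ?nnegrE//.
    have := ler_normD (t - z.1) (z.1 - x1); rewrite addrA subrK -/s (distrC z.1 x1).
    have : del <= `|s| by rewrite /s distrC.
    by lra.
  have s0 : 0 < s ^+ 2 by rewrite (lt_le_trans _ s2)// exprn_gt0.
  rewrite mul1r -[K * z.2 / _]mulrA mulrCA ler_wpM2l ?(ltW y0)//.
  apply: (@le_trans _ _ (4 / s ^+ 2)).
    by rewrite -invf_div lef_pV2 ?posrE ?divr_gt0// ?pker_den.
  rewrite ler_pdivrMr// mulrAC ler_pdivlMr ?addr_gt0// /K -mulrA ler_pM2l//.
  have : 1 <= del ^- 2 * s ^+ 2 by rewrite mulrC ler_pdivlMr ?exprn_gt0// mul1r.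
  by lra.
move=> _ /le_trans; apply; rewrite mulrDl divfK ?gt_eqF// [leRHS](splitr eta) lerD//.
have -> : 2 * M * K * z.2 * pi = z.2 * (2 * M * K * pi) by ring.
apply: (@le_trans _ _ (z.2 * (2 * M * K * pi + 1))); first by rewrite ler_wpM2l ?lerDl ?(ltW y0).
by rewrite -ler_pdivlMr ?ltr_wpDl// ltW.
Unshelve. all: by end_near. Qed.

Lemma poisson_infty : (forall eta : R, 0 < eta -> exists A : R, forall t, A < `|t| -> `|g t| <= eta) ->
  forall eta : R, 0 < eta -> exists r : R, forall z, 0 < z.2 -> r < `|z| -> `|poisson z| <= eta.
Proof.
move=> g0 eta eta0; have pi1 := pi_gt0 R.
have eta1 : 0 < eta / 2 / pi by rewrite !divr_gt0.
have [A0 hA0] := g0 _ eta1; pose A := Num.max A0 0.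
have hA t : A < `|t| -> `|g t| <= eta / 2 / pi.
  by move=> At; apply: hA0; apply: le_lt_trans At; rewrite le_max lexx.
have A00 : 0 <= A by rewrite le_max lexx orbT.
pose c := M * (A ^+ 2 + 1) * pi.
have c0 : 0 <= c by rewrite !mulr_ge0 ?pi_ge0// addr_ge0 ?sqr_ge0.
(* The term [2 * A] gives [pker z t <= 1 / r] for [|t| <= A]: either [z.2 > r], or
   [|t - z.1| >= r / 2], where the kernel is at most [1 / (2 |t - z.1|)]. The other term makes
   [c / r <= eta / 2]. *)
pose r := 2 * A + (c + 1) / (eta / 2).
have r0 : 0 < r by rewrite ltr_wpDl ?mulr_ge0// !divr_gt0// ltr_wpDl.
exists r => z y0 rz.
have [] // := @pker_dominated (fun t => g t * pker z t)
  (eta / 2 / pi) (M * (A ^+ 2 + 1) / r) z (0, 1) y0 ltr01.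
- by apply: measurable_funM => //; exact: measurable_pker.
- move=> t; rewrite normrM (gtr0_norm (pker_gt0 _ y0)).
  have p1 := pker_gt0 t y0; have p2 := @pker_gt0 (0, 1) t ltr01.
  have [tA|tA] := ltP A `|t|.
    rewrite -[leLHS]addr0 lerD//; first by rewrite ler_wpM2r ?(ltW p1)// hA.
    by rewrite mulr_ge0 ?(ltW p2)// divr_ge0 ?(ltW r0)// mulr_ge0// addr_ge0 ?sqr_ge0.
  rewrite -[leLHS]add0r lerD//; first by rewrite mulr_ge0// ltW.
  have -> : M * (A ^+ 2 + 1) / r * pker (0, 1) t = M * ((A ^+ 2 + 1) * pker (0, 1) t / r) by ring.
  apply: ler_pM => //; first exact: ltW.
  apply: (@le_trans _ _ r^-1).
    have : r < `|z| by []. rewrite prod_normE/= lt_max => /orP[rx|ry].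
      have rt : r / 2 <= `|t - z.1|.
        have := ler_normB z.1 (z.1 - t); rewrite opprB addrC subrK.
        have := ler_normD (t - z.1) (- t); rewrite addrAC subrr sub0r !normrN.
        have : 2 * A <= r by rewrite lerDl !divr_ge0// ?ltW// ltr_wpDl.
        by lra.
      rewrite /pker /rker ler_pdivrMr ?pker_den// ler_pdivlMl//.
      have : `|t - z.1| ^+ 2 = (t - z.1) ^+ 2 by rewrite real_normK ?num_real.
      have := sqr_ge0 (`|t - z.1| - z.2); rewrite sqrrB.
      have : z.2 * r <= z.2 * (2 * `|t - z.1|) by rewrite ler_wpM2l ?(ltW y0)//; lra.
      by lra.
    rewrite (le_trans (pker_le _ y0))// lef_pV2 ?posrE// ltW//.
    by move: ry; rewrite gtr0_norm.
  rewrite -[leLHS]mul1r ler_wpM2r ?invr_ge0 ?(ltW r0)//.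
  rewrite /pker /rker/= subr0 expr1n mul1r ler_pdivlMr ?ltr_wpDl ?sqr_ge0// mul1r lerD2r.
  by rewrite -[leLHS]real_normK ?num_real// lerXn2r ?nnegrE.
move=> _ /le_trans; apply; rewrite mulrDl divfK ?gt_eqF// [leRHS](splitr eta) lerD//.
have -> : M * (A ^+ 2 + 1) / r * pi = c / r by rewrite /c; ring.
rewrite ler_pdivrMr// mulrC -ler_pdivrMr ?divr_gt0//.
apply: (@le_trans _ _ ((c + 1) / (eta / 2))).
  by rewrite ler_wpM2r ?lerDl// invr_ge0 ltW// divr_gt0.
by rewrite lerDr mulr_ge0.
Qed.

End PoissonIntegral.

Lemma cvg_pairR T (F : set_system T) {FF : Filter F} (u v : T -> R) (a b : R) :
  u @ F --> a -> v @ F --> b -> (fun t => (u t, v t)) @ F --> (a, b).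
Proof. 
move=> ua vb; apply/cvgrPdist_lt => e e0; near=> t.
rewrite prod_normE/= gt_max; apply/andP; split.
  by near: t; exact: (iffLR (cvgrPdist_lt _ _) ua).
by near: t; exact: (iffLR (cvgrPdist_lt _ _) vb).
Unshelve. all: by end_near. Qed.

Lemma slice_continuous (H : R * R -> R) (s : R) : harmonic_on upper_half_plane H -> 0 < s ->
  continuous (fun t => H (t, s)).
Proof.
move=> [[cH _] _] s0 t; apply: (@continuous_comp _ _ _ (fun t : R => (t, s)) H).
  by apply: cvg_pairR; [exact: cvg_id|exact: cvg_cst].
exact: cH.
Qed.

Lemma slice_vanishes (H : R * R -> R) (s : R) : vanishes_at_infinity_on upper_half_plane H ->
  0 < s -> forall eta : R, 0 < eta -> exists A : R, forall t, A < `|t| -> `|H (t, s)| <= eta.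
Proof.
move=> Hv s0 eta /Hv[r hr]; exists r => t rt; apply/ltW/hr => //.
by rewrite (lt_le_trans rt)// prod_normE le_max lexx.
Qed.

Lemma slice_bounded (H : R * R -> R) (s : R) : harmonic_on upper_half_plane H ->
  vanishes_at_infinity_on upper_half_plane H -> 0 < s ->
  exists M : R, forall t, `|H (t, s)| <= M.
Proof.
move=> Hh Hv s0; have [A hA] := slice_vanishes Hv s0 ltr01.
have [C hC] := continuous_bounded_on A (slice_continuous Hh s0).
exists (Num.max C 1) => t; rewrite le_max.
by have [tA|tA] := leP `|t| A; [rewrite hC|rewrite hA ?orbT].
Qed.

(** Both sides have the same boundary values and vanish at infinity, so the minimum principle
    applies to [sg * (Hs - v)] for both signs. Starting from a height [s > 0] makes the boundary
    data continuous and bounded. *)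
Lemma poisson_representation (H : R * R -> R) : harmonic_on upper_half_plane H ->
  vanishes_at_infinity_on upper_half_plane H -> forall (s : R) z, 0 < s -> 0 < z.2 ->
  \int[mu]_t (H (t, s) * pker z t) = pi * H (z.1, z.2 + s).
Proof.
move=> Hh Hv s z s0 z0; pose g t := H (t, s).
have cH p : upper_half_plane p -> {for p, continuous H}.
  by case: Hh => -[h _] _; exact: h.
have cg : continuous g := slice_continuous Hh s0.
have gv (eta : R) : 0 < eta -> exists A : R, forall t, A < `|t| -> `|g t| <= eta.
  exact: slice_vanishes.
have [M hM] : exists M : R, forall t, `|g t| <= M by exact: slice_bounded.
pose v := poisson g; pose Hs p := pi * H (p.1, p.2 + s).
have pi1 := pi_gt0 R.
have ups (p : R * R) : 0 < p.2 -> upper_half_plane (p.1, p.2 + s) by move=> p0; exact: addr_gt0.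
have cHs p : 0 < p.2 -> {for p, continuous Hs}.
  move=> p0; apply: cvgMl_tmp.
  apply: (@continuous_comp _ _ _ (fun p : R * R => (p.1, p.2 + s)) H); last exact/cH/ups.
  by apply: cvg_pairR; [exact: cvg_fst|apply: cvgD; [exact: cvg_snd|exact: cvg_cst]].
have lapE p h : lap5 Hs p h = pi * lap5 H (p.1, p.2 + s) h.
  rewrite /lap5 /Hs/=.
  have -> : p.2 + h + s = p.2 + s + h by ring.
  have -> : p.2 - h + s = p.2 + s - h by ring.
  by ring.
have lapHs p : 0 < p.2 -> forall eps : R, 0 < eps ->
    \forall h \near (0 : R)^'+, `|lap5 Hs p h| <= eps * h ^+ 2.
  move=> p0 eps eps0; have [h1 h2] := harmonic_superharmonic open_upper_half_plane Hh (ups p p0).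
  have e1 : 0 < eps / pi by rewrite divr_gt0.
  have := h1 _ e1; have := h2 _ e1; apply: filterS2 => h.
  have -> : lap5 (fun p => - H p) (p.1, p.2 + s) h = - lap5 H (p.1, p.2 + s) h by rewrite /lap5; ring.
  move=> k2 k1; rewrite lapE normrM (gtr0_norm pi1) mulrC -ler_pdivlMr// mulrAC.
  by rewrite ler_norml k1 andbT lerNl.
have main (sg : R) : `|sg| = 1 -> forall p, 0 < p.2 -> 0 <= sg * (Hs p - v p).
  move=> sg1; apply: (@min_principle _ upper_half_plane) => //.
  - exact: open_upper_half_plane.
  - move=> p p0; apply: cvgMl_tmp; apply: cvgB; first exact: cHs.
    exact: (poisson_continuous cg hM).
  - move=> p p0 eps eps0; have e2 : 0 < eps / 2 by rewrite divr_gt0.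
    have := lapHs p p0 _ e2; have := lap_poisson cg hM p0 e2; apply: filterS2 => h k1 k2.
    have -> : lap5 (fun p => sg * (Hs p - v p)) p h = sg * (lap5 Hs p h - lap5 v p h).
      by rewrite /lap5; ring.
    rewrite (le_trans (ler_norm _))// normrM sg1 mul1r (le_trans (ler_normB _ _))//; lra.
  - move=> p clp np eta eta0.
    have p20 : p.2 <= 0 by rewrite leNgt; apply/negP.
    have [pn|pp|p0] := ltgtP p.2 0; last first.
    + have e2 : 0 < eta / 2 by rewrite divr_gt0.
      have ep : p = (p.1, 0) by rewrite [LHS]surjective_pairing p0.
      have k1 := poisson_boundary cg hM p.1 e2.
      have k2 : \forall z \near (p.1, 0 : R), `|pi * g p.1 - Hs z| < eta / 2.
        have ce : {for (p.1, 0 : R), continuous Hs}.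
          apply: cvgMl_tmp.
          apply: (@continuous_comp _ _ _ (fun p : R * R => (p.1, p.2 + s)) H); last first.
            by apply: cH; rewrite /upper_half_plane/= add0r.
          by apply: cvg_pairR; [exact: cvg_fst|apply: cvgD; [exact: cvg_snd|exact: cvg_cst]].
        have <- : Hs (p.1, 0) = pi * g p.1 by rewrite /Hs/= add0r.
        exact: (iffLR (cvgrPdist_lt _ _) ce _ e2).
      rewrite ep; move: k1 k2; apply: filterS2 => q k1 k2 q0.
      rewrite lerNl -mulrN (le_trans (ler_norm _))// normrM sg1 mul1r normrN.
      have -> : Hs q - v q = (Hs q - pi * g p.1) - (v q - pi * g p.1) by ring.
      rewrite (le_trans (ler_normB _ _))// [leRHS](splitr eta) lerD//; last exact: k1.
      by rewrite distrC ltW.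
    + by move: p20; rewrite leNgt pp.
    + have sc : snd q @[q --> p] --> p.2 by exact: cvg_snd.
      have : \forall z \near p, z.2 < 0 by exact: (cvgr_lt p.2 sc 0 pn).
      by apply: filterS => q qn q0; move: q0; rewrite /upper_half_plane/= ltNge ltW.
  - move=> eta eta0; have e2 : 0 < eta / 2 by rewrite divr_gt0.
    have [r1 hr1] := poisson_infty cg hM gv e2.
    have e3 : 0 < eta / 2 / pi by rewrite divr_gt0.
    have [r2 hr2] := Hv _ e3.
    exists (Num.max r1 r2) => p p0; rewrite gt_max => /andP[pr1 pr2].
    rewrite lerNl -mulrN (le_trans (ler_norm _))// normrM sg1 mul1r normrN.
    rewrite (le_trans (ler_normB _ _))// [leRHS](splitr eta) lerD//; last exact: hr1.
    rewrite /Hs normrM (gtr0_norm pi1) mulrC -ler_pdivlMr// ltW// hr2//.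
      exact: ups.
    apply: (lt_le_trans pr2); rewrite !prod_normE/= ge_max !le_max lexx/=.
    apply/orP; right; rewrite !gtr0_norm ?addr_gt0//.
    by rewrite lerDl ltW.
apply/eqP; rewrite -subr_eq0; apply/eqP/le_anti/andP; split.
  have := main 1 (normr1 _) z z0; rewrite mul1r /v /poisson /Hs.
  by rewrite subr_ge0 subr_le0.
have := main (-1) (normrN1 _) z z0; rewrite mulN1r oppr_ge0 /v /poisson /Hs.
by rewrite subr_ge0 subr_le0.
Qed.

End PoissonKernel.

(** * [H] as the Poisson integral of the distribution [f] *)

Section BoundaryRepresentation.
Context {R : realType}.
Notation mu := (@lebesgue_measure R).

Lemma smooth_family_inv_quad I (W : set I) (x y : I -> R) (kappa : R -> R) (c K : R) :
  0 < c -> smooth kappa -> (forall i, W i -> `|x i| <= K /\ `|y i| <= K) ->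
  (forall i, W i -> forall t, c <= (t - x i) ^+ 2 + y i ^+ 2 + kappa t) ->
  smooth_family W (fun i t => ((t - x i) ^+ 2 + y i ^+ 2 + kappa t)^-1).
Proof.
move=> c0 sk hK hc; apply: (smooth_familyV c0) => //.
apply: smooth_familyD; last exact: smooth_smooth_family.
have sx : smooth_family W (fun i _ => x i) by apply: (@smooth_family_cst _ _ _ _ K) => i /hK[].
have sy : smooth_family W (fun i _ => y i) by apply: (@smooth_family_cst _ _ _ _ K) => i /hK[].
have st := smooth_familyB (smooth_family_id W) sx.
by apply: smooth_familyD; [exact: (smooth_familyM st st)|exact: (smooth_familyM sy sy)].
Qed.

Lemma smooth_pker (z : R * R) : 0 < z.2 -> smooth (pker z).
Proof.
move=> y0; apply: (@smoothM _ (fun=> z.2)); first exact: smooth_cst.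
have -> : (fun t => ((t - z.1) ^+ 2 + z.2 ^+ 2)^-1) =
    (fun t => ((t - z.1) ^+ 2 + z.2 ^+ 2 + (fun=> 0) t)^-1) by apply/funext => t; rewrite addr0.
have sf : smooth_family (setT : set unit)
    (fun=> fun t => ((t - z.1) ^+ 2 + z.2 ^+ 2 + (fun=> 0) t)^-1).
  apply: (@smooth_family_inv_quad _ _ (fun=> z.1) (fun=> z.2) (fun=> 0) (z.2 ^+ 2)
    (Num.max `|z.1| `|z.2|)).
  - by rewrite exprn_gt0.
  - exact: smooth_cst.
  - by move=> _ _; rewrite !le_max !lexx orbT.
  - by move=> _ _ t; rewrite addr0 lerDr sqr_ge0.
exact: (smooth_family_smooth (i := tt) sf).
Qed.

Variables (H : R * R -> R) (f : (R -> R) -> R).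
Hypothesis H_harmonic : harmonic_on upper_half_plane H.
Hypothesis H_infty : vanishes_at_infinity_on upper_half_plane H.
Hypothesis f_compact : compact_distribution f.
Hypothesis H_limit : has_distr_boundary_limit H f.

(** Let [s] tend to [0] in [poisson_representation]. The kernel is not a test function: after a
    cutoff [H_limit] applies, and the rest is at most [eta / 3] uniformly in [s], because [H] is
    small far away. That cutoff depends on [eta]; replacing it by the given [chi] changes nothing,
    as [f] has compact support. *)
Lemma boundary_representation : exists A : R, 0 < A /\ forall chi, test_function chi ->
  (forall t, `|t| < A -> chi t = 1) -> forall z, 0 < z.2 ->
  pi * H z = f (fun t => chi t * pker z t).
Proof.
have [df cf] := f_compact; have [A0 [A00 hA0]] := compactly_supportedP cf.
exists A0; split=> // chi tchi chi1 z z0.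
apply/eqP; rewrite -subr_eq0 -normr_eq0; apply/eqP/le_anti/andP; split => //.
apply/ler_addgt0Pl => eta eta0; rewrite addr0.
have pi1 := pi_gt0 R.
have e3 : 0 < eta / 3 by rewrite divr_gt0.
have e4 : 0 < eta / 3 / pi by rewrite divr_gt0.
have [r hr] := H_infty e4; pose A := Num.max A0 r.
have AA0 : A0 <= A by rewrite le_max lexx.
have rA : r <= A by rewrite le_max lexx orbT.
pose chi' := plateau (- A - 1) (- A) A (A + 1) : R -> R.
have c1 : - A - 1 < - A by lra.
have c2 : A < A + 1 by lra.
have chi'1 t : `|t| <= A -> chi' t = 1.
  by rewrite ler_norml => h; rewrite /chi' plateau1.
have tchi' : test_function chi' by exact: test_plateau.
have sp := smooth_pker z0.
have tp := testM tchi sp; have tp' := testM tchi' sp.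
have -> : f (fun t => chi t * pker z t) = f (fun t => chi' t * pker z t).
  apply/eqP; rewrite -subr_eq0 -(distrB df)//; apply/eqP/hA0; first exact: testB.
  by move=> t tA; rewrite chi1// chi'1 ?subrr// (le_trans (ltW tA)).
set rho := fun t => chi' t * pker z t.
have tail (s : R) : 0 < s -> `|pi * H (z.1, z.2 + s) - \int[mu]_t (H (t, s) * rho t)| <= eta / 3.
  move=> s0; have [M hM] := slice_bounded H_harmonic H_infty s0.
  have cg := slice_continuous H_harmonic s0.
  have mg : measurable_fun setT (fun t => H (t, s)) by exact: continuous_measurable_fun.
  have mc : measurable_fun setT chi'.
    by apply: continuous_measurable_fun; exact: smooth_continuous (test_smooth tchi').
  have mp := measurable_pker z0.
  have i1 := integrable_poisson cg hM z0.
  have M0 : 0 <= M by exact: le_trans (normr_ge0 _) (hM 0).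
  have [i2 _] : mu.-integrable setT (EFin \o (fun t => H (t, s) * rho t)) /\
      `|\int[mu]_t (H (t, s) * rho t)| <= (M + 0) * pi.
    apply: (@pker_dominated _ _ M 0 z z z0 z0).
      by apply: measurable_funM => //; exact: measurable_funM.
    move=> t; rewrite mul0r addr0 normrM ler_pM// /rho normrM.
    rewrite [X in _ * X]gtr0_norm ?pker_gt0// ger0_norm ?plateau_ge0//.
    by rewrite ler_piMl ?plateau_le1// ltW// pker_gt0.
  rewrite -(poisson_representation H_harmonic H_infty s0 z0) -RintegralB//.
  have [] // := @pker_dominated _ (fun t => H (t, s) * pker z t - H (t, s) * rho t)
    (eta / 3 / pi) 0 z z z0 z0.
  - apply: measurable_funB; first exact: measurable_funM.
    by apply: measurable_funM => //; exact: measurable_funM.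
  - move=> t; rewrite mul0r addr0.
    have -> : H (t, s) * pker z t - H (t, s) * rho t = (H (t, s) * (1 - chi' t)) * pker z t.
      by rewrite /rho; ring.
    rewrite normrM [X in _ * X]gtr0_norm ?pker_gt0// ler_wpM2r ?(ltW (pker_gt0 _ z0))//.
    have [tA|tA] := leP `|t| A; first by rewrite chi'1// subrr mulr0 normr0 ltW.
    rewrite normrM (@le_trans _ _ (`|H (t, s)| * 1))//.
      rewrite ler_wpM2l// ger0_norm ?subr_ge0 ?plateau_le1// gerBl; exact: plateau_ge0.
    rewrite mulr1 ltW// hr//.
    by rewrite (le_lt_trans rA)// (lt_le_trans tA)// prod_normE le_max lexx.
  by move=> _ /le_trans; apply; rewrite addr0 divfK// gt_eqF.
have lim1 : (fun s => pi * H (z.1, z.2 + s)) @ (0 : R)^'+ --> pi * H z.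
  apply: cvgMl_tmp.
  have e : z = (z.1, z.2 + 0) by rewrite addr0 -surjective_pairing.
  have h1 : (fun s : R => (z.1, z.2 + s)) @ (0 : R)^'+ --> (z.1, z.2 + 0).
    apply: cvg_pairR; first exact: cvg_cst.
    by apply: cvgD; [exact: cvg_cst|exact: cvg_at_right_filter cvg_id].
  have cH : {for z, continuous H} by case: H_harmonic => -[h _] _; exact: h.
  rewrite -e in h1; exact: (cvg_comp _ _ h1 cH).
have lim2 := H_limit tp'.
have k1 := iffLR (cvgrPdist_lt _ _) lim1 _ e3.
have k2 := iffLR (cvgrPdist_lt _ _) lim2 _ e3.
have [s [/= s0 [h1 h2]]] := @filter_ex _ ((0 : R)^'+) _ _
  (filterI (nbhs_right_gt (0 : R)) (filterI (k1 _) (k2 _))).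
have h3 := tail s s0.
have -> : pi * H z - f rho = (pi * H z - pi * H (z.1, z.2 + s)) +
  (pi * H (z.1, z.2 + s) - \int[mu]_t (H (t, s) * rho t)) -
  (f rho - \int[mu]_t (H (t, s) * rho t)) by ring.
rewrite (le_trans (ler_normB _ _))//.
have := ler_normD (pi * H z - pi * H (z.1, z.2 + s)) (pi * H (z.1, z.2 + s) - \int[mu]_t (H (t, s) * rho t)).
have h1' := ltW h1; have h2' := ltW h2; rewrite /= in h1' h2'.
lra.
Qed.

End BoundaryRepresentation.

(** * Behaviour at one boundary point *)

Section ScalingLimit.
Context {R : realType}.
Notation mu := (@lebesgue_measure R).

Lemma Rintegral_vanishes_off (g : R -> R) (a b : R) : vanishes_off a b g ->
  \int[mu]_x g x = \int[mu]_(x in `[a, b]) g x.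
Proof.
move=> hg; rewrite [RHS]Rintegral_mkcond; apply: eq_Rintegral => x _.
rewrite patchE; case: ifPn => // /negP xab; apply: hg; apply/negP => h; apply: xab.
by rewrite inE/= in_itv.
Qed.

Lemma Rintegral_derive1_test (phi : R -> R) : test_function phi ->
  \int[mu]_x derive1 phi x = 0.
Proof.
move=> tphi; have [A [A0 vphi]] := test_vanishes_off tphi.
have sphi := test_smooth tphi; have sphi' := smooth_derive1 sphi.
have c1 : - (A + 1) < A + 1 by lra.
have v' : vanishes_off (- (A + 1)) (A + 1) (derive1 phi).
  by apply: vanishes_offS (vanishes_off_derive1 vphi); lra.
rewrite (Rintegral_vanishes_off v') /Rintegral (@continuous_FTC2 _ _ phi)//.
- have -> : phi (A + 1) = 0 by apply: (vanishes_offr vphi); lra.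
  by rewrite (vanishes_offl vphi) ?sube0//; lra.
- by apply: continuous_subspaceT; exact: smooth_continuous.
- have cphi := smooth_continuous sphi; split.
  + by move=> x _; exact: (sphi 0%N x).
  + by apply: cvg_at_right_filter; exact: cphi.
  + by apply: cvg_at_left_filter; exact: cphi.
Qed.

(** Differentiating the dilate brings out [1 / e], which up to sign is the normalisation in
    [has_point_value]. The point value drops out, since a derivative of a test function has integral
    [0]. *)
Lemma Lojasiewicz_scaling (F f : (R -> R) -> R) : Lojasiewicz_distribution F ->
  is_distr_derivative F f -> forall a phi, test_function phi ->
  f (dilate a e phi) @[e --> (0 : R)^'] --> (0 : R).
Proof.
move=> [dF lF] Ff a phi tphi; have [gamma hg] := lF a.
have sphi := test_smooth tphi; have [A [A0 vphi]] := test_vanishes_off tphi.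
have tphi' : test_function (derive1 phi).
  exact: vanishes_off_test (smooth_derive1 sphi) (vanishes_off_derive1 vphi).
have := hg _ tphi'; rewrite Rintegral_derive1_test// mulr0 => lim.
apply/cvgrPdist_lt => eta eta0.
have := iffLR (cvgrPdist_lt _ _) lim _ eta0; move=> /(_ _) lim'.
near=> e.
have e0 : e != 0 by near: e; exact: nbhs_dnbhs_neq.
rewrite Ff; last exact: test_dilate.
have -> : derive1 (dilate a e phi) = (fun t => e^-1 * dilate a e (derive1 phi) t).
  by have := derive1n_dilate a e 1 sphi; rewrite derive1n1 expr1.
rewrite (distrZ dF); last exact: test_dilate.
rewrite sub0r opprK normrM normfV.
suff : `|0 - `|e|^-1 * F (dilate a e (derive1 phi))| < eta.
  by rewrite sub0r normrN normrM normfV normr_id.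
by near: e; exact: lim'.
Unshelve. all: by end_near. Qed.

End ScalingLimit.

(** * Estimates for [f] near one point and away from it *)

Section LocalEstimates.
Context {R : realType}.
Variable f : (R -> R) -> R.
Hypothesis f_distr : Defs.distribution f.
Hypothesis f_supp : compactly_supported f.

Lemma smooth_family_scale I (W : set I) (phi : R -> R) (psi : I -> R -> R) :
  smooth phi -> smooth_family W psi -> smooth_family W (fun i t => phi t * psi i t).
Proof. by move=> h1 h2; apply: smooth_familyM => //; exact: smooth_smooth_family. Qed.

(** Off [[c, d]] the kernel has no singularity for [z.1] in [[c', d']], so it is [z.2] times a
    member of a bounded family. The bump [kappa] bounds the denominators below for all [t]. *)
Lemma far_part (chi sigma : R -> R) (c c' d' d : R) : test_function chi -> smooth sigma ->
  (forall t, c <= t <= d -> sigma t = 1) -> c < c' -> d' < d ->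
  exists C : R, 0 <= C /\ forall z : R * R, c' <= z.1 <= d' -> 0 < z.2 -> z.2 <= 1 ->
    `|f (fun t => chi t * (1 - sigma t) * pker z t)| <= C * z.2.
Proof.
move=> tchi ssig sig1 cc dd.
pose c1 := (c + c') / 2; pose d1 := (d + d') / 2.
have cc1 : c < c1 by rewrite /c1; lra.
have dd1 : d1 < d by rewrite /d1; lra.
pose kappa := plateau c c1 d1 d : R -> R.
pose m := Num.min 1 (Num.min ((c' - c) / 2) ((d - d') / 2)).
have m0 : 0 < m by rewrite !lt_min ltr01 !divr_gt0// subr_gt0.
pose W := [set z : R * R | c' <= z.1 <= d' /\ 0 < z.2 <= 1].
have low (z : R * R) : W z -> forall t, m ^+ 2 <= (t - z.1) ^+ 2 + z.2 ^+ 2 + kappa t.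
  move=> [/andP[z1 z2] /andP[z3 z4]] t.
  have m1 : m <= 1 by rewrite ge_min lexx.
  have m2 : m <= (c' - c) / 2 by rewrite !ge_min lexx orbT.
  have m3 : m <= (d - d') / 2 by rewrite !ge_min lexx !orbT.
  have k0 : 0 <= kappa t := plateau_ge0 _ _ _ _ _.
  have y2 : 0 <= z.2 ^+ 2 := sqr_ge0 _.
  have [tin|] := boolP (c1 <= t <= d1).
    have -> : kappa t = 1 by exact: plateau1.
    have : m ^+ 2 <= 1 by rewrite expr_le1// ltW.
    by have := sqr_ge0 (t - z.1); lra.
  have sq (u : R) : m <= u -> m ^+ 2 <= u ^+ 2.
    by move=> mu; rewrite lerXn2r ?nnegrE ?(ltW m0) ?(le_trans (ltW m0)).
  rewrite negb_and -!ltNge => /orP[h|h].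
    have h' : m <= z.1 - t by rewrite /c1 in h; lra.
    have e2 : (t - z.1) ^+ 2 = (z.1 - t) ^+ 2 by ring.
    by have := sq _ h'; rewrite e2; lra.
  have h' : m <= t - z.1 by rewrite /d1 in h; lra.
  by have := sq _ h'; lra.
pose psi (z : R * R) t := chi t * (1 - sigma t) * ((t - z.1) ^+ 2 + z.2 ^+ 2 + kappa t)^-1.
have sfam : smooth_family W psi.
  apply: (@smooth_family_scale _ _ (fun t => chi t * (1 - sigma t))).
    apply: smoothM; first exact: test_smooth.
    exact: smoothB (smooth_cst 1) ssig.
  apply: (@smooth_family_inv_quad _ _ _ fst snd kappa (m ^+ 2) (Num.max (`|c'| + `|d'|) 1)).
  - by rewrite exprn_gt0.
  - exact: smooth_plateau.
  - move=> z [/andP[z1 z2] /andP[z3 z4]]; rewrite !le_max (gtr0_norm z3) z4 orbT; split=> //.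
    apply/orP; left; rewrite ler_norml; apply/andP; split.
      by have := ler_norm (- c'); rewrite normrN; have := normr_ge0 d'; lra.
    by have := ler_norm d'; have := normr_ge0 c'; lra.
  - exact: low.
have [A [A0 vchi]] := test_vanishes_off tchi.
have [|C [C0 hC]] := distr_family_bound f_distr sfam (A := A).
  by move=> z _; apply: vanishes_offMl; exact: vanishes_offMl.
exists C; split=> // z z1 z2 z3.
have Wz : W z by split=> //; rewrite z2.
have -> : (fun t => chi t * (1 - sigma t) * pker z t) = (fun t => z.2 * psi z t).
  (* Adding [kappa] is harmless: where it is not [0], [sigma] is [1] and both sides vanish. *)
  apply/funext => t; rewrite /psi /pker /rker.
  have [k0|k0] := eqVneq (kappa t) 0; first by rewrite k0 addr0; ring.
  have -> : 1 - sigma t = 0; last by ring.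
  rewrite sig1 ?subrr//; apply/andP; split; rewrite leNgt; apply/negP => ht.
    by move: k0; rewrite /kappa plateau0l ?eqxx// ltW.
  by move: k0; rewrite /kappa plateau0r ?eqxx// ltW.
rewrite (distrZ f_distr); last first.
  apply: (vanishes_off_test (smooth_family_smooth sfam Wz) (a := - A) (b := A)).
  by apply: vanishes_offMl; exact: vanishes_offMl.
by rewrite normrM (gtr0_norm z2) mulrC ler_wpM2r ?(ltW z2)// hC.
Qed.

(** Split [phi] by a cutoff at scale [e] around [a]. The inner part is small by [cutoff_vanishing];
    the outer part falls into a left and a right piece, each of which lies where [f] is positive. So
    [f phi] exceeds every negative number. *)
Lemma removable_point (a c d : R) : c < a < d ->
  (forall phi, test_function phi -> f (dilate a e phi) @[e --> (0 : R)^'] --> (0 : R)) ->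
  (forall x, c < x < d -> x != a -> exists2 e : R, 0 < e & pos_on f (x - e) (x + e)) ->
  exists2 e : R, 0 < e & pos_on f (a - e) (a + e).
Proof.
move=> /andP[ca ad] scal loc.
pose del := Num.min ((a - c) / 2) ((d - a) / 2).
have del0 : 0 < del by rewrite lt_min !divr_gt0// subr_gt0.
have del1 : del <= (a - c) / 2 by rewrite ge_min lexx.
have del2 : del <= (d - a) / 2 by rewrite ge_min lexx orbT.
exists del => // phi sphi phi0 vphi.
rewrite leNgt; apply/negP => fneg.
pose chi := plateau (- 2) (- 1) 1 2 : R -> R.
have l1 : - 2 < - 1 :> R by lra.
have l2 : 1 < 2 :> R by lra.
have tchi : test_function chi by exact: test_plateau.
have lim := cutoff_vanishing f_distr f_supp scal sphi tchi.
have fn : 0 < - f phi by lra.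
have k1 := iffLR (cvgrPdist_lt _ _) lim _ fn.
have [e [/= e0 he]] : exists e : R, 0 < e /\ `|0 - f (fun t => phi t * dilate a e chi t)| < - f phi.
  case: (k1 _) => r /= r0 hr.
  have r2 : 0 < r / 2 by rewrite divr_gt0.
  exists (r / 2); split => //; apply: hr; last by rewrite gt_eqF.
  by rewrite /= sub0r normrN gtr0_norm//; lra.
have ne0 : e != 0 by rewrite gt_eqF.
have sd : smooth (dilate a e chi) by exact: smooth_dilate (test_smooth tchi).
have d01 t : 0 <= 1 - dilate a e chi t by rewrite subr_ge0 plateau_le1.
have d1 t : a - e <= t <= a + e -> 1 - dilate a e chi t = 0.
  move=> /andP[t1 t2]; rewrite /dilate /chi plateau1 ?subrr//.
  by rewrite ler_pdivlMr// ler_pdivrMr// mulN1r mul1r; apply/andP; split; lra.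
pose s := step (a - e) (a + e) : R -> R.
have ss : smooth s := smooth_step _ _.
have ee : a - e < a + e by lra.
have tphi : test_function phi := vanishes_off_test sphi vphi.
have s1d : smooth (fun t => 1 - dilate a e chi t) := smoothB (smooth_cst 1) sd.
have s1s : smooth (fun t => 1 - s t) := smoothB (smooth_cst 1) ss.
have sphid : smooth (fun t => phi t * (1 - dilate a e chi t)) := smoothM sphi s1d.
have p1 : 0 <= f (fun t => phi t * (1 - dilate a e chi t) * (1 - s t)).
  have pl : pos_on f (a - del) (a - e).
    apply: pos_on_glue => // x /andP[x1 x2]; apply: loc; last by rewrite lt_eqF//; lra.
    by apply/andP; split; lra.
  apply: pl; first exact: smoothM.
    by move=> t; rewrite !mulr_ge0// subr_ge0 step_le1.
  apply: vanishes_offP => t ht; first by rewrite (vanishes_offl vphi)// !mul0r.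
  have [te|te] := leP t (a + e); first by rewrite d1 ?mulr0 ?mul0r// te andbT ltW.
  by rewrite /s step1 ?subrr ?mulr0// ltW.
have p2 : 0 <= f (fun t => phi t * (1 - dilate a e chi t) * s t).
  have pr : pos_on f (a + e) (a + del).
    apply: pos_on_glue => // x /andP[x1 x2]; apply: loc; last by rewrite gt_eqF//; lra.
    by apply/andP; split; lra.
  apply: pr; first exact: smoothM.
    by move=> t; apply: mulr_ge0; [exact: mulr_ge0|exact: step_ge0].
  apply: vanishes_offP => t ht; last by rewrite (vanishes_offr vphi)// !mul0r.
  have [te|te] := leP (a - e) t; first by rewrite d1 ?mulr0 ?mul0r// te/= ltW.
  by rewrite /s step0 ?mulr0// ltW.
have split_f : f phi = f (fun t => phi t * dilate a e chi t) +
  (f (fun t => phi t * (1 - dilate a e chi t) * (1 - s t)) +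
   f (fun t => phi t * (1 - dilate a e chi t) * s t)).
  have t1 : test_function (fun t => phi t * (1 - dilate a e chi t)) := testM tphi s1d.
  rewrite -(distrD f_distr); [|exact: testM|exact: testM].
  rewrite -(distrD f_distr); [|exact: testM|]; last by apply: testD; exact: testM.
  by congr f; apply/funext => t; ring.
by move: he; rewrite sub0r normrN ltr_norml => /andP[]; lra.
Qed.

(* [kappa] keeps the denominator away from [0]; it is chosen to vanish wherever the factor
   multiplying [iquad] does not. *)
Definition iquad (kappa : R -> R) (v : R * R) (t : R) : R :=
  ((t - v.1) ^+ 2 + v.2 ^+ 2 + kappa t)^-1.

(** [dilation_uniform] with explicit divided differences: [1/q - 1/q' = (q' - q) / (q * q')], and
    [q' - q] is a combination of the two parameter increments with coefficients [E1] and [E2]. A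
    zero slope in [al] or [ga] freezes one coordinate of the pole, giving one side of a square. *)
Lemma iquad_uniform (a : R) (beta kappa : R -> R) (al ga : R * R) (c : R) :
  (forall phi, test_function phi -> f (dilate a e phi) @[e --> (0 : R)^'] --> (0 : R)) ->
  let v (s : R * R) := (al.1 + al.2 * s.1, ga.1 + ga.2 * s.2) in
  test_function beta -> smooth kappa -> 0 < c ->
  (forall s : R * R, 0 <= s.1 <= 1 -> 0 <= s.2 <= 1 ->
     forall t, c <= (t - (v s).1) ^+ 2 + (v s).2 ^+ 2 + kappa t) ->
  (exists M : R, 0 <= M /\ forall e s, e != 0 -> 0 <= s.1 <= 1 -> 0 <= s.2 <= 1 ->
     `|f (dilate a e (fun t => beta t * iquad kappa (v s) t))| <= M) /\
  (forall eta : R, 0 < eta -> \forall e \near (0 : R)^', forall s, 0 <= s.1 <= 1 -> 0 <= s.2 <= 1 ->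
     `|f (dilate a e (fun t => beta t * iquad kappa (v s) t))| <= eta).
Proof.
move=> scal v tbeta skappa c0 low.
pose Q := [set s : R * R | (0 <= s.1 <= 1) /\ (0 <= s.2 <= 1)].
have sbeta := test_smooth tbeta; have [A [A0 vbeta]] := test_vanishes_off tbeta.
pose K := `|al.1| + `|al.2| + `|ga.1| + `|ga.2|.
have bd (u w x : R) : 0 <= x <= 1 -> `|u + w * x| <= `|u| + `|w|.
  move=> /andP[x0 x1]; rewrite (le_trans (ler_normD _ _))// lerD2l normrM.
  by rewrite ler_piMr// ger0_norm.
have vK s : Q s -> `|(v s).1| <= K /\ `|(v s).2| <= K.
  move=> [s1 s2]; have b1 := bd al.1 al.2 _ s1; have b2 := bd ga.1 ga.2 _ s2.
  have := normr_ge0 al.1; have := normr_ge0 al.2; have := normr_ge0 ga.1; have := normr_ge0 ga.2.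
  by rewrite /K /v /=; split; lra.
have sI : smooth_family Q (fun s => iquad kappa (v s)).
  apply: (@smooth_family_inv_quad _ _ _ (fun s => (v s).1) (fun s => (v s).2) kappa c K) => //.
  by move=> s [s1 s2]; exact: low.
have sBI := smooth_family_scale sbeta sI.
have vBI (psi : R -> R) : vanishes_off (- A) A (fun t => beta t * psi t) by exact: vanishes_offMl.
split.
  have [M [M0 hM]] := dilation_family_bounded f_distr f_supp scal sBI (fun s _ => vBI _).
  by exists M; split=> // e s e0 s1 s2; exact: hM.
have pick1 : smooth_family (Q `*` Q) (fun p => iquad kappa (v p.1)).
  apply: (@smooth_family_inv_quad _ _ _ (fun p => (v p.1).1) (fun p => (v p.1).2) kappa c K) => //.
    by move=> [s s'] [/vK].
  by move=> [s s'] [[s1 s2] _]; exact: low.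
have pick2 : smooth_family (Q `*` Q) (fun p => iquad kappa (v p.2)).
  apply: (@smooth_family_inv_quad _ _ _ (fun p => (v p.2).1) (fun p => (v p.2).2) kappa c K) => //.
    by move=> [s s'] [_ /vK].
  by move=> [s s'] [_ [s1 s2]]; exact: low.
have pick12 := smooth_familyM pick1 pick2.
pose E1 (p : (R * R) * (R * R)) (t : R) := al.2 * (2 * t - (v p.1).1 - (v p.2).1).
pose E2 (p : (R * R) * (R * R)) (t : R) := - (ga.2 * ((v p.1).2 + (v p.2).2)).
have sE1 : smooth_family (Q `*` Q) E1.
  apply: smooth_family_scale; first exact: smooth_cst.
  apply: smooth_familyB; last by apply: (@smooth_family_cst _ _ _ _ K) => -[s s'] [_ /vK[]].
  apply: smooth_familyB; last by apply: (@smooth_family_cst _ _ _ _ K) => -[s s'] [/vK[]].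
  by apply: smooth_family_scale; [exact: smooth_cst|exact: smooth_family_id].
have sE2 : smooth_family (Q `*` Q) E2.
  apply: (@smooth_family_cst _ _ _ (fun p => - (ga.2 * ((v p.1).2 + (v p.2).2))) (`|ga.2| * (K + K))).
  move=> [s s'] [/vK[_ h1] /vK[_ h2]]; rewrite normrN normrM ler_wpM2l//.
  by rewrite (le_trans (ler_normD _ _))// lerD.
pose D1 p t := beta t * (E1 p t * (iquad kappa (v p.1) t * iquad kappa (v p.2) t)).
pose D2 p t := beta t * (E2 p t * (iquad kappa (v p.1) t * iquad kappa (v p.2) t)).
suff DU : forall eta : R, 0 < eta -> \forall e \near (0 : R)^', forall s, Q s ->
    `|f (dilate a e (fun t => beta t * iquad kappa (v s) t))| <= eta.
  by move=> eta /DU; apply: filterS => e h s s1 s2; exact: h.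
apply: (@dilation_uniform _ f a f_distr f_supp scal (fun s t => beta t * iquad kappa (v s) t) D1 D2 A).
- by move=> s Qs; split; [exact: (smooth_family_smooth sBI Qs)|exact: vBI].
- exact: smooth_family_scale sbeta (smooth_familyM sE1 pick12).
- exact: smooth_family_scale sbeta (smooth_familyM sE2 pick12).
- by move=> p _; split; exact: vBI.
- move=> s s' [s1 s2] [s1' s2'] t; rewrite /D1 /D2 /E1 /E2 /iquad /=.
  have n1 : (t - (v s).1) ^+ 2 + (v s).2 ^+ 2 + kappa t != 0.
    by rewrite gt_eqF// (lt_le_trans c0)// low.
  have n2 : (t - (v s').1) ^+ 2 + (v s').2 ^+ 2 + kappa t != 0.
    by rewrite gt_eqF// (lt_le_trans c0)// low.
  move: n1 n2; rewrite /v /= => n1 n2; field.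
  by rewrite n1 n2.
Qed.

End LocalEstimates.

Lemma telescope_geometric (R : realType) (a : nat -> R) (k c : R) : 0 <= k -> 0 <= c ->
  (forall m, k * `|a m.+1 - a m| <= 2^-1 ^+ m.+1 * c) -> forall m, k * `|a m - a 0%N| <= c.
Proof.
move=> k0 c0 ha m.
suff : k * `|a m - a 0%N| <= (1 - 2^-1 ^+ m) * c.
  by move=> /le_trans; apply; rewrite ler_piMl// gerBl exprn_ge0.
elim: m => [|m IH]; first by rewrite subrr normr0 mulr0 expr0 subrr mul0r.
have h2 := ha m; have := ler_normD (a m.+1 - a m) (a m - a 0%N); rewrite addrA subrK => h1.
have h3 : k * `|a m.+1 - a 0%N| <= k * (`|a m.+1 - a m| + `|a m - a 0%N|) by rewrite ler_wpM2l.
by move: h2 h3 IH; rewrite !exprS; lra.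
Qed.

(** * Growth of [H] at an end point of a gap *)

Section Corner.
Context {R : realType}.
Variables (H : R * R -> R) (f : (R -> R) -> R).
Hypothesis H_harmonic : harmonic_on upper_half_plane H.
Hypothesis H_infty : vanishes_at_infinity_on upper_half_plane H.
Hypothesis f_compact : compact_distribution f.
Hypothesis H_limit : has_distr_boundary_limit H f.

(** Ingredients of the dyadic partition: [dbeta], the difference of the cutoff [dchi] at two
    consecutive scales, lives on [1 <= |u| <= 4], while [dkappa] lives on [|u| <= 1]. *)
Let dchi := plateau (- 4) (- 2) 2 4 : R -> R.
Let dbeta (u : R) := dchi u - dchi (2 * u).
Let dkappa := plateau (- 1) (- (3 / 4)) (3 / 4) 1 : R -> R.

Let dchi_test : test_function dchi.
Proof. by apply: test_plateau; lra. Qed.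

Let dchi2_smooth : smooth (fun u => dchi (2 * u)).
Proof.
have -> : (fun u : R => dchi (2 * u)) = (fun u => dchi (0 + 2 * u)).
  by apply/funext => u; rewrite add0r.
exact: smooth_comp_affine (test_smooth dchi_test).
Qed.

Let dchi_off (u : R) : 4 <= `|u| -> dchi u = 0.
Proof.
move=> hu; have [u0|u0] := ltP u 0.
  by apply: plateau0l; [lra|move: hu; rewrite ltr0_norm//; lra].
by apply: plateau0r; [lra|move: hu; rewrite ger0_norm].
Qed.

Let dchi_on (u : R) : `|u| <= 2 -> dchi u = 1.
Proof. by rewrite ler_norml => /andP[h1 h2]; apply: plateau1; [lra|lra|rewrite h2 andbT; lra]. Qed.

Let dbeta_test : test_function dbeta.
Proof.
apply: testB => //; apply: (vanishes_off_test dchi2_smooth (a := - 4) (b := 4)).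
apply: vanishes_offP => u hu; apply: dchi_off; rewrite normrM ger0_norm//.
  by rewrite ltr0_norm; lra.
by rewrite gtr0_norm; lra.
Qed.

Let dbeta_in (u : R) : `|u| <= 1 -> dbeta u = 0.
Proof.
move=> hu; have h2 : `|2 * u| <= 2 by rewrite normrM ger0_norm//; lra.
by rewrite /dbeta (dchi_on h2) dchi_on ?subrr//; lra.
Qed.

Let dkappa_out (u : R) : 1 < `|u| -> dkappa u = 0.
Proof.
have [un|up] := ltP u 0.
  by rewrite ltr0_norm// => h; apply: plateau0l; lra.
by rewrite ger0_norm// => h; apply: plateau0r; lra.
Qed.

Lemma smooth_iquad (kappa : R -> R) (v : R * R) (c : R) : smooth kappa -> 0 < c ->
  (forall t, c <= (t - v.1) ^+ 2 + v.2 ^+ 2 + kappa t) -> smooth (iquad kappa v).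
Proof.
move=> sk c0 hc.
have s1 : smooth (fun t => t - v.1) := smoothB smooth_id (smooth_cst v.1).
have s2 : smooth (fun t => (t - v.1) ^+ 2) := smoothM s1 s1.
exact: (smoothV c0 hc (smoothD (smoothD s2 (smooth_cst (v.2 ^+ 2))) sk)).
Qed.

Let sqge (m u : R) : 0 <= m -> m <= `|u| -> m ^+ 2 <= u ^+ 2.
Proof. by move=> m0 mu; rewrite -[u ^+ 2]real_normK ?num_real// lerXn2r ?nnegrE. Qed.

Let sq16 : (1 / 4) ^+ 2 = 1 / 16 :> R. Proof. by field. Qed.

(** Seen at scale [2^(m+1)], the pole is [w / 2^(m+1)], in the square [[0, 1/2]^2]. Either
    [|t| <= 3/4] and [dkappa t = 1], or [t] is at distance at least [1/4] from its abscissa. *)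
Let lowD (s : R * R) : 0 <= s.1 <= 1 -> 0 <= s.2 <= 1 -> forall t,
  1 / 16 <= (t - (0 + 1 / 2 * s.1)) ^+ 2 + (0 + 1 / 2 * s.2) ^+ 2 + dkappa t.
Proof.
move=> /andP[s1 s1'] _ t; rewrite !add0r.
have k0 : 0 <= dkappa t := plateau_ge0 _ _ _ _ _.
have y0 := sqr_ge0 (1 / 2 * s.2).
have [ht|ht] := leP `|t| (3 / 4).
  have -> : dkappa t = 1.
    by move: ht; rewrite ler_norml => h; apply: plateau1 => //; lra.
  by have := sqr_ge0 (t - 1 / 2 * s.1); lra.
have : (1 / 4) ^+ 2 <= (t - 1 / 2 * s.1) ^+ 2.
  apply: sqge; first lra.
  have := ler_normD (t - 1 / 2 * s.1) (1 / 2 * s.1); rewrite subrK.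
  by rewrite [X in _ <= _ + X]ger0_norm; lra.
by lra.
Qed.

(** At scale [1] the point [w] is on the right or the top side of the unit square, so the kernel can
    be singular only near [t = 1]. [sig] isolates that region, where [f] will be assumed positive,
    and [kap] lives where [sig = 1]. *)
Let sig := plateau (1 / 4) (1 / 2) (3 / 2) 2 : R -> R.
Let kap := plateau (1 / 2) (3 / 4) (5 / 4) (3 / 2) : R -> R.

Let sig_kap (u : R) : sig u = 1 \/ kap u = 0.
Proof.
have [u1|u1] := leP u (1 / 2); first by right; apply: plateau0l => //; lra.
have [u2|u2] := leP (3 / 2) u; first by right; apply: plateau0r => //; lra.
by left; apply: plateau1; [lra|lra|apply/andP; split; lra].
Qed.

Let sig_supp : vanishes_off (1 / 4) 2 sig.
Proof. by apply: vanishes_off_plateau; lra. Qed.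

Let lowR (s : R * R) t : 1 / 16 <= (t - (1 + 0 * s.1)) ^+ 2 + (0 + 1 * s.2) ^+ 2 + kap t.
Proof.
rewrite add0r mul0r addr0 mul1r.
have k0 : 0 <= kap t := plateau_ge0 _ _ _ _ _.
have y0 := sqr_ge0 s.2.
have [ht|ht] := leP `|t - 1| (1 / 4).
  have -> : kap t = 1.
    by move: ht; rewrite ler_norml => /andP[h1 h2]; apply: plateau1; [lra|lra|apply/andP; split; lra].
  by have := sqr_ge0 (t - 1); lra.
have : (1 / 4) ^+ 2 <= (t - 1) ^+ 2 by apply: sqge; lra.
by lra.
Qed.

Let lowT (s : R * R) t : 1 / 16 <= (t - (0 + 1 * s.1)) ^+ 2 + (1 + 0 * s.2) ^+ 2 + kap t.
Proof.
rewrite add0r mul0r addr0 mul1r expr1n.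
have k0 : 0 <= kap t := plateau_ge0 _ _ _ _ _.
by have := sqr_ge0 (t - s.1); lra.
Qed.

Let ssig : smooth sig := smooth_plateau _ _ _ _.

Let gam u := dchi u * (1 - sig u).

Let tgam : test_function gam := testM dchi_test (smoothB (smooth_cst 1) ssig).

(** Homogeneity of the kernel. A negative [e] reflects the picture, so the two end points of a gap
    are treated together. *)
Lemma pker_dilate (a e : R) (w : R * R) (t : R) : e != 0 -> 0 < w.2 ->
  pker (a + e * w.1, `|e| * w.2) t = `|e|^-1 * dilate a e (pker w) t.
Proof.
move=> e0 w0; rewrite /dilate /pker /rker/=.
have n0 : 0 < `|e| by rewrite normr_gt0.
have e2 : `|e| ^+ 2 = e ^+ 2 by rewrite real_normK ?num_real.
have d1 := pker_den ((t - a) / e) w0.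
have -> : (t - (a + e * w.1)) ^+ 2 + (`|e| * w.2) ^+ 2 =
    `|e| ^+ 2 * (((t - a) / e - w.1) ^+ 2 + w.2 ^+ 2).
  by rewrite exprMn e2; field.
move: d1; set q := _ + w.2 ^+ 2 => q0.
by field; rewrite !gt_eqF.
Qed.

(* The Poisson kernel is cut dyadically around [a].  The piece at scale [2^m |e|] is a dilate
   of one of a compact family of test functions, with weight [4^-m]: the large scales are
   summable by uniform boundedness, and the finitely many others tend to [0] uniformly. *)
Lemma corner_estimate (a : R) :
  (forall phi, test_function phi -> f (dilate a e phi) @[e --> (0 : R)^'] --> (0 : R)) ->
  forall eta : R, 0 < eta -> \forall e \near (0 : R)^',
  (forall phi, smooth phi -> (forall t, 0 <= phi t) -> vanishes_off (1 / 4) 2 phi ->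
     0 <= f (dilate a e phi)) ->
  forall w : R * R, 0 <= w.1 <= 1 -> 0 < w.2 <= 1 -> w.1 = 1 \/ w.2 = 1 ->
  - eta <= `|e| * (pi * H (a + e * w.1, `|e| * w.2)).
Proof.
move=> scal eta eta0; have [df cf] := f_compact.
have [A [A0 repr]] := boundary_representation H_harmonic H_infty f_compact H_limit.
have e2 : 0 < eta / 2 by rewrite divr_gt0.
have e42 : eta / 4 <= eta / 2 by lra.
have e22 : - eta = - (eta / 2) + - (eta / 2) by lra.
have c0 : 0 < 1 / 16 :> R by rewrite divr_gt0.
have [[M [M0 hM]] dyU] := @iquad_uniform _ f df cf a dbeta dkappa (0, 1 / 2) (0, 1 / 2) (1 / 16)
  scal dbeta_test (smooth_plateau _ _ _ _) c0 lowD.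
have [_ rightU] := @iquad_uniform _ f df cf a gam kap (1, 0) (0, 1) (1 / 16)
  scal tgam (smooth_plateau _ _ _ _) c0 (fun s _ _ => lowR s).
have [_ topU] := @iquad_uniform _ f df cf a gam kap (0, 1) (1, 0) (1 / 16)
  scal tgam (smooth_plateau _ _ _ _) c0 (fun s _ _ => lowT s).
(* Beyond scale [J0] the uniform bound [M] suffices; the scales up to [J0] are finitely many, and
   [dyS] treats them by the uniform limit. *)
have [J0 hJ0] : exists J0 : nat, M * 2^-1 ^+ J0 <= eta / 4.
  exists (Num.truncn (4 * M / eta)).+1.
  rewrite exprVn ler_pdivrMr ?exprn_gt0//.
  have h1 := truncnS_gt (4 * M / eta).
  have h2 : (Num.truncn (4 * M / eta)).+1%:R <= 2 ^+ (Num.truncn (4 * M / eta)).+1 :> R.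
    by rewrite -natrX ler_nat ltnW// ltn_expl.
  have h3 : 4 * M / eta <= 2 ^+ (Num.truncn (4 * M / eta)).+1 by rewrite (le_trans _ h2)// ltW.
  by move: h3; rewrite ler_pdivrMr//; lra.
have e4 : 0 < eta / 4 by rewrite divr_gt0.
have dyS : \forall e \near (0 : R)^', forall j : 'I_J0.+1, forall s, 0 <= s.1 <= 1 -> 0 <= s.2 <= 1 ->
   `|f (dilate a (2 ^+ j * e) (fun t => dbeta t * iquad dkappa (0 + 1 / 2 * s.1, 0 + 1 / 2 * s.2) t))|
     <= eta / 4.
  apply: filter_forall => j; case: (dyU _ e4) => r /= r0 hr.
  have p0 : 0 < 2 ^+ j :> R by rewrite exprn_gt0.
  exists (r / 2 ^+ j); first by rewrite /= divr_gt0.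
  move=> e /= er ene; apply: hr; last by rewrite mulf_neq0// gt_eqF.
  move: er; rewrite /= !sub0r !normrN normrM (gtr0_norm p0) => er.
  by rewrite mulrC -ltr_pdivlMr.
have rS := rightU _ e2; have tS := topU _ e2.
near=> e => fpos w w1 /andP[w2 w2'] w12.
have e0 : e != 0 by near: e; exact: nbhs_dnbhs_neq.
have n0 : 0 < `|e| by rewrite normr_gt0.
set z := (a + e * w.1, `|e| * w.2).
have z0 : 0 < z.2 by rewrite mulr_gt0.
have spz := smooth_pker z0; have spw := smooth_pker w2.
pose an m := f (fun t => dilate a (2 ^+ m * e) dchi t * pker z t).
have pe m : 2 ^+ m * e != 0 by rewrite mulf_neq0// expf_neq0.
have tdil m : test_function (dilate a (2 ^+ m * e) dchi) := test_dilate a (pe m) dchi_test.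
have tan m : test_function (fun t => dilate a (2 ^+ m * e) dchi t * pker z t) :=
  testM (tdil m) spz.
(* For large [J] the cutoff is [1] near the support of [f], so [boundary_representation] applies
   with it. *)
have [J hJ] : exists J : nat, pi * H z = an J.
  exists (Num.truncn ((A + `|a|) / `|e|)).+1; set J := (Num.truncn _).+1.
  have J2 : (A + `|a|) / `|e| <= 2 ^+ J.
    have h2 : J%:R <= 2 ^+ J :> R by rewrite -natrX ler_nat ltnW// ltn_expl.
    by rewrite (le_trans _ h2)// ltW// truncnS_gt.
  apply: (repr _ (tdil J)) z0.
  move=> t tA; apply: dchi_on; rewrite normrM normfV normrM normrX (@ger0_norm _ 2)//.
  rewrite ler_pdivrMr ?mulr_gt0 ?exprn_gt0//.
  move: J2; rewrite ler_pdivrMr// => J2.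
  have h1 := ler_normB t a; have h2 : 0 <= 2 ^+ J * `|e| by rewrite mulr_ge0// exprn_ge0.
  by lra.
(* Of the weight [4^-(m+1)], one factor [2^-(m+1)] is kept for the geometric sum; the other
   compensates [M] at large scales. *)
have dyadic m : `|e| * `|an m.+1 - an m| <= 2^-1 ^+ m.+1 * (eta / 2).
  pose s := (w.1 / 2 ^+ m, w.2 / 2 ^+ m).
  have pm : 1 <= 2 ^+ m :> R by rewrite exprn_ege1// ler1n.
  have pm0 : 0 < 2 ^+ m :> R by exact: lt_le_trans pm.
  have s1 : 0 <= s.1 <= 1.
    case/andP: w1 => w1 w1'; rewrite /s/= divr_ge0 ?(ltW pm0)//= ler_pdivrMr// mul1r.
    exact: le_trans pm.
  have s2 : 0 <= s.2 <= 1.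
    rewrite /s/= divr_ge0 ?(ltW pm0) ?(ltW w2)//= ler_pdivrMr// mul1r.
    exact: le_trans pm.
  pose ps t := dbeta t * iquad dkappa (0 + 1 / 2 * s.1, 0 + 1 / 2 * s.2) t.
  have -> : an m.+1 - an m = (`|e|^-1 * (2 ^+ m.+1) ^- 2 * w.2) * f (dilate a (2 ^+ m.+1 * e) ps).
    rewrite -(distrB df)// -(distrZ df); last first.
      have siq := @smooth_iquad dkappa (0 + 1 / 2 * s.1, 0 + 1 / 2 * s.2) _
        (smooth_plateau _ _ _ _) c0 (lowD s1 s2).
      exact: (test_dilate a (pe m.+1) (testM dbeta_test siq)).
    congr f; apply/funext => t.
    rewrite /z (pker_dilate _ _ e0 w2) -mulrBl /dilate.
    set u := (t - a) / (2 ^+ m.+1 * e).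
    have -> : (t - a) / (2 ^+ m * e) = 2 * u.
      by rewrite /u exprS; field; rewrite e0 gt_eqF.
    have -> : (t - a) / e = 2 ^+ m.+1 * u.
      by rewrite /u; field; rewrite e0 expf_neq0.
    rewrite -/(dbeta u) /ps /iquad /pker /rker/= !add0r.
    have [b0|b0] := eqVneq (dbeta u) 0; first by rewrite b0; ring.
    have -> : dkappa u = 0.
      by apply: dkappa_out; rewrite ltNge; apply: contra b0 => /dbeta_in/eqP.
    rewrite addr0.
    have -> : (2 ^+ m.+1 * u - w.1) ^+ 2 + w.2 ^+ 2 = (2 ^+ m.+1) ^+ 2 *
        ((u - 1 / 2 * (w.1 / 2 ^+ m)) ^+ 2 + (1 / 2 * (w.2 / 2 ^+ m)) ^+ 2).
      by rewrite [2 ^+ m.+1]exprS; field; rewrite gt_eqF.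
    have d0 : 0 < (u - 1 / 2 * (w.1 / 2 ^+ m)) ^+ 2 + (1 / 2 * (w.2 / 2 ^+ m)) ^+ 2.
      by rewrite ltr_wpDl ?sqr_ge0// exprn_gt0// mulr_gt0// divr_gt0.
    move: d0; set d0 := _ + (1 / 2 * _) ^+ 2 => d00.
    by field; rewrite !gt_eqF.
  have v0 : 0 < `|e|^-1 * (2 ^+ m.+1) ^- 2 * w.2.
    by rewrite mulr_gt0// mulr_gt0 ?invr_gt0// !exprn_gt0.
  rewrite normrM (gtr0_norm v0) exprVn.
  have p1 : 1 <= 2 ^+ m.+1 :> R by rewrite exprn_ege1// ler1n.
  have p10 : 0 < 2 ^+ m.+1 :> R by exact: lt_le_trans p1.
  have -> : `|e| * (`|e|^-1 * (2 ^+ m.+1) ^- 2 * w.2 * `|f (dilate a (2 ^+ m.+1 * e) ps)|) =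
     (2 ^+ m.+1)^-1 * (w.2 * ((2 ^+ m.+1)^-1 * `|f (dilate a (2 ^+ m.+1 * e) ps)|)).
    by field; rewrite !gt_eqF.
  rewrite ler_wpM2l ?invr_ge0 ?(ltW p10)//.
  set X := _^-1 * _; have X0 : 0 <= X by rewrite mulr_ge0// invr_ge0 ltW.
  suff X1 : X <= eta / 4.
    by apply: le_trans e42; apply: le_trans X1; rewrite ler_piMl.
  have [mJ|Jm] := leqP m.+1 J0.
    have mJ' : (m.+1 < J0.+1)%N by rewrite ltnS.
    have hd : `|f (dilate a (2 ^+ m.+1 * e) ps)| <= eta / 4.
      have hS : forall j : 'I_J0.+1, forall s, 0 <= s.1 <= 1 -> 0 <= s.2 <= 1 ->
         `|f (dilate a (2 ^+ j * e) (fun t => dbeta t * iquad dkappa (0 + 1 / 2 * s.1, 0 + 1 / 2 * s.2) t))|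
          <= eta / 4 by near: e.
      exact: (hS (Ordinal mJ') s s1 s2).
    apply: le_trans hd; rewrite /X -[leRHS]mul1r ler_wpM2r//.
    by rewrite invf_le1.
  have hX : X <= (2 ^+ m.+1)^-1 * M by rewrite /X ler_wpM2l ?invr_ge0 ?(ltW p10)//; exact: hM.
  apply: (le_trans hX); apply: le_trans hJ0; rewrite mulrC ler_wpM2l// -exprVn.
  by rewrite ler_wiXn2l ?invr_ge0// ?invf_le1 ?ler1n// ltnW.
have telescope m : `|e| * `|an m - an 0%N| <= eta / 2.
  exact: telescope_geometric (ltW n0) (ltW e2) dyadic m.
(* At the smallest scale the part cut by [sig] is nonnegative by [fpos], and the rest is in the
   compact family [rightU] or [topU]. *)
have first : - (eta / 2) <= `|e| * an 0%N.
  have tw (phi : R -> R) : test_function phi -> test_function (fun t => phi t * pker w t).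
    by move=> h; exact: (testM h spw).
  have eR1 : w.1 = 1 -> 1 + 0 * w.1 = w.1 by move=> ->; rewrite mul0r addr0.
  have eR2 : 0 + 1 * w.2 = w.2 by rewrite add0r mul1r.
  have eT1 : 0 + 1 * w.1 = w.1 by rewrite add0r mul1r.
  have eT2 : w.2 = 1 -> 1 + 0 * w.2 = w.2 by move=> ->; rewrite mul0r addr0.
  have low0 (t : R) : 1 / 16 <= (t - w.1) ^+ 2 + w.2 ^+ 2 + kap t.
    by case: w12 => h; [have := lowR w t; rewrite (eR1 h) eR2|have := lowT w t; rewrite eT1 (eT2 h)].
  have tgi : test_function (fun t => gam t * iquad kap w t).
    exact: (testM tgam (@smooth_iquad kap w _ (smooth_plateau _ _ _ _) c0 low0)).
  have hg : `|f (dilate a e (fun t => gam t * iquad kap w t))| <= eta / 2.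
    have ww : w = (w.1, w.2) by case: (w).
    have w20 : 0 <= w.2 <= 1 by rewrite (ltW w2).
    case: w12 => h.
      have hS : forall s, 0 <= s.1 <= 1 -> 0 <= s.2 <= 1 ->
        `|f (dilate a e (fun t => gam t * iquad kap (1 + 0 * s.1, 0 + 1 * s.2) t))| <= eta / 2 by near: e.
      by have := hS w w1 w20; rewrite (eR1 h) eR2 -ww.
    have hS : forall s, 0 <= s.1 <= 1 -> 0 <= s.2 <= 1 ->
      `|f (dilate a e (fun t => gam t * iquad kap (0 + 1 * s.1, 1 + 0 * s.2) t))| <= eta / 2 by near: e.
    by have := hS w w1 w20; rewrite eT1 (eT2 h) -ww.
  have tds : test_function (fun t => dchi t * sig t * pker w t) by exact: (tw _ (testM dchi_test ssig)).
  have ps : 0 <= f (dilate a e (fun t => dchi t * sig t * pker w t)).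
    apply: fpos; first exact: test_smooth.
      by move=> t; rewrite mulr_ge0 ?(ltW (pker_gt0 _ _))// mulr_ge0 ?plateau_ge0.
    exact: vanishes_offMl (vanishes_offMr _ sig_supp).
  have -> : `|e| * an 0%N = f (dilate a e (fun t => dchi t * sig t * pker w t)) +
      w.2 * f (dilate a e (fun t => gam t * iquad kap w t)).
    have tdg := test_dilate a e0 tgi; have tdd := test_dilate a e0 tds.
    rewrite -(distrZ df `|e| (tan 0%N)) -(distrZ df w.2 tdg) -(distrD df tdd (testZ w.2 tdg)).
    congr f; apply/funext => t; rewrite /z (pker_dilate _ _ e0 w2) expr0 mul1r /dilate.
    set u := (t - a) / e.
    have -> : `|e| * (dchi u * (`|e|^-1 * pker w u)) = dchi u * pker w u.
      by field; rewrite gt_eqF.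
    rewrite /gam /iquad.
    have [-> | ->] := sig_kap u; first by rewrite subrr; ring.
    rewrite addr0 /pker /rker; have := pker_den u w2.
    set q := _ + _ => q0; by field; rewrite gt_eqF.
  have : w.2 * f (dilate a e (fun t => gam t * iquad kap w t)) >= - (eta / 2).
    have : `|w.2 * f (dilate a e (fun t => gam t * iquad kap w t))| <= eta / 2.
      rewrite normrM (gtr0_norm w2); apply: le_trans hg; by rewrite ler_piMl.
    by rewrite ler_norml => /andP[].
  by move=> h; rewrite -[- (eta / 2)]add0r; exact: lerD.
rewrite hJ; have := telescope J.
rewrite -[X in X * `|_|](ger0_norm (ltW n0)) -normrM mulrBr ler_norml => /andP[h1 _].
rewrite e22; move: h1; rewrite lerBrDr; apply: le_trans; by rewrite lerD2l.
Unshelve. all: by end_near. Qed.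

End Corner.

(** * Lower bounds across a gap *)

Section Barrier.
Context {R : realType}.

(* [Re ((1 + i) / (X + i Y))]: a harmonic barrier for the corner of the quadrant. *)
Definition bar (X Y : R) : R := rker X Y + rker Y X.

Lemma bar_ge (e X Y : R) : 0 <= X <= e -> 0 < Y <= e -> e^-1 <= bar X Y.
Proof.
move=> /andP[X0 Xe] /andP[Y0 Ye]; have e0 : 0 < e by exact: lt_le_trans Ye.
have -> : bar X Y = (X + Y) / (X ^+ 2 + Y ^+ 2).
  by rewrite /bar /rker [Y ^+ 2 + _]addrC -mulrDl addrC.
have d0 : 0 < X ^+ 2 + Y ^+ 2 by rewrite ltr_wpDl ?sqr_ge0// exprn_gt0.
rewrite ler_pdivlMr// mulrC ler_pdivrMr// !expr2 mulrDl.
by apply: lerD; rewrite ler_wpM2l// ltW.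
Qed.

Lemma bar_ge0 (X Y : R) : 0 <= X -> 0 <= Y -> 0 <= bar X Y.
Proof. by move=> X0 Y0; rewrite /bar /rker addr_ge0// divr_ge0// addr_ge0 ?sqr_ge0. Qed.

Lemma bar_superharmonic (a : R) (z : R * R) : 0 < z.2 ->
  superharmonic_at (fun p => bar (p.1 - a) p.2) z /\
  superharmonic_at (fun p => bar (a - p.1) p.2) z.
Proof.
move=> z0.
have main (X : R) eps : 0 < eps ->
    \forall h \near (0 : R)^'+, lap_rker X z.2 h + lap_rker z.2 X h <= eps * h ^+ 2.
  move=> eps0; have e2 : 0 < eps / 2 by rewrite divr_gt0.
  have d1 : 0 < X ^+ 2 + z.2 ^+ 2 by rewrite ltr_wpDl ?sqr_ge0// exprn_gt0.
  have d2 : 0 < z.2 ^+ 2 + X ^+ 2 by rewrite addrC.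
  have := lap_rker_small d1 e2; have := lap_rker_small d2 e2; apply: filterS2 => h.
  by rewrite !ler_norml => /andP[_ h1] /andP[_ h2]; lra.
split=> eps eps0.
  have := main (z.1 - a) eps eps0; apply: filterS => h; congr (_ <= _).
  rewrite /lap5 /lap_rker /bar /=.
  have -> : z.1 + h - a = z.1 - a + h by ring.
  have -> : z.1 - h - a = z.1 - a - h by ring.
  by ring.
have := main (a - z.1) eps eps0; apply: filterS => h; congr (_ <= _).
rewrite /lap5 /lap_rker /bar /=.
have -> : a - (z.1 + h) = a - z.1 - h by ring.
have -> : a - (z.1 - h) = a - z.1 + h by ring.
by ring.
Qed.

Lemma bar_continuous (a : R) (z : R * R) : 0 < z.2 ->
  {for z, continuous (fun p : R * R => bar (p.1 - a) p.2)} /\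
  {for z, continuous (fun p : R * R => bar (a - p.1) p.2)}.
Proof.
move=> z0.
have main (g : R * R -> R) : {for z, continuous g} ->
    {for z, continuous (fun p : R * R => bar (g p) p.2)}.
  move=> cg; have c2 : (fun p : R * R => p.2) @ z --> z.2 by exact: cvg_snd.
  have cg2 : (fun p : R * R => g p ^+ 2) @ z --> g z ^+ 2 by rewrite expr2; apply: cvgM.
  have c22 : (fun p : R * R => p.2 ^+ 2) @ z --> z.2 ^+ 2 by rewrite expr2; apply: cvgM.
  have d0 : 0 < g z ^+ 2 + z.2 ^+ 2 by rewrite ltr_wpDl ?sqr_ge0// exprn_gt0.
  apply: cvgD; apply: cvgM => //; apply: cvgV.
  - by rewrite gt_eqF.
  - exact: cvgD.
  - by rewrite addrC gt_eqF.
  - exact: cvgD.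
split; apply: main.
  by apply: cvgB; [exact: cvg_fst|exact: cvg_cst].
by apply: cvgB; [exact: cvg_cst|exact: cvg_fst].
Qed.

End Barrier.

Section Gap.
Context {R : realType}.
Variables (H : R * R -> R) (f : (R -> R) -> R).
Hypothesis H_harmonic : harmonic_on upper_half_plane H.
Hypothesis H_infty : vanishes_at_infinity_on upper_half_plane H.
Hypothesis f_compact : compact_distribution f.
Hypothesis H_limit : has_distr_boundary_limit H f.

(** Split the kernel by a plateau on [[c, d]]: the near part contributes at least [0] by positivity,
    the other is [O(z.2)] by [far_part]. *)
Lemma local_lower_bound (c c' d' d : R) : pos_on f c d -> c < c' -> d' < d ->
  exists C : R, 0 <= C /\ forall z : R * R, c' <= z.1 <= d' -> 0 < z.2 -> z.2 <= 1 ->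
    - (C * z.2) <= H z.
Proof.
move=> fpos cc dd; have [df cf] := f_compact; have pi0 := pi_gt0 R.
have [A [A0 repr]] := boundary_representation H_harmonic H_infty f_compact H_limit.
pose c0 := (c + c') / 2; pose d0 := (d + d') / 2.
have cc0 : c < c0 by rewrite /c0; lra.
have c0c : c0 < c' by rewrite /c0; lra.
have dd0 : d0 < d by rewrite /d0; lra.
have d0d : d' < d0 by rewrite /d0; lra.
pose chi := plateau (- (A + 1)) (- A) A (A + 1) : R -> R.
have tchi : test_function chi by apply: test_plateau; lra.
have chi1 t : `|t| < A -> chi t = 1.
  by rewrite ltr_norml => /andP[h1 h2]; apply: plateau1; [lra|lra|rewrite !ltW].
pose sig := plateau c c0 d0 d : R -> R.
have ssig : smooth sig := smooth_plateau _ _ _ _.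
have sig1 t : c0 <= t <= d0 -> sig t = 1 by exact: plateau1.
have [C [C0 hC]] := far_part df tchi ssig sig1 c0c d0d.
exists (C / pi); split; first by rewrite divr_ge0// ltW.
move=> z z1 z0 z2; rewrite -(ler_pM2l pi0) (repr _ tchi chi1 _ z0).
have -> : pi * - (C / pi * z.2) = - (C * z.2).
  have e (q : R) : 0 < q -> q * - (C / q * z.2) = - (C * z.2) by move=> q0; field; rewrite gt_eqF.
  exact: e.
have spz := smooth_pker z0.
have t1 : test_function (fun t => chi t * (1 - sig t) * pker z t).
  exact: testM (testM tchi (smoothB (smooth_cst 1) ssig)) spz.
have t2 : test_function (fun t => chi t * sig t * pker z t) := testM (testM tchi ssig) spz.
have -> : f (fun t => chi t * pker z t) = f (fun t => chi t * (1 - sig t) * pker z t) +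
    f (fun t => chi t * sig t * pker z t).
  by rewrite -(distrD df t1 t2); congr f; apply/funext => t; ring.
have := hC z z1 z0 z2; rewrite ler_norml => /andP[h1 _].
have : 0 <= f (fun t => chi t * sig t * pker z t).
  apply: fpos; first exact: test_smooth.
    by move=> t; rewrite mulr_ge0 ?(ltW (pker_gt0 _ _))// mulr_ge0 ?plateau_ge0.
  exact: vanishes_offMl (vanishes_offMr _ (vanishes_off_plateau cc0 dd0)).
by lra.
Qed.

(** The sign [s] tells on which side of [a] the gap lies. Taking [e = max X Y] as scale puts
    [(X / e, Y / e)] on a side of the unit square, where [corner_estimate] gives [H >= - eta / e];
    by [bar_ge] this is at least [- eta * bar X Y]. *)
Lemma corner_barrier (a s : R) : s = 1 \/ s = -1 ->
  (forall phi, test_function phi -> f (dilate a e phi) @[e --> (0 : R)^'] --> (0 : R)) ->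
  (\forall e \near (0 : R)^'+, forall phi, smooth phi -> (forall t, 0 <= phi t) ->
     vanishes_off (1 / 4) 2 phi -> 0 <= f (dilate a (s * e) phi)) ->
  forall eta : R, 0 < eta -> exists2 r : R, 0 < r & forall X Y, 0 <= X -> X < r -> 0 < Y -> Y < r ->
    - (eta * bar X Y) <= H (a + s * X, Y).
Proof.
move=> s1 scal [r1 /= r10 hr1] eta eta0; have pi0 := pi_gt0 R.
have eta1 : 0 < eta * pi by rewrite mulr_gt0.
have ns : `|s| = 1 by case: s1 => ->; rewrite ?normrN normr1.
have s0 : s != 0 by rewrite -normr_eq0 ns oner_eq0.
have [r2 /= r20 hr2] := corner_estimate H_harmonic H_infty f_compact H_limit scal eta1.
exists (Num.min r1 r2); first by rewrite lt_min; apply/andP.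
move=> X Y X0; rewrite lt_min => /andP[X1 X2] Y0; rewrite lt_min => /andP[Y1 Y2].
pose e := Num.max X Y.
have e0 : 0 < e by rewrite lt_max Y0 orbT.
have Xe : X <= e by rewrite le_max lexx.
have Ye : Y <= e by rewrite le_max lexx orbT.
have er1 : e < r1 by rewrite gt_max X1.
have er2 : e < r2 by rewrite gt_max X2.
have pose1 : forall phi, smooth phi -> (forall t, 0 <= phi t) ->
    vanishes_off (1 / 4) 2 phi -> 0 <= f (dilate a (s * e) phi).
  by apply: hr1 => //=; rewrite sub0r normrN gtr0_norm.
have nse : `|s * e| = e by rewrite normrM ns mul1r gtr0_norm.
have ball2 : ball 0 r2 (s * e) by rewrite /ball/= sub0r normrN nse.
have se0 : s * e != 0 by rewrite mulf_neq0// gt_eqF.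
have Xe1 : 0 <= X / e <= 1 by rewrite divr_ge0 ?(ltW e0)//= ler_pdivrMr// mul1r.
have Ye1 : 0 < Y / e <= 1 by rewrite divr_gt0//= ler_pdivrMr// mul1r.
have or1 : X / e = 1 \/ Y / e = 1.
  have : X = e \/ Y = e by rewrite /e; case: (leP X Y) => _; [right|left].
  by case=> h; [left|right]; rewrite h divff// gt_eqF.
have := hr2 _ ball2 se0 pose1 (X / e, Y / e) Xe1 Ye1 or1; rewrite /= nse.
have -> : s * e * (X / e) = s * X by field; rewrite gt_eqF.
have -> : e * (Y / e) = Y by field; rewrite gt_eqF.
have -> : e * (pi * H (a + s * X, Y)) = (e * H (a + s * X, Y)) * pi by ring.
rewrite -mulNr ler_pM2r// => h.
have X0e : 0 <= X <= e by apply/andP.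
have Y0e : 0 < Y <= e by apply/andP.
have := bar_ge X0e Y0e; rewrite -(ler_pM2l eta0) => h2.
apply: (@le_trans _ _ (- (eta / e))); first by rewrite lerN2.
by rewrite -mulNr ler_pdivrMr// mulrC.
Qed.

(** Minimum principle in the rectangle above the gap for [H + C1] plus [eta] times the two barriers.
    Sides and top are hypotheses, the open bottom is [local_lower_bound], the bottom corners are
    [corner_barrier]; finally [eta] tends to [0]. *)
Lemma gap_lower_bound (a b h0 C1 : R) : a < b -> 0 <= C1 ->
  (forall x, a < x < b -> exists2 e : R, 0 < e & pos_on f (x - e) (x + e)) ->
  (forall x, x = a \/ x = b -> forall phi, test_function phi ->
     f (dilate x e phi) @[e --> (0 : R)^'] --> (0 : R)) ->
  (forall x, x = a \/ x = b -> forall y, 0 < y <= h0 -> - C1 <= H (x, y)) ->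
  (forall x, a <= x <= b -> - C1 <= H (x, h0)) ->
  forall x y, a < x < b -> 0 < y < h0 -> - C1 <= H (x, y).
Proof.
move=> ab C10 loc scal side top x0 y0 xab yh0; have [df cf] := f_compact.
have h00 : 0 < h0 by case/andP: yh0 => h1 h2; exact: lt_trans h2.
have posab c d : a < c -> d < b -> pos_on f c d.
  move=> ac db; apply: (pos_on_glue df) => x /andP[cx xd]; apply: loc.
  by rewrite (lt_le_trans ac)// (le_lt_trans xd).
have cH z : 0 < z.2 -> {for z, continuous H} by case: H_harmonic => -[h _] _; exact: h.
pose D := [set z : R * R | a < z.1 < b /\ 0 < z.2 < h0].
have oD : open D.
  have -> : D = (fst @^-1` `]a, b[%classic) `&` (snd @^-1` `]0, h0[%classic).
    by apply/seteqP; split=> z /=; rewrite !in_itv.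
  by apply: openI; apply: open_comp => //; try exact: interval_open;
    move=> z _; [exact: cvg_fst|exact: cvg_snd].
have clD p : closure D p -> a <= p.1 <= b /\ 0 <= p.2 <= h0.
  pose D' := (fst @^-1` `[a, b]%classic) `&` (snd @^-1` `[0, h0]%classic) : set (R * R).
  have cD' : closed D'.
    apply: closedI.
      by apply: closed_comp => [z _|]; [exact: cvg_fst|exact: interval_closed].
    by apply: closed_comp => [z _|]; [exact: cvg_snd|exact: interval_closed].
  have DD' : D `<=` D'.
    by move=> z [/andP[h1 h2] /andP[h3 h4]]; split; rewrite /= in_itv/= !ltW.
  move=> /(closure_subset DD'); rewrite -(iffLR (closure_id _) cD').
  by move=> [] /=; rewrite !in_itv.
suff main : forall eta : R, 0 < eta -> forall z, D z ->
    0 <= H z + C1 + eta * (bar (z.1 - a) z.2 + bar (b - z.1) z.2).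
  have D0 : D (x0, y0) by [].
  set B := bar (x0 - a) y0 + bar (b - x0) y0.
  have B0 : 0 <= B.
    case/andP: xab => h1 h2; case/andP: yh0 => h3 _.
    by rewrite addr_ge0// bar_ge0 ?subr_ge0// ltW.
  apply/ler_addgt0Pr => e e0.
  have eB : 0 < e / (B + 1) by rewrite divr_gt0// ltr_wpDl.
  have := main _ eB _ D0; rewrite /= -/B.
  have : e / (B + 1) * B <= e.
    rewrite mulrAC ler_pdivrMr ?ltr_wpDl// ler_pM2l//; lra.
  by lra.
move=> eta eta0; apply: min_principle => //.
- move=> z [_ /andP[z0 _]]; have [c1 _] := bar_continuous a z0.
  have [_ c2] := bar_continuous b z0.
  apply: cvgD; first by apply: cvgD; [exact: cH|exact: cvg_cst].
  by apply: cvgM; [exact: cvg_cst|exact: cvgD].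
- move=> z [_ /andP[z0 _]]; have [c1 _] := bar_superharmonic a z0.
  have [_ c2] := bar_superharmonic b z0.
  have [sH _] := harmonic_superharmonic open_upper_half_plane H_harmonic z0.
  apply: superharmonicD; first by apply: superharmonicD => //; exact: superharmonic_cst.
  by apply: superharmonicZ; [exact: ltW|exact: superharmonicD].
- move=> p /clD[p1 p2] nD e e0.
  have Bge0 z : D z -> 0 <= bar (z.1 - a) z.2 /\ 0 <= bar (b - z.1) z.2.
    by move=> [/andP[h1 h2] /andP[h3 _]]; split; rewrite bar_ge0 ?subr_ge0// ltW.
  have interior : 0 < p.2 -> - C1 <= H p ->
      \forall z \near p, D z ->
      - e <= H z + C1 + eta * (bar (z.1 - a) z.2 + bar (b - z.1) z.2).
    move=> p20 Hp; have /cvgrPdist_le/(_ _ e0) := cH p p20; apply: filterS => z hz Dz.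
    have [B1 B2] := Bge0 z Dz; have B12 := mulr_ge0 (ltW eta0) (addr_ge0 B1 B2).
    by move: hz; rewrite ler_norml => /andP[_ hz]; lra.
  have ww : p = (p.1, p.2) by case: (p).
  have [p20|p20] := ltP 0 p.2.
    apply: interior => //.
    have [pa|pa] := eqVneq p.1 a.
      by rewrite ww; apply: side; [left|rewrite p20; case/andP: p2].
    have [pb|pb] := eqVneq p.1 b.
      by rewrite ww; apply: side; [right|rewrite p20; case/andP: p2].
    have [ph|ph] := eqVneq p.2 h0; first by rewrite ww ph; exact: top.
    case: nD; case/andP: p1 => h1 h2; case/andP: p2 => h3 h4.
    by split; rewrite !lt_neqAle ?h1 ?h2 ?h3 ?h4 ?pb ?ph ?andbT 1?eq_sym ?pa// gt_eqF.
  have pe : p.2 = 0 by apply/le_anti; rewrite p20; case/andP: p2 => ->.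
  have nd r : 0 < r -> \forall z \near p, `|z.1 - p.1| < r /\ `|z.2| < r.
    move=> r0; have : \forall z \near p, ball p r z by exact: nbhsx_ballx.
    apply: filterS => z [] /=; rewrite /ball/= pe sub0r normrN distrC.
    by [].
  have [pa|pa] := eqVneq p.1 a.
    have near1 : \forall e \near (0 : R)^'+, forall phi, smooth phi -> (forall t, 0 <= phi t) ->
        vanishes_off (1 / 4) 2 phi -> 0 <= f (dilate a (1 * e) phi).
      (* For a scale [d] below this, [[1/4, 2]] is dilated into [[a + d/4, a + 2d]], inside the
         gap. *)
      exists ((b - a) / 2); first by rewrite /= divr_gt0// subr_gt0.
      move=> d /=; rewrite sub0r normrN mul1r => hd d0 phi sphi phi0 vphi.
      rewrite (gtr0_norm d0) in hd.
      apply: (posab (a + d / 4) (a + d * 2)); [lra|lra|exact: smooth_dilate| |].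
        by move=> t; exact: phi0.
      apply: vanishes_offP => t ht; [apply: (vanishes_offl vphi)|apply: (vanishes_offr vphi)].
        by rewrite ltr_pdivrMr//; lra.
      by rewrite ltr_pdivlMr//; lra.
    have [|r r0 hr] := corner_barrier (or_introl erefl) _ near1 eta0.
      by apply: scal; left.
    have := nd r r0; apply: filterS => z [z1 z2] Dz.
    have [B1 B2] := Bge0 z Dz; have B3 := mulr_ge0 (ltW eta0) B2.
    case: Dz => /andP[z11 z12] /andP[z21 z22].
    have := hr (z.1 - a) z.2; rewrite mul1r [a + _]addrC subrK.
    have -> : (z.1, z.2) = z by case: (z).
    rewrite subr_ge0 (ltW z11) z21.
    move: z1 z2; rewrite pa gtr0_norm ?subr_gt0// gtr0_norm// => -> -> /(_ isT isT isT isT) h.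
    by clear -H_harmonic H_infty f_compact H_limit h B3 C10 e0; lra.
  have [pb|pb] := eqVneq p.1 b.
    have near1 : \forall e \near (0 : R)^'+, forall phi, smooth phi -> (forall t, 0 <= phi t) ->
        vanishes_off (1 / 4) 2 phi -> 0 <= f (dilate b (-1 * e) phi).
      exists ((b - a) / 2); first by rewrite /= divr_gt0// subr_gt0.
      move=> d /=; rewrite sub0r normrN mulN1r => hd d0 phi sphi phi0 vphi.
      rewrite (gtr0_norm d0) in hd.
      apply: (posab (b - d * 2) (b - d / 4)); [lra|lra|exact: smooth_dilate| |].
        by move=> t; exact: phi0.
      apply: vanishes_offP => t ht; [apply: (vanishes_offr vphi)|apply: (vanishes_offl vphi)].
        by rewrite invrN mulrN -mulNr ltr_pdivlMr//; lra.
      by rewrite invrN mulrN -mulNr ltr_pdivrMr//; lra.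
    have [|r r0 hr] := corner_barrier (or_intror erefl) _ near1 eta0.
      by apply: scal; right.
    have := nd r r0; apply: filterS => z [z1 z2] Dz.
    have [B1 B2] := Bge0 z Dz; have B3 := mulr_ge0 (ltW eta0) B1.
    case: Dz => /andP[z11 z12] /andP[z21 z22].
    have := hr (b - z.1) z.2; have -> : b + -1 * (b - z.1) = z.1 by ring.
    have -> : (z.1, z.2) = z by case: (z).
    rewrite subr_ge0 (ltW z12) z21.
    move: z1 z2; rewrite pb distrC gtr0_norm ?subr_gt0// gtr0_norm// => -> -> /(_ isT isT isT isT) h.
    by clear -H_harmonic H_infty f_compact H_limit h B3 C10 e0; lra.
  have /loc[r r0 fr] : a < p.1 < b.
    by case/andP: p1 => h1 h2; rewrite !lt_neqAle h1 h2 pb eq_sym pa.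
  have pr1 : p.1 - r < p.1 - r / 2 by lra.
  have pr2 : p.1 + r / 2 < p.1 + r by lra.
  have [C [C0 hC]] := local_lower_bound fr pr1 pr2.
  have m0 : 0 < Num.min (Num.min (r / 2) 1) (e / (C + 1)).
    by have Cp : 0 < C + 1 := ltr_wpDl C0 ltr01; rewrite !lt_min ltr01 !divr_gt0.
  have := nd _ m0; apply: filterS => z [] z1; rewrite !lt_min => /andP[/andP[_ z21] z22] Dz.
  have [B1 B2] := Bge0 z Dz; have B12 := mulr_ge0 (ltW eta0) (addr_ge0 B1 B2).
  case: Dz => _ /andP[z0 _].
  rewrite (gtr0_norm z0) in z21 z22.
  have zr : p.1 - r / 2 <= z.1 <= p.1 + r / 2.
    move: z1; rewrite !lt_min => /andP[/andP[+ _] _].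
    by rewrite ltr_norml => /andP[h1 h2]; apply/andP; clear -H_harmonic H_infty f_compact H_limit h1 h2; split; lra.
  have := hC z zr z0 (ltW z21).
  move: z22; rewrite ltr_pdivlMr ?ltr_wpDl// => h3 h4.
  by clear -H_harmonic H_infty f_compact H_limit h3 h4 B12 C10 z0; lra.
- move=> e e0; exists (`|a| + `|b| + h0) => z [/andP[z1 z1'] /andP[z2 z2']].
  rewrite prod_normE/= lt_max => /orP[h|h].
    exfalso; move: h; have : `|z.1| <= `|a| + `|b|; last by lra.
    rewrite ler_norml; apply/andP; split.
      by have := ler_norm (- a); rewrite normrN; have := normr_ge0 b; lra.
    by have := ler_norm b; have := normr_ge0 a; lra.
  exfalso; move: h; rewrite (gtr0_norm z2); have := normr_ge0 b; have := normr_ge0 a; lra.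
Qed.

End Gap.

(** * From a lower bound to positivity *)

Section Covering.
Context {R : realType}.
Local Notation mu := (@lebesgue_measure R).

Lemma test_integrable (phi : R -> R) : test_function phi -> mu.-integrable setT (EFin \o phi).
Proof.
move=> tphi; have [A [A0 vphi]] := test_vanishes_off tphi.
have cphi := smooth_continuous (test_smooth tphi).
have i1 : mu.-integrable `[- A, A] (EFin \o phi).
  apply: continuous_compact_integrable; first exact: segment_compact.
  exact: continuous_subspaceT.
have := (iffLR (integrable_mkcond _ _)) i1; move=> /(_ (measurable_itv _)).
apply: eq_integrable => // x _; rewrite patchE; case: ifPn => // /negP xab.
rewrite /= vphi//; apply/negP => h; apply: xab; by rewrite inE/= in_itv.
Qed.

Lemma Rintegral_testD (phi psi : R -> R) : test_function phi -> test_function psi ->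
  \int[mu]_x (phi x + psi x) = \int[mu]_x phi x + \int[mu]_x psi x.
Proof. by move=> /test_integrable h1 /test_integrable h2; exact: RintegralD. Qed.

Lemma Rintegral_testZ (a : R) (phi : R -> R) : test_function phi ->
  \int[mu]_x (a * phi x) = a * \int[mu]_x phi x.
Proof. by move=> /test_integrable h1; exact: RintegralZl. Qed.

Lemma Rintegral_test_ge0 (phi : R -> R) : (forall t, 0 <= phi t) -> 0 <= \int[mu]_x phi x.
Proof. by move=> h; apply: Rintegral_ge0. Qed.

Lemma measurable_indic_ball (x r : R) : measurable_fun setT (fun t : R => \1_(ball x r) t : R).
Proof. by apply: measurable_indic; apply: open_measurable; exact: ball_open. Qed.

Lemma integral_ball_sum (s : seq R) (c r : R -> R) : (forall x, 0 <= c x) -> (forall x, 0 < r x) ->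
  (\int[mu]_t (\sum_(k <- s) c k * \1_(ball k (r k)) t)%:E = (\sum_(k <- s) c k * (2 * r k))%:E)%E.
Proof.
move=> c0 r0; under eq_integral do rewrite -sumEFin.
rewrite ge0_integral_sum//; last first.
- by move=> k t _; rewrite lee_fin mulr_ge0.
- move=> k; apply/measurable_EFinP; apply: measurable_funM => //; exact: measurable_indic_ball.
rewrite -sumEFin; apply: eq_bigr => k _.
under eq_integral do rewrite EFinM.
rewrite ge0_integralZl//; last first.
- by rewrite lee_fin.
- apply/measurable_EFinP; exact: measurable_indic_ball.
rewrite integral_indic//; last by apply: open_measurable; exact: ball_open.
rewrite setIT [X in (_ * X)%E](_ : _ = (r k *+ 2)%:E).
  by rewrite -EFinM mulr_natl.
exact: lebesgue_measure_ball (ltW (r0 k)).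
Qed.

(** In the use below, [U] absorbs the exceptional null set, and the balls are those of a Vitali
    covering after enlargement. *)
Lemma Rintegral_le_cover (phi : R -> R) (U : set R) (M e : R) (s : seq R) (c r : R -> R) :
  test_function phi -> (forall t, 0 <= phi t) -> measurable U -> (mu U <= e%:E)%E -> 0 <= M ->
  (forall x, 0 <= c x) -> (forall x, 0 < r x) ->
  (forall t, phi t <= M * \1_U t + \sum_(k <- s) c k * \1_(ball k (r k)) t) ->
  \int[mu]_t phi t <= M * e + \sum_(k <- s) c k * (2 * r k).
Proof.
move=> tphi phi0 mU Ue M0 c0 r0 hphi.
have mphi : measurable_fun setT (EFin \o phi).
  by case/integrableP: (test_integrable tphi).
have mS : measurable_fun setT (fun t : R => (\sum_(k <- s) c k * \1_(ball k (r k)) t : R)).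
  apply: measurable_sum => k; apply: measurable_funM => //; exact: measurable_indic_ball.
have mI : measurable_fun setT (fun t : R => M * \1_U t : R).
  by apply: measurable_funM => //; exact: measurable_indic.
have S0 t : 0 <= \sum_(k <- s) c k * \1_(ball k (r k)) t :> R.
  by apply: sumr_ge0 => k _; rewrite mulr_ge0.
rewrite -lee_fin /Rintegral fineK; last exact/integrable_fin_num/test_integrable.
have := @ge0_le_integral _ _ _ mu setT measurableT (EFin \o phi)
  (fun t => (M * \1_U t)%:E + (\sum_(k <- s) c k * \1_(ball k (r k)) t)%:E)%E.
move=> /(_ (fun t _ => _) mphi) h; apply: (le_trans (h _ _ _)).
- by move=> t; rewrite lee_fin.
- by apply: emeasurable_funD; apply/measurable_EFinP.
- by move=> t _; rewrite -EFinD lee_fin.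
rewrite ge0_integralD//.
- rewrite integral_ball_sum// EFinD leeD2r//.
  under eq_integral do rewrite EFinM.
  rewrite ge0_integralZl//; last by apply/measurable_EFinP; exact: measurable_indic.
  by rewrite integral_indic// setIT EFinM lee_wpmul2l// lee_fin.
- by move=> t _; rewrite lee_fin mulr_ge0.
- exact/measurable_EFinP.
- by move=> t _; rewrite lee_fin.
- exact/measurable_EFinP.
Qed.

Lemma disjoint_ball_value (s : seq R) (r : R -> R) (g : R -> R -> R) (t x : R) : uniq s ->
  trivIset [set` s] (fun x => ball x (r x)) -> x \in s -> ball x (r x) t ->
  (forall y, ~ ball y (r y) t -> g y t = 0) -> \sum_(y <- s) g y t = g x t.
Proof.
move=> us tI xs xt g0; rewrite (bigD1_seq x)//= big1_seq ?addr0// => y /andP[yx ys].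
apply: g0 => yt; move/eqP: yx; apply; apply: (tI y x) => //=.
by exists t.
Qed.

Lemma disjoint_balls_length (s : seq R) (r : R -> R) (a b : R) : a <= b -> uniq s ->
  trivIset [set` s] (fun x => ball x (r x)) -> (forall x, 0 < r x) ->
  (forall x, x \in s -> ball x (r x) `<=` `[a, b]) -> \sum_(k <- s) 2 * r k <= b - a.
Proof.
move=> ab us tI r0 hs.
have := @integral_ball_sum s (fun=> 1) r (fun=> ler01) r0.
under [X in _ = X%:E -> _]eq_bigr do rewrite mul1r.
move=> e; rewrite -lee_fin -e.
have mS : measurable_fun setT (fun t : R => (\sum_(k <- s) 1 * \1_(ball k (r k)) t : R)).
  apply: measurable_sum => k; apply: measurable_funM => //; exact: measurable_indic_ball.
have -> : ((b - a)%:E = \int[mu]_t (\1_(`[a, b]%classic) t)%:E)%E.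
  transitivity (mu `[a, b]%classic); last by rewrite integral_indic ?setIT.
  rewrite lebesgue_measure_itv/= lte_fin.
  by case: ltgtP ab => // -> _; rewrite subrr.
apply: ge0_le_integral => //.
- by move=> t _; rewrite lee_fin; apply: sumr_ge0 => k _; rewrite mul1r.
- exact/measurable_EFinP.
- by apply/measurable_EFinP; exact: measurable_indic.
move=> t _; rewrite lee_fin.
have [[x [xs xt]]|no] := pselect (exists x, x \in s /\ ball x (r x) t).
  rewrite (@disjoint_ball_value _ r (fun k t => 1 * \1_(ball k (r k)) t) t x)//; last first.
    by move=> y yt; rewrite indicE memNset// mulr0.
  by rewrite mul1r !indicE mem_set// mem_set//; exact: hs xt.
rewrite big1_seq ?indicE ?ler0n// => k /andP[_ ks]; rewrite indicE memNset ?mulr0// => kt.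
by apply: no; exists k.
Qed.

End Covering.

Section BoundaryLimits.
Context {R : realType}.
Variable H : R * R -> R.

Lemma limsup_boundary_le (x c : R) : (\forall y \near (0 : R)^'+, H (x, y) <= c) ->
  (limsup_boundary H x <= c%:E)%E.
Proof.
move=> h; rewrite /limsup_boundary /limf_esup.
apply: (@le_trans _ _ (ereal_sup [set (H (x, y))%:E | y in [set y | H (x, y) <= c]])).
  by apply: ereal_inf_lbound; exists [set y | H (x, y) <= c].
by apply: ge_ereal_sup => _ [y /= hy <-]; rewrite lee_fin.
Qed.

Lemma liminf_boundary_gt (x c : R) : (c%:E < liminf_boundary H x)%E ->
  \forall y \near (0 : R)^'+, c <= H (x, y).
Proof.
rewrite /liminf_boundary limf_einfE => /ereal_sup_gt[_ [V FV <-] cV].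
apply: filterS FV => y Vy; rewrite -lee_fin (le_trans (ltW cV))//.
by apply: ereal_inf_lbound; exists y.
Qed.

End BoundaryLimits.

(** * Majorants of the Poisson kernel by bumps of dyadic radius *)

Section Tents.
Context {R : realType}.
Local Notation mu := (@lebesgue_measure R).

Definition linear_on_tests (L : (R -> R) -> R) := forall a phi psi, test_function phi ->
  test_function psi -> L (fun x => a * phi x + psi x) = a * L phi + L psi.

Lemma linear_sum L (n : nat) (a : nat -> R) (g : nat -> R -> R) : linear_on_tests L ->
  (forall k, test_function (g k)) ->
  test_function (fun t => \sum_(k < n) a k * g k t) /\
  L (fun t => \sum_(k < n) a k * g k t) = \sum_(k < n) a k * L (g k).
Proof.
move=> lL tg; elim: n => [|n [IH1 IH2]].
  have -> : (fun t => \sum_(k < 0) a k * g k t) = (fun=> 0) by apply/funext => t; rewrite big_ord0.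
  split; first exact: test0.
  have := lL 1 _ _ test0 test0.
  have -> : (fun _ : R => 1 * 0 + 0) = (fun=> 0 : R) by apply/funext => t; rewrite mulr0 addr0.
  by rewrite big_ord0; lra.
have -> : (fun t => \sum_(k < n.+1) a k * g k t) = (fun t => a n * g n t + \sum_(k < n) a k * g k t).
  by apply/funext => t; rewrite big_ord_recr addrC.
split; first exact: testD (testZ _ (tg n)) IH1.
by rewrite lL// IH2 big_ord_recr addrC.
Qed.

Definition tent (x r : R) : R -> R := dilate x r (plateau (- 2) (- 1) 1 2).

Lemma tent_ge0 x r t : 0 <= tent x r t.
Proof. exact: plateau_ge0. Qed.

Lemma tent_le1 x r t : tent x r t <= 1.
Proof. exact: plateau_le1. Qed.

Lemma tent_test x r : 0 < r -> test_function (tent x r).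
Proof. by move=> r0; apply: test_dilate; [rewrite gt_eqF|apply: test_plateau; lra]. Qed.

Lemma tent1 x r t : 0 < r -> `|t - x| <= r -> tent x r t = 1.
Proof.
rewrite ler_norml => r0 /andP[h1 h2]; apply: plateau1; [lra|lra|].
by rewrite ler_pdivlMr// ler_pdivrMr//; apply/andP; split; lra.
Qed.

Lemma tent0 x r t : 0 < r -> 2 * r <= `|t - x| -> tent x r t = 0.
Proof.
move=> r0; have [h|h] := ltP (t - x) 0.
  rewrite ltr0_norm// => h2; apply: plateau0l; first lra.
  by rewrite ler_pdivrMr//; lra.
rewrite ger0_norm// => h2; apply: plateau0r; first lra.
by rewrite ler_pdivlMr//; lra.
Qed.

Lemma vanishes_off_tent x r : 0 < r -> vanishes_off (x - 2 * r) (x + 2 * r) (tent x r).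
Proof.
move=> r0 t; rewrite negb_and -!ltNge => h; apply: tent0 => //.
case/orP: h => h; first by rewrite ltr0_norm; lra.
by rewrite gtr0_norm; lra.
Qed.

Lemma dyadic_scale (y rho : R) : 0 < y -> y < rho -> exists n : nat, rho <= 2 ^+ n * y < 2 * rho.
Proof.
move=> y0 yr; have ex : exists n : nat, rho <= 2 ^+ n * y.
  exists (Num.truncn (rho / y)).+1; rewrite -ler_pdivrMr//.
  apply: le_trans (ltW (truncnS_gt _)) _.
  by rewrite -natrX ler_nat ltnW// ltn_expl.
case: (ex_minnP ex) => -[|n] hn min; first by move: hn; rewrite expr0; lra.
exists n.+1; rewrite hn/= exprS -mulrA ltr_pM2l//.
by rewrite ltNge; apply/negP => /min; rewrite ltnn.
Qed.

(** Let [m] be least with [|t - x| <= 2^m * y]. The tent of index [m] is [1] at [t], and the kernel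
    is at most [4 / (y * 4^m)]: for [m > 0] because [|t - x| > 2^(m-1) * y]. *)
Lemma pker_le_tents (x y rho : R) (n : nat) (t : R) : 0 < y -> 0 < rho -> rho <= 2 ^+ n * y ->
  tent x (rho / 2) t * pker (x, y) t <= \sum_(k < n.+1) (4 / y / 4 ^+ k) * tent x (2 ^+ k * y) t.
Proof.
move=> y0 r0 hn; have p0 k : 0 < 2 ^+ k * y by rewrite mulr_gt0// exprn_gt0.
have a0 k : 0 <= 4 / y / 4 ^+ k by rewrite !divr_ge0// ?exprn_ge0// ltW.
have S0 (P : pred 'I_n.+1) : 0 <= \sum_(k < n.+1 | P k) (4 / y / 4 ^+ k) * tent x (2 ^+ k * y) t.
  by apply: sumr_ge0 => k _; rewrite mulr_ge0// tent_ge0.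
have [far|near] := leP rho `|t - x|.
  by rewrite tent0 ?mul0r//; [rewrite divr_gt0|rewrite mulrC divfK].
have ex : exists m : nat, `|t - x| <= 2 ^+ m * y by exists n; rewrite (le_trans (ltW near)).
case: (ex_minnP ex) => m hm min.
have mn : (m < n.+1)%N by rewrite ltnS min// (le_trans (ltW near)).
rewrite (bigD1 (Ordinal mn))//= [tent x (2 ^+ m * y) t]tent1// mulr1 -[leLHS]addr0; apply: lerD => //.
have pk0 : 0 <= pker (x, y) t by rewrite ltW// pker_gt0.
apply: (@le_trans _ _ (pker (x, y) t)); first by rewrite ler_piMl// tent_le1.
case: m {mn ex} hm min => [|m] hm min.
  rewrite expr0 divr1 (le_trans (pker_le _ _))//= ler_peMl ?invr_ge0 ?(ltW y0)//; lra.
have lm : 2 ^+ m * y < `|t - x| by rewrite ltNge; apply/negP => /min; rewrite ltnn.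
rewrite /pker /rker/= ler_pdivrMr ?(pker_den t (z := (x, y)))//.
have l2 : (2 ^+ m * y) ^+ 2 <= (t - x) ^+ 2.
  by rewrite -[leRHS]real_normK ?num_real// lerXn2r ?nnegrE ?(ltW lm)// ltW.
have e4 : (4 : R) ^+ m = 2 ^+ m ^+ 2 by rewrite -exprM mulnC exprM; congr (_ ^+ _); ring.
have q0 : 0 < 2 ^+ m :> R by rewrite exprn_gt0.
rewrite exprS e4; move: l2; move: (2 ^+ m : R) q0 => q q0 l2.
rewrite -(ler_pM2l (x := q ^+ 2 * y)); last by rewrite mulr_gt0// exprn_gt0.
have -> : q ^+ 2 * y * (4 / y / (4 * q ^+ 2) * ((t - x) ^+ 2 + y ^+ 2)) = (t - x) ^+ 2 + y ^+ 2.
  by field; rewrite !gt_eqF.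
have := sqr_ge0 y; move: l2; rewrite exprMn expr2; lra.
Qed.

(** The kernel has total integral [pi], and beyond distance [rho / 2] it is at most [c1 * y] times
    the kernel at height [1]. *)
Lemma integral_tent_pker (x rho : R) : 0 < rho -> exists C : R, 0 <= C /\ forall y, 0 < y ->
  pi - C * y <= \int[mu]_t (tent x (rho / 2) t * pker (x, y) t).
Proof.
move=> r0; pose c1 := 1 + 4 / rho ^+ 2.
have c10 : 0 <= c1 by rewrite addr_ge0// divr_ge0// sqr_ge0.
exists (c1 * pi); split; first by rewrite mulr_ge0// pi_ge0.
move=> y y0; have r20 : 0 < rho / 2 by rewrite divr_gt0.
have z1 : 0 < (x, 1 : R).2 by rewrite /=.
have zy : 0 < (x, y).2 by [].
have ts := tent_test x r20.
pose k t := (1 - tent x (rho / 2) t) * pker (x, y) t.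
have mk : measurable_fun setT k.
  apply: continuous_measurable_fun; apply: smooth_continuous.
  exact: smoothM (smoothB (smooth_cst 1) (test_smooth ts)) (smooth_pker zy).
have bk t : `|k t| <= c1 * y * pker (x, 1) t + 0 * pker (x, 1) t.
  rewrite mul0r addr0 /k normrM [X in _ * X]gtr0_norm ?pker_gt0//.
  rewrite ger0_norm ?subr_ge0 ?tent_le1//.
  have [near|far] := leP `|t - x| (rho / 2).
    by rewrite tent1// subrr mul0r; apply: mulr_ge0;
      [apply: mulr_ge0 => //; exact: ltW|rewrite ltW// pker_gt0].
  apply: (@le_trans _ _ (pker (x, y) t)).
    by rewrite ler_piMl ?gerBl ?tent_ge0// ltW// pker_gt0.
  have l2 : (rho / 2) ^+ 2 <= (t - x) ^+ 2.
    by rewrite -[leRHS]real_normK ?num_real// lerXn2r ?nnegrE ?(ltW far)// ltW.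
  have l3 : 1 <= 4 / rho ^+ 2 * (t - x) ^+ 2.
    rewrite [leLHS](_ : _ = 4 / rho ^+ 2 * (rho / 2) ^+ 2); last by field; rewrite gt_eqF.
    by rewrite ler_wpM2l// divr_ge0// sqr_ge0.
  rewrite /pker /rker/= expr1n mulrA mulr1 [c1 * y]mulrC -[leRHS]mulrA ler_wpM2l ?(ltW y0)//.
  have d1 : 0 < (t - x) ^+ 2 + y ^+ 2 by exact: pker_den zy.
  have d2 : 0 < (t - x) ^+ 2 + 1 by rewrite ltr_wpDl ?sqr_ge0.
  rewrite ler_pdivlMr// mulrC ler_pdivrMr//.
  have c11 : 1 <= c1 by rewrite lerDl divr_ge0// sqr_ge0.
  have : 0 <= c1 * y ^+ 2 by rewrite mulr_ge0// sqr_ge0.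
  by rewrite /c1; move: l3; lra.
have [ik hk] := pker_dominated z1 z1 mk bk.
have e := Rintegral_pker zy.
have e2 : \int[mu]_t pker (x, y) t = \int[mu]_t (tent x (rho / 2) t * pker (x, y) t) + \int[mu]_t k t.
  rewrite -RintegralD//; last exact: test_integrable (testM ts (smooth_pker zy)).
  by apply: eq_Rintegral => t _; rewrite /k; ring.
move: hk; rewrite addr0 ler_norml => /andP[_ hk].
have : c1 * pi * y = c1 * y * pi by ring.
by move: e2 hk; rewrite e; lra.
Qed.

End Tents.

Section Density.
Context {R : realType}.
Variables (H : R * R -> R) (f : (R -> R) -> R).
Hypothesis H_harmonic : harmonic_on upper_half_plane H.
Hypothesis H_infty : vanishes_at_infinity_on upper_half_plane H.
Hypothesis f_compact : compact_distribution f.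
Hypothesis H_limit : has_distr_boundary_limit H f.
Local Notation mu := (@lebesgue_measure R).

Definition ge_on (C a b : R) := forall phi, smooth phi -> (forall t, 0 <= phi t) ->
  vanishes_off a b phi -> - (C * \int[mu]_t phi t) <= f phi.

Lemma ge_on_linear (C : R) : linear_on_tests (fun phi => f phi + C * \int[mu]_t phi t).
Proof.
move=> c phi psi tphi tpsi; have [df _] := f_compact.
rewrite (distr_lin df)// Rintegral_testD//; last exact: testZ.
by rewrite Rintegral_testZ//; ring.
Qed.

(* If all small tents had small mass, the dyadic majorant [pker_le_tents] would bound
   [H (x, y)] above by a negative constant for small [y]. *)
Lemma dense_tent (C a b x rho : R) : ge_on C a b -> 0 < C -> a < x < b ->
  (0 <= limsup_boundary H x)%E -> 0 < rho ->
  exists r : R, [/\ 0 < r, r < rho &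
    C * r / 8 <= f (tent x r) + C * \int[mu]_t tent x r t].
Proof.
move=> ge C0 /andP[ax xb] lims rho0; apply: contrapT => no.
have [df cf] := f_compact; have lT := ge_on_linear C.
pose T phi := f phi + C * \int[mu]_t phi t.
have [A [A0 repr]] := boundary_representation H_harmonic H_infty f_compact H_limit.
pose r1 := Num.min rho (Num.min ((x - a) / 2) ((b - x) / 2)).
have r10 : 0 < r1 by rewrite !lt_min rho0 !divr_gt0// subr_gt0.
have r1rho : r1 <= rho by rewrite ge_min lexx.
have r1a : r1 <= (x - a) / 2 by rewrite !ge_min lexx orbT.
have r1b : r1 <= (b - x) / 2 by rewrite !ge_min lexx !orbT.
pose r2 := r1 / 2; have r20 : 0 < r2 by rewrite divr_gt0.
have small r : 0 < r -> r < r1 -> T (tent x r) <= C * r / 8.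
  move=> r0 rr; rewrite leNgt; apply/negP => h; apply: no; exists r; split=> //.
    exact: lt_le_trans r1rho.
  exact: ltW.
have r22 : 0 < r2 / 2 by rewrite divr_gt0.
pose sig := tent x (r2 / 2); have tsig : test_function sig := tent_test x r22.
have ssig := test_smooth tsig.
pose A' := A + `|x| + r2; have A'0 : 0 < A' by have := normr_ge0 x; rewrite /A'; lra.
pose chi := plateau (- (A' + 1)) (- A') A' (A' + 1) : R -> R.
have tchi : test_function chi by apply: test_plateau; lra.
have chi1' t : `|t| <= A' -> chi t = 1.
  by rewrite ler_norml => /andP[h1 h2]; apply: plateau1; [lra|lra|apply/andP].
have chi1 t : `|t| < A -> chi t = 1.
  by move=> tA; apply: chi1'; have := normr_ge0 x; rewrite /A'; lra.
have chisig t : chi t * sig t = sig t.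
  have [h|h] := leP (2 * (r2 / 2)) `|t - x|; first by rewrite /sig tent0// mulr0.
  rewrite chi1' ?mul1r//; have := ler_normD (t - x) x; rewrite subrK /A'; lra.
have sig1 t : x - r2 / 2 <= t <= x + r2 / 2 -> sig t = 1.
  by move=> h; apply: tent1 => //; rewrite ler_distl.
have xr1 : x - r2 / 2 < x by lra.
have xr2 : x < x + r2 / 2 by lra.
have [C1 [C10 hC1]] := far_part df tchi ssig sig1 xr1 xr2.
have [C2 [C20 hC2]] := integral_tent_pker x r20.
(* The tents contribute at most the sum of [(4 / (y * 4^k)) * (C * 2^k * y / 8) = (C / 2) * 2^-k],
   hence at most [C], while the Lebesgue part subtracts nearly [C * pi]. As [pi >= 2], a bound
   [- C + O(y)] remains; this is what the [8] is for. *)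
have key y : 0 < y -> y <= 1 -> y < r2 -> pi * H (x, y) <= C1 * y + C - C * (pi - C2 * y).
  move=> y0 y1 yr; have zy : 0 < (x, y).2 by [].
  have spz := smooth_pker zy.
  have tsp : test_function (fun t => sig t * pker (x, y) t) := testM tsig spz.
  have tcp : test_function (fun t => chi t * (1 - sig t) * pker (x, y) t).
    exact: testM (testM tchi (smoothB (smooth_cst 1) ssig)) spz.
  rewrite (repr _ tchi chi1 _ zy).
  have -> : f (fun t => chi t * pker (x, y) t) = f (fun t => chi t * (1 - sig t) * pker (x, y) t) +
      f (fun t => sig t * pker (x, y) t).
    rewrite -(distrD df tcp tsp); congr f; apply/funext => t; rewrite -{2}[sig t]chisig; ring.
  have xx : x <= (x, y).1 <= x by rewrite /= lexx.
  have := hC1 (x, y) xx zy y1; rewrite ler_norml => /andP[_ h1].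
  have h2 := hC2 y y0.
  suff h3 : T (fun t => sig t * pker (x, y) t) <= C.
    have h4 : C * (pi - C2 * y) <= C * \int[mu]_t (sig t * pker (x, y) t).
      by rewrite ler_pM2l.
    by move: h1 h3 h4; rewrite /T/=; lra.
  have [n /andP[hn1 hn2]] := dyadic_scale y0 yr.
  pose ak (k : nat) : R := 4 / y / 4 ^+ k.
  pose gk (k : nat) := tent x (2 ^+ k * y).
  have p0 (k : nat) : 0 < 2 ^+ k * y by rewrite mulr_gt0// exprn_gt0.
  have tg k : test_function (gk k) := tent_test x (p0 k).
  have [tS eS] := linear_sum n.+1 ak lT tg.
  have kn (k : nat) : (k < n.+1)%N -> 2 ^+ k * y <= 2 ^+ n * y.
    by move=> h; rewrite ler_wpM2r ?(ltW y0)// ler_weXn2l// ler1n.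
  have r2r1 : 2 * r2 = r1 by rewrite /r2; field.
  have pos : 0 <= T (fun t => (-1) * (sig t * pker (x, y) t) + \sum_(k < n.+1) ak k * gk k t).
    rewrite /T -lerBlDr sub0r; apply: ge.
    - exact: test_smooth (testD (testZ _ tsp) tS).
    - move=> t; rewrite mulN1r addrC subr_ge0; exact: pker_le_tents.
    - move=> t ht; rewrite /sig (vanishes_off_tent r22) ?mul0r ?mulr0 ?add0r.
        rewrite big1// => k _; rewrite /gk (vanishes_off_tent (p0 k)) ?mulr0//.
        apply: contra ht => /andP[h5 h6]; have := kn k (ltn_ord k).
        by move=> h7; apply/andP; clear -H_harmonic H_infty f_compact H_limit h5 h6 h7 hn2 r2r1 r1a r1b; split; lra.
      by apply: contra ht => /andP[h5 h6]; apply/andP; clear -H_harmonic H_infty f_compact H_limit h5 h6 r2r1 r1a r1b r20; split; lra.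
  have eT : T (fun t => (-1) * (sig t * pker (x, y) t) + \sum_(k < n.+1) ak k * gk k t) =
     (-1) * T (fun t => sig t * pker (x, y) t) + T (fun t => \sum_(k < n.+1) ak k * gk k t).
    exact: lT.
  have hS : T (fun t => \sum_(k < n.+1) ak k * gk k t) <= \sum_(k < n.+1) C / 2 * (2^-1) ^+ k.
    rewrite /T eS; apply: ler_sum => k _.
    have q0 : 0 < 2 ^+ k :> R by rewrite exprn_gt0.
    have e4 : (4 : R) ^+ k = 2 ^+ k ^+ 2 by rewrite -exprM mulnC exprM; congr (_ ^+ _); ring.
    have -> : C / 2 * 2^-1 ^+ k = ak k * (C * (2 ^+ k * y) / 8).
      by rewrite /ak e4 exprVn; field; rewrite !gt_eqF.
    rewrite ler_wpM2l ?divr_ge0 ?(ltW y0) ?exprn_ge0//.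
    by apply: small => //; apply: le_lt_trans (kn k (ltn_ord k)) _; rewrite -r2r1.
  have geo m : \sum_(k < m) C / 2 * (2^-1) ^+ k = C - C * 2^-1 ^+ m.
    elim: m => [|m IH]; first by rewrite big_ord0 expr0 mulr1 subrr.
    by rewrite big_ord_recr/= IH exprS; field.
  have : 0 <= C * 2^-1 ^+ n.+1 by rewrite mulr_ge0 ?(ltW C0)// exprn_ge0.
  by move: pos eT hS; rewrite geo; lra.
have pi2 := pi_ge2 R.
have pi0 := pi_gt0 R.
pose c := - (C / 2 / pi).
have D0 : 0 < C1 + C * C2 + 1 by rewrite ltr_wpDl// addr_ge0// mulr_ge0// ltW.
have c30 : 0 < C / 2 / (C1 + C * C2 + 1) by rewrite !divr_gt0.
have : (limsup_boundary H x <= c%:E)%E.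
  apply: limsup_boundary_le; near=> y.
  have y0 : 0 < y by near: y; exact: nbhs_right_gt.
  have y1 : y <= 1 by apply: ltW; near: y; exact: nbhs_right_lt.
  have y2 : y < r2 by near: y; exact: nbhs_right_lt.
  have y3 : y < C / 2 / (C1 + C * C2 + 1) by near: y; exact: nbhs_right_lt.
  rewrite -(ler_pM2l pi0); apply: (le_trans (key y y0 y1 y2)).
  have -> : pi * c = - (C / 2) by rewrite /c mulrN mulrC divfK// gt_eqF.
  move: y3; rewrite ltr_pdivlMr// => y3.
  have : C * 2 <= C * pi by rewrite ler_pM2l.
  by lra.
move=> /(le_trans lims); rewrite lee_fin /c oppr_ge0 leNgt.
by rewrite !divr_gt0.
Unshelve. all: by end_near. Qed.

End Density.

(** * Improving a lower bound by a Vitali covering *)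

Section Improve.
Context {R : realType}.
Variables (H : R * R -> R) (f : (R -> R) -> R).
Hypothesis H_harmonic : harmonic_on upper_half_plane H.
Hypothesis H_infty : vanishes_at_infinity_on upper_half_plane H.
Hypothesis f_compact : compact_distribution f.
Hypothesis H_limit : has_distr_boundary_limit H f.
Local Notation mu := (@lebesgue_measure R).
Hypothesis H_limsup : {ae mu, forall x : R, (0 <= limsup_boundary H x)%E}.

Lemma test_bounded (phi : R -> R) : test_function phi -> exists M : R, 0 <= M /\ forall t, `|phi t| <= M.
Proof.
move=> tphi; have [A [A0 vphi]] := test_vanishes_off tphi.
have [C hC] := continuous_bounded_on A (smooth_continuous (test_smooth tphi)).
exists (Num.max C 0); split; first by rewrite le_max lexx orbT.
move=> t; rewrite le_max; have [tA|tA] := leP `|t| A; first by rewrite hC.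
by rewrite vphi ?normr0 ?lexx ?orbT// -ler_norml -ltNge.
Qed.

Lemma test_lipschitz (phi : R -> R) : test_function phi ->
  exists K : R, 0 <= K /\ forall s t, `|phi s - phi t| <= K * `|s - t|.
Proof.
move=> tphi; have sphi := test_smooth tphi; have [A [A0 vphi]] := test_vanishes_off tphi.
have t' : test_function (derive1 phi).
  exact: vanishes_off_test (smooth_derive1 sphi) (vanishes_off_derive1 vphi).
have [K [K0 hK]] := test_bounded t'; exists K; split=> // s t.
wlog st : s t / t < s.
  move=> h; have [ts|st|->] := ltgtP s t; last by rewrite !subrr normr0 mulr0.
    by rewrite distrC [`|s - t|]distrC; exact: h.
  exact: h.
have [c _ ->] := @mvt_local _ phi (derive1 phi) t s st (fun x _ => smooth_is_derive x sphi).
by rewrite normrM ler_wpM2r.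
Qed.

(* The value [1 / 96] does not matter, only that it does not depend on [C]: the gain is
   iterated in [ge_on_pos]. *)
Lemma ge_on_improve (C a b : R) : ge_on f C a b -> 0 < C -> a < b ->
  forall phi, smooth phi -> (forall t, 0 <= phi t) -> vanishes_off a b phi ->
  C / 96 * \int[mu]_t phi t <= f phi + C * \int[mu]_t phi t.
Proof.
move=> ge C0 ab phi sphi phi0 vphi.
have tphi := vanishes_off_test sphi vphi.
have lT := ge_on_linear f_compact C.
pose T psi := f psi + C * \int[mu]_t psi t.
have Tge0 psi : smooth psi -> (forall t, 0 <= psi t) -> vanishes_off a b psi -> 0 <= T psi.
  by move=> h1 h2 h3; rewrite /T -lerBlDr sub0r; exact: ge.
have [M [M0 hM]] := test_bounded tphi.
have [K [K0 hK]] := test_lipschitz tphi.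
(* The errors come from the measure of [U], the oscillation of [phi] on balls, and the total length;
   all are linear in [e]. *)
suff main e : 0 < e -> \int[mu]_t phi t <= M * e + 96 / C * T phi + 6 * e * (b - a).
  apply/ler_addgt0Pr => eta eta0.
  have D0 : 0 < M + 6 * (b - a) + 1 by rewrite ltr_wpDl// addr_ge0// mulr_ge0// subr_ge0 ltW.
  have e0 : 0 < eta * (96 / C) / (M + 6 * (b - a) + 1) by rewrite !(divr_gt0, mulr_gt0).
  have := main _ e0; set e := _ / (M + _ + 1) => h.
  have c0 : 0 < C / 96 by rewrite divr_gt0.
  have h2 : C / 96 * \int[mu]_t phi t <= C / 96 * (M * e + 96 / C * T phi + 6 * e * (b - a)).
    by rewrite ler_pM2l.
  apply: (le_trans h2).
  have -> : C / 96 * (M * e + 96 / C * T phi + 6 * e * (b - a)) =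
      T phi + C / 96 * e * (M + 6 * (b - a)) by field; rewrite gt_eqF.
  rewrite lerD2l.
  have -> : C / 96 * e * (M + 6 * (b - a)) = eta * ((M + 6 * (b - a)) / (M + 6 * (b - a) + 1)).
    by rewrite /e; field; rewrite !gt_eqF.
  rewrite -[leRHS]mulr1 ler_pM2l// ler_pdivrMr// mul1r; lra.
move=> e0.
have [N0 [mN0 N00 N0sub]] := H_limsup.
(* The end points join the exceptional set because [dense_tent] needs an interior point. *)
pose N : set R := N0 `|` [set a; b].
have c2 : countable [set a; b] by apply: finite_set_countable.
have mab : measurable ([set a; b] : set R) by exact: measurableU.
have mN : measurable N by exact: measurableU.
have ab0 : mu [set a; b] = 0 := countable_lebesgue_measure0 c2.
have N1 : (mu N = 0)%E := etrans (measureU0 mN0 mab ab0) N00.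
have Nfin : (mu N < +oo)%E by rewrite N1 ltry.
have [U [oU NU Ue]] := lebesgue_regularity_outer mN Nfin e0.
have mU := open_measurable oU.
have muU : (mu U <= e%:E)%E.
  have mD : measurable (U `\` N) by exact: measurableD.
  have UE : U = (U `\` N) `|` N by rewrite setUC setDUK.
  have muE : mu U = mu (U `\` N) by rewrite {1}UE; apply: measureU0.
  by rewrite muE ltW.
pose Kc := `[a, b]%classic `&` ~` U.
have cK : compact Kc.
  apply: (subclosed_compact _ (@segment_compact _ a b)); last exact: subIsetl.
  by apply: closedI; [exact: interval_closed|exact: open_closedC].
have Kin x : Kc x -> a < x < b /\ (0 <= limsup_boundary H x)%E.
  move=> [/= xab xU]; split; last first.
    by apply: contrapT => h; apply: xU; apply: NU; left; exact: N0sub.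
  move: xab; rewrite in_itv/= => /andP[h1 h2]; rewrite !lt_neqAle h1 h2 !andbT.
  apply/andP; split; apply/eqP => h; apply: xU; apply: NU; right => /=; [left|right] => //.
have /choice[r hr] : forall x, exists r : R, 0 < r /\ (Kc x ->
    [/\ a <= x - 2 * r, x + 2 * r <= b, K * (6 * r) <= e & C * r / 8 <= T (tent x r)]).
  move=> x; have [Kx|nK] := pselect (Kc x); last by exists 1.
  have [xab lims] := Kin x Kx; case/andP: (xab) => ax xb.
  (* The tent must stay inside [[a, b]], and [phi] must vary by at most [e] up to distance [6 * r],
     the radius [2 * r] after tripling. *)
  pose rho := Num.min ((x - a) / 2) (Num.min ((b - x) / 2) (e / (6 * (K + 1)))).
  have rho0 : 0 < rho.
    by rewrite !lt_min !divr_gt0 ?subr_gt0// mulr_gt0// ltr_wpDl.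
  have [r [r0 rr hr]] := dense_tent H_harmonic H_infty f_compact H_limit ge C0 xab lims rho0.
  exists r; split=> // _; move: rr; rewrite !lt_min => /andP[h1 /andP[h2 h3]].
  split; [lra|lra| |exact: hr].
  move: h3; rewrite ltr_pdivlMr ?mulr_gt0 ?ltr_wpDl// => h3.
  by have := r0; lra.
have r0 x : 0 < r x by case: (hr x).
have r20 x : 0 < 2 * r x by rewrite mulr_gt0.
pose B x := ball x (2 * r x).
have := cK; rewrite compact_cover => /(_ R Kc B).
case=> [x _|x Kx|s0 s0K sK].
- exact: ball_open.
- by exists x => //; exact: ballxx.
have [s [us ss0 tI cov]] := @vitali_lemma_finite_cover R R B
  (fun x => is_ball_ball x (2 * r x)) (fun x => ex_intro _ x (ballxx x (r20 x))) (finmap.enum_fset s0).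
have sKc x : x \in s -> Kc x.
  by move=> /ss0/s0K; rewrite inE.
(* Lowered by [e], so that the sum of the [m x] times the disjoint tents stays below [phi]. *)
pose m x := Num.max (phi x - e) 0.
have m0 x : 0 <= m x by rewrite le_max lexx orbT.
have mphi x : phi x - e <= m x by rewrite le_max lexx.
have lip x t : x \in s -> `|t - x| <= 6 * r x -> `|phi t - phi x| <= e.
  move=> xs tx; have [_ /(_ (sKc x xs))[_ _ h _]] := hr x.
  by apply: (le_trans (hK _ _)); apply: le_trans h; rewrite ler_wpM2l.
pose ak (k : nat) := m (nth 0 s k).
pose gk (k : nat) := tent (nth 0 s k) (r (nth 0 s k)).
have tg k : test_function (gk k) := tent_test _ (r0 _).
have [tS eS] := linear_sum (size s) ak lT tg.
have ordE (F : R -> R) : \sum_(k < size s) F (nth 0 s k) = \sum_(x <- s) F x.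
  by rewrite [RHS](big_nth 0) big_mkord.
have Sle t : \sum_(k < size s) ak k * gk k t <= phi t.
  rewrite (ordE (fun x => m x * tent x (r x) t)).
  have out x : ~ B x t -> m x * tent x (r x) t = 0.
    move=> h; rewrite tent0 ?mulr0// leNgt; apply/negP => h2; apply: h.
    by rewrite /B /ball/= distrC.
  have [[x [xs xt]]|no] := pselect (exists x, x \in s /\ B x t).
    have -> : \sum_(x <- s) m x * tent x (r x) t = m x * tent x (r x) t.
      exact: (@disjoint_ball_value _ s (fun x => 2 * r x) (fun x t => m x * tent x (r x) t)
        t x us tI xs xt out).
    have h6 : `|t - x| <= 6 * r x.
      by move: xt; rewrite /B /ball/= distrC => h; have := r0 x; lra.
    have := lip x t xs h6; rewrite ler_norml => /andP[h _].
    apply: (@le_trans _ _ (m x)); first by rewrite ler_piMr// tent_le1.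
    by rewrite /m ge_max phi0 andbT; lra.
  rewrite big1_seq// => x /andP[_ xs]; apply: out => xt; apply: no; by exists x.
have lower : \sum_(x <- s) m x * (C * r x / 8) <= T phi.
  have pos : 0 <= T (fun t => (-1) * (\sum_(k < size s) ak k * gk k t) + phi t).
    apply: Tge0.
    - exact: test_smooth (testD (testZ _ tS) tphi).
    - by move=> t; rewrite mulN1r addrC subr_ge0.
    - move=> t ht; rewrite vphi// addr0.
      suff -> : \sum_(k < size s) ak k * gk k t = 0 by rewrite mulr0.
      apply/le_anti/andP; split; first by rewrite (le_trans (Sle t))// vphi.
      by apply: sumr_ge0 => k _; apply: mulr_ge0; [exact: m0|exact: tent_ge0].
  have eT : T (fun t => (-1) * (\sum_(k < size s) ak k * gk k t) + phi t) =
     (-1) * T (fun t => \sum_(k < size s) ak k * gk k t) + T phi by exact: lT.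
  have : \sum_(x <- s) m x * (C * r x / 8) <= T (fun t => \sum_(k < size s) ak k * gk k t).
    rewrite [leRHS]eS (ordE (fun x => m x * T (tent x (r x)))) big_seq [leRHS]big_seq.
    apply: ler_sum => x xs; rewrite ler_wpM2l//.
    by have [_ /(_ (sKc x xs))[]] := hr x.
  by move: pos eT; lra.
(* The tripled balls cover [Kc], and there [phi t <= phi x + e <= m x + 2 * e]; the rest of [[a, b]]
   is in [U]. *)
have upper : \int[mu]_t phi t <= M * e + \sum_(x <- s) (m x + 2 * e) * (2 * (3 * (2 * r x))).
  apply: (@Rintegral_le_cover _ phi U M e s (fun x => m x + 2 * e) (fun x => 3 * (2 * r x))) => //.
  - by move=> x; rewrite addr_ge0// mulr_ge0// ltW.
  - by move=> x; rewrite mulr_gt0.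
  move=> t; have S0 : 0 <= \sum_(k <- s) (m k + 2 * e) * \1_(ball k (3 * (2 * r k))) t :> R.
    by apply: sumr_ge0 => k _; rewrite mulr_ge0// addr_ge0// mulr_ge0// ltW.
  have [tab|tab] := boolP (a <= t <= b); last by rewrite vphi// addr_ge0// mulr_ge0.
  have [tU|tU] := pselect (U t).
    by rewrite indicE mem_set// mulr1 -[leLHS]addr0 lerD// (le_trans (ler_norm _))// hM.
  have /sK/cov[x /= xs] : Kc t by split=> //=; rewrite in_itv.
  rewrite /B scale_ballE// => xt.
  rewrite indicE memNset// mulr0 add0r (bigD1_seq x)//= indicE mem_set// mulr1.
  have h6 : `|t - x| <= 6 * r x.
    by move: xt; rewrite /ball/= distrC => h; have := r0 x; lra.
  have := lip x t xs h6; rewrite ler_norml => /andP[_ h].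
  have : 0 <= \sum_(i <- s | i != x) (m i + 2 * e) * \1_(ball i (3 * (2 * r i))) t :> R.
    by apply: sumr_ge0 => k _; rewrite mulr_ge0// addr_ge0// mulr_ge0// ltW.
  by have := mphi x; lra.
have len : \sum_(x <- s) 2 * (2 * r x) <= b - a.
  apply: disjoint_balls_length => //; first exact: ltW.
  move=> x xs t; rewrite /ball/= => h; have [_ /(_ (sKc x xs))[h1 h2 _ _]] := hr x.
  move: h; rewrite ltr_distl => /andP[h3 h4]; rewrite in_itv/=; apply/andP; clear -H_harmonic H_infty f_compact H_limit H_limsup h1 h2 h3 h4; split; lra.
apply: (le_trans upper); rewrite -[leRHS]addrA lerD2l.
(* The tripled ball has length [12 * r] against a mass [C * r / 8] of the tent: the ratio is
   [96 / C]. *)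
have -> : \sum_(x <- s) (m x + 2 * e) * (2 * (3 * (2 * r x))) =
    96 / C * (\sum_(x <- s) m x * (C * r x / 8)) + 6 * e * \sum_(x <- s) 2 * (2 * r x).
  rewrite !mulr_sumr -big_split/=; apply: eq_bigr => x _.
  by field; rewrite gt_eqF.
apply: lerD; first by rewrite ler_wpM2l// divr_ge0// ltW.
by rewrite ler_wpM2l// mulr_ge0// ltW.
Qed.

Lemma ge_on_pos (C a b : R) : ge_on f C a b -> 0 < C -> a < b -> pos_on f a b.
Proof.
move=> ge C0 ab phi sphi phi0 vphi.
have I0 := Rintegral_test_ge0 phi0.
pose th : R := 95 / 96.
have iter n : ge_on f (C * th ^+ n) a b.
  elim: n => [|n IH]; first by rewrite expr0 mulr1.
  move=> psi spsi psi0 vpsi.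
  have p0 : 0 < C * th ^+ n by rewrite mulr_gt0// exprn_gt0// /th divr_gt0.
  have := ge_on_improve IH p0 ab spsi psi0 vpsi.
  by rewrite exprS mulrCA; move: (C * th ^+ n) (\int[mu]_t psi t) => u v; rewrite /th; lra.
rewrite leNgt; apply/negP => fneg.
pose I := \int[mu]_t phi t.
have D0 : 0 < C * I + 1 by rewrite ltr_wpDl// mulr_ge0// ltW.
have e0 : 0 < - f phi / (C * I + 1) by rewrite divr_gt0// oppr_gt0.
have th1 : `|th| < 1 by rewrite ger0_norm /th; lra.
have /cvgrPdist_lt/(_ _ e0)[n _ hn] := cvg_expr th1.
have := hn n (leqnn n); rewrite sub0r normrN ger0_norm ?exprn_ge0 /th ?divr_ge0//= -/th.
rewrite ltr_pdivlMr// => h.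
have := iter n phi sphi phi0 vphi; rewrite -/I.
have : 0 <= th ^+ n by rewrite exprn_ge0 // /th divr_ge0.
by move: h; move: (th ^+ n) => u; lra.
Qed.

End Improve.

(** * Riesz representation *)

Section Stieltjes.
Context {R : realType}.

(* Both sides of the Riesz representation have increments [psi x * (G y - G x)] up to
   an error of second order, so they agree. *)
Lemma second_order_increments (W G : R -> R) (c a b : R) : a <= b -> 0 <= c ->
  {homo G : x y / x <= y} ->
  (forall x y, a <= x -> x <= y -> `|W y - W x| <= c * (y - x) * (G y - G x)) -> W b = W a.
Proof.
move=> ab c0 ndG hW; apply/eqP; rewrite -subr_eq0 -normr_eq0; apply/eqP/le_anti/andP; split => //.
have ba0 : 0 <= b - a by rewrite subr_ge0.
have Gab : 0 <= G b - G a by rewrite subr_ge0 ndG.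
apply/ler_addgt0Pl => eta eta0; rewrite addr0.
pose D := c * (b - a) * (G b - G a); have D0 : 0 <= D by apply: mulr_ge0 => //; exact: mulr_ge0.
pose n := (Num.truncn (D / eta)).+1.
have n0 : 0 < n%:R :> R by rewrite ltr0n.
pose h := (b - a) / n%:R; have h0 : 0 <= h by rewrite divr_ge0// ltW.
have step i : `|W (a + i%:R * h) - W a| <= c * h * (G (a + i%:R * h) - G a).
  elim: i => [|i IH]; first by rewrite mul0r addr0 !subrr normr0 mulr0.
  set p := a + i%:R * h; have -> : a + i.+1%:R * h = p + h by rewrite -natr1 /p; ring.
  have ap : a <= p by rewrite /p lerDl mulr_ge0// ler0n.
  have := hW p (p + h) ap; rewrite lerDl => /(_ h0).
  have -> : p + h - p = h by ring.
  move=> h1; have := ler_normD (W (p + h) - W p) (W p - W a).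
  rewrite addrA subrK => h2; apply: (le_trans h2).
  have -> : c * h * (G (p + h) - G a) = c * h * (G (p + h) - G p) + c * h * (G p - G a) by ring.
  exact: lerD.
have := step n; have -> : a + n%:R * h = b by rewrite /h; field; rewrite gt_eqF.
move=> /le_trans; apply.
have -> : c * h * (G b - G a) = D / n%:R by rewrite /h /D; ring.
rewrite ler_pdivrMr// mulrC -ler_pdivrMr//.
exact: ltW (truncnS_gt _).
Qed.

Section Measure.
Variable G : cumulative R R.
Definition stieltjes : {measure set (measurableTypeR R) -> \bar R} := lebesgue_stieltjes_measure G.

Lemma stieltjes_itv (a b : R) : a <= b -> stieltjes `]a, b]%classic = (G b - G a)%:E.
Proof.
move=> ab; rewrite /stieltjes/= /lebesgue_stieltjes_measure/= /measure_extension/=.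
by rewrite measurable_mu_extE/= ?wlength_itv_bnd//; exact: is_ocitv.
Qed.

Lemma stieltjes_Radon : is_Radon_measure stieltjes.
Proof.
move=> K cK; have [A [A0 hA]] := compact_in_segment cK.
have sub : K `<=` `](- A - 1), A]%classic.
  move=> t /hA/=; rewrite !in_itv/= => /andP[h1 h2]; rewrite h2 andbT; lra.
have ab : - A - 1 <= A by lra.
apply: (@le_lt_trans _ _ (stieltjes `](- A - 1), A]%classic)); last by rewrite stieltjes_itv// ltry.
apply: le_measure => //; rewrite inE; first exact: compact_measurable.
exact: measurable_itv.
Qed.

Lemma stieltjes_integrable (psi : R -> R) (M x y : R) : continuous psi -> (forall t, `|psi t| <= M) ->
  x <= y -> stieltjes.-integrable `]x, y]%classic (EFin \o psi).
Proof.
move=> cpsi hM xy; apply: measurable_bounded_integrable.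
- exact: measurable_itv.
- by rewrite stieltjes_itv// ltry.
- by apply: measurable_funTS; exact: continuous_measurable_fun.
- exists M; split; first by rewrite num_real.
  by move=> z Mz t _ /=; apply: le_trans (hM t) (ltW Mz).
Qed.

Lemma stieltjes_increment (psi : R -> R) (K M x y : R) : continuous psi ->
  (forall t, `|psi t| <= M) -> 0 <= K -> (forall s t, `|psi s - psi t| <= K * `|s - t|) -> x <= y ->
  `|\int[stieltjes]_(t in `]x, y]) psi t - psi x * (G y - G x)| <= K * (y - x) * (G y - G x).
Proof.
move=> cpsi hM K0 hK xy.
have mI : measurable (`]x, y]%classic : set (measurableTypeR R)) by exact: measurable_itv.
have ip := stieltjes_integrable cpsi hM xy.
have icst (c : R) : stieltjes.-integrable `]x, y]%classic (EFin \o (fun=> c)).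
  by apply: (@stieltjes_integrable (fun=> c) `|c|) => // t; exact: cvg_cst.
have ecst (c : R) : \int[stieltjes]_(t in `]x, y]) c = c * (G y - G x).
  by rewrite Rintegral_cst// stieltjes_itv.
have near t : `]x, y]%classic t -> `|psi t - psi x| <= K * (y - x).
  rewrite /= in_itv/= => /andP[h1 h2]; apply: (le_trans (hK _ _)).
  by rewrite ler_wpM2l// gtr0_norm ?subr_gt0// lerD2r.
have up : \int[stieltjes]_(t in `]x, y]) psi t <= (psi x + K * (y - x)) * (G y - G x).
  rewrite -ecst; apply: le_Rintegral => // t /near; rewrite ler_norml => /andP[_ h].
  by rewrite -lerBlDl.
have lo : (psi x - K * (y - x)) * (G y - G x) <= \int[stieltjes]_(t in `]x, y]) psi t.
  rewrite -ecst; apply: le_Rintegral => // t /near; rewrite ler_norml => /andP[h _].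
  by rewrite lerBlDr addrC -lerBlDr; move: h; lra.
by rewrite ler_norml; apply/andP; split; move: up lo; lra.
Qed.

End Measure.
End Stieltjes.

Section Riesz.
Context {R : realType}.
Variables (P : (R -> R) -> R) (B : R).
Hypothesis B0 : 0 < B.
Hypothesis P_linear : forall a phi psi, smooth phi -> smooth psi ->
  P (fun t => a * phi t + psi t) = a * P phi + P psi.
Hypothesis P_pos : forall phi, smooth phi -> (forall t, `|t| <= B -> 0 <= phi t) -> 0 <= P phi.

Let P_le phi psi : smooth phi -> smooth psi -> (forall t, `|t| <= B -> phi t <= psi t) -> P phi <= P psi.
Proof.
move=> s1 s2 h; have : 0 <= P (fun t => (-1) * phi t + psi t).
  apply: (P_pos (smoothD (smoothZ (a := -1) s1) s2)).
  by move=> t /h h1; rewrite mulN1r addrC subr_ge0.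
by rewrite (P_linear (-1) s1 s2); lra.
Qed.

Let P_eq phi psi : smooth phi -> smooth psi -> (forall t, `|t| <= B -> phi t = psi t) -> P phi = P psi.
Proof.
move=> s1 s2 h; apply/le_anti/andP; split.
  by apply: (P_le s1 s2) => t /h ->.
by apply: (P_le s2 s1) => t /h ->.
Qed.

Let P0 : P (fun=> 0) = 0.
Proof.
have := P_linear 1 (smooth_cst (0 : R)) (smooth_cst (0 : R)).
have -> : (fun _ : R => 1 * 0 + 0) = (fun=> 0 : R) by apply/funext => t; rewrite mulr0 addr0.
lra.
Qed.

(** Smooth majorants of the indicator of []-oo, x]]. That they are still [1] up to [x + d] is what
    makes [mass] right continuous. As [P] acts on all smooth functions, constants and these
    half-line cutoffs are allowed. *)
Definition cutoff (x d t : R) : R := 1 - step (x + d) (x + 2 * d) t.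

Let cutoff_smooth x d : smooth (cutoff x d).
Proof. exact (smoothB (smooth_cst 1) (smooth_step _ _)). Qed.

Let cutoff_ge0 x d t : 0 <= cutoff x d t. Proof. by rewrite subr_ge0 step_le1. Qed.

Let cutoff_le1 x d t : cutoff x d t <= 1. Proof. by rewrite gerBl step_ge0. Qed.

Let cutoff1 x d t : 0 < d -> t <= x + d -> cutoff x d t = 1.
Proof. by move=> d0 h; rewrite /cutoff step0 ?subr0//; lra. Qed.

Let cutoff0 x d t : 0 < d -> x + 2 * d <= t -> cutoff x d t = 0.
Proof. by move=> d0 h; rewrite /cutoff step1 ?subrr//; lra. Qed.

Let cutoff_le x d x' d' t : 0 < d -> 0 < d' -> x + 2 * d <= x' + d' -> cutoff x d t <= cutoff x' d' t.
Proof.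
move=> d0 d0' h; have [h1|h1] := leP (x + 2 * d) t; first by rewrite cutoff0.
by rewrite [leRHS]cutoff1// (le_trans (ltW h1)).
Qed.

(* The mass given to [`]-oo, x]] by [psi] times the measure under construction. *)
Definition mass (psi : R -> R) (x : R) := inf [set P (fun t => psi t * cutoff x d t) | d in [set d : R | 0 < d]].

Section Distribution.
Variable psi : R -> R.
Hypothesis spsi : smooth psi.
Hypothesis psi0 : forall t, 0 <= psi t.

Let sp x d : smooth (fun t => psi t * cutoff x d t).
Proof. exact (smoothM spsi (@cutoff_smooth x d)). Qed.

Let mono x d x' d' : 0 < d -> 0 < d' -> x + 2 * d <= x' + d' ->
  P (fun t => psi t * cutoff x d t) <= P (fun t => psi t * cutoff x' d' t).
Proof. by move=> d0 d0' h; apply: (P_le (@sp x d) (@sp x' d')) => t _; rewrite ler_wpM2l// cutoff_le. Qed.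

Let hasinf x : has_inf [set P (fun t => psi t * cutoff x d t) | d in [set d : R | 0 < d]].
Proof.
split; first by exists (P (fun t => psi t * cutoff x 1 t)); exists 1 => //=.
by exists 0 => _ [d _ <-]; apply: (P_pos (@sp x d)) => t _; rewrite mulr_ge0.
Qed.

Let mass_le x d : 0 < d -> mass psi x <= P (fun t => psi t * cutoff x d t).
Proof. by move=> d0; apply: ge_inf; [case: (hasinf x)|exists d]. Qed.

Lemma mass_ndecr : {homo mass psi : x y / x <= y}.
Proof.
move=> x y xy; apply: lb_le_inf; first by case: (hasinf y).
move=> _ [d /= d0 <-]; have d2 : 0 < d / 2 by rewrite divr_gt0.
by apply: (le_trans (mass_le x d2)); apply: mono => //; lra.
Qed.

Lemma mass_cvg x : P (fun t => psi t * cutoff x d t) @[d --> (0 : R)^'+] --> mass psi x.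
Proof.
apply/cvgrPdist_le => e e0; have [_ [d0 /= d00 <-] h] := inf_adherent e0 (hasinf x).
have d2 : 0 < d0 / 2 by rewrite divr_gt0.
near=> d; have d1 : 0 < d by near: d; exact: nbhs_right_gt.
have dd : d < d0 / 2 by near: d; exact: nbhs_right_lt.
have h1 := mass_le x d1.
have h2 : P (fun t => psi t * cutoff x d t) <= P (fun t => psi t * cutoff x d0 t).
  by apply: mono => //; lra.
rewrite ler_distl lerBlDr (le_trans h2 (ltW h))/=.
by rewrite (le_trans h1)// lerDl ltW.
Unshelve. all: by end_near. Qed.

Lemma mass_right_continuous : right_continuous (mass psi).
Proof.
move=> x; apply/cvgrPdist_le => e e0; have [_ [d0 /= d00 <-] h] := inf_adherent e0 (hasinf x).
have d2 : 0 < d0 / 2 by rewrite divr_gt0.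
near=> y; have xy : x < y by near: y; exact: nbhs_right_gt.
have yd : y < x + d0 / 2 by near: y; apply: nbhs_right_lt; rewrite ltrDl.
have h1 := mass_ndecr (ltW xy).
have d4 : 0 < d0 / 4 by rewrite divr_gt0.
have h2 := mass_le y d4.
have h3 : P (fun t => psi t * cutoff y (d0 / 4) t) <= P (fun t => psi t * cutoff x d0 t).
  by apply: mono => //; lra.
rewrite ler_distl lerBlDr (le_trans h2 (le_trans h3 (ltW h)))/=.
by rewrite (le_trans h1)// lerDl ltW.
Unshelve. all: by end_near. Qed.

Lemma mass_left x : x < - B -> mass psi x = 0.
Proof.
move=> xB; apply/le_anti/andP; split.
  have d0 : 0 < (- B - x) / 2 by rewrite divr_gt0// subr_gt0.
  apply: (le_trans (mass_le x d0)); rewrite -[leRHS]P0 (P_eq (@sp x _) (smooth_cst (0 : R)))//.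
  move=> t; rewrite ler_norml => /andP[h1 _]; rewrite cutoff0 ?mulr0//; lra.
apply: lb_le_inf; first by case: (hasinf x).
by move=> _ [d _ <-]; apply: (P_pos (@sp x d)) => t _; rewrite mulr_ge0.
Qed.

Lemma mass_right x : B <= x -> mass psi x = P psi.
Proof.
move=> Bx; have e d : 0 < d -> P (fun t => psi t * cutoff x d t) = P psi.
  move=> d0; apply: (P_eq (@sp x d) spsi) => t; rewrite ler_norml => /andP[_ h].
  by rewrite cutoff1 ?mulr1//; lra.
apply/le_anti/andP; split; first by rewrite -(e 1)// mass_le.
apply: lb_le_inf; first by case: (hasinf x).
by move=> _ [d /= d0 <-]; rewrite e.
Qed.

End Distribution.

(** For fixed [d], the difference of the cutoffs at [y] and [x] is nonnegative and lives on
    [[x + d, y + 2 * d]], where [psi] is within [K * (y - x + 2 * d)] of [psi x]. Positivity of [P]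
    gives the estimate for this [d]; then [d] tends to [0]. *)
Let mass_increment (psi : R -> R) (K x y : R) : smooth psi -> (forall t, 0 <= psi t) -> 0 <= K ->
  (forall s t, `|psi s - psi t| <= K * `|s - t|) -> x <= y ->
  `|mass psi y - mass psi x - psi x * (mass (fun=> 1) y - mass (fun=> 1) x)| <=
  K * (y - x) * (mass (fun=> 1) y - mass (fun=> 1) x).
Proof.
move=> spsi psi0 K0 hK xy.
have [<-|xy'] := eqVneq x y; first by rewrite !subrr !mulr0 subr0 normr0.
have xy0 : 0 < y - x by rewrite subr_gt0 lt_neqAle xy'.
have s1 : smooth (fun _ : R => 1 : R) := smooth_cst 1.
have cP z : P (fun t => psi t * cutoff z d t) @[d --> (0 : R)^'+] --> mass psi z := @mass_cvg psi spsi psi0 z.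
have c1 z : P (fun t => 1 * cutoff z d t) @[d --> (0 : R)^'+] --> mass (fun=> 1) z := @mass_cvg _ s1 (fun=> ler01) z.
pose p z d := P (fun t => psi t * cutoff z d t); pose q z d := P (fun t => 1 * cutoff z d t).
have cd : (fun d : R => d) @ (0 : R)^'+ --> (0 : R) by apply: cvg_at_right_filter; exact: cvg_id.
have cL : `|p y d - p x d - psi x * (q y d - q x d)| @[d --> (0 : R)^'+] -->
    `|mass psi y - mass psi x - psi x * (mass (fun=> 1) y - mass (fun=> 1) x)|.
  apply: cvg_norm; apply: cvgB; first by apply: cvgB; exact: cP.
  by apply: cvgM; [exact: cvg_cst|apply: cvgB; exact: c1].
have cR : K * (y - x + 2 * d) * (q y d - q x d) @[d --> (0 : R)^'+] -->
    K * (y - x + 2 * 0) * (mass (fun=> 1) y - mass (fun=> 1) x).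
  apply: cvgM; last by apply: cvgB; exact: c1.
  apply: cvgM; first exact: cvg_cst.
  by apply: cvgD; [exact: cvg_cst|apply: cvgM => //; exact: cvg_cst].
rewrite mulr0 addr0 in cR; apply: (ler_cvg_to cL cR); near=> d.
have d0 : 0 < d by near: d; exact: nbhs_right_gt.
(* Ensures [x + 2 * d <= y + d], which [cutoff_le] requires. *)
have dxy : d < y - x by near: d; exact: nbhs_right_lt.
have sd z : smooth (fun t => 1 * cutoff z d t) := smoothM s1 (@cutoff_smooth z d).
have sp z : smooth (fun t => psi t * cutoff z d t) := smoothM spsi (@cutoff_smooth z d).
have sB : smooth (fun t => (-1) * (psi t * cutoff x d t) + psi t * cutoff y d t).
  exact (smoothD (smoothZ (a := -1) (sp x)) (sp y)).
have sQ : smooth (fun t => (-1) * (1 * cutoff x d t) + 1 * cutoff y d t).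
  exact (smoothD (smoothZ (a := -1) (sd x)) (sd y)).
have eB : P (fun t => (-1) * (psi t * cutoff x d t) + psi t * cutoff y d t) = p y d - p x d.
  by rewrite (P_linear (-1) (sp x) (sp y)) addrC mulN1r.
have eQ : P (fun t => (-1) * (1 * cutoff x d t) + 1 * cutoff y d t) = q y d - q x d.
  by rewrite (P_linear (-1) (sd x) (sd y)) addrC mulN1r.
have key (c : R) : (forall t, x + d <= t <= y + 2 * d -> psi t <= c) ->
    p y d - p x d <= c * (q y d - q x d).
  move=> hc; rewrite -eB -eQ -[leRHS]addr0 -[X in _ + X]P0 -(P_linear c sQ (smooth_cst (0 : R))).
  apply: (P_le sB (smoothD (smoothZ (a := c) sQ) (smooth_cst (0 : R)))).
  move=> t _ /=; rewrite addr0 !mul1r.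
  have h1 : cutoff x d t <= cutoff y d t by apply: cutoff_le => //; lra.
  have [h2|h2] := boolP (x + d <= t <= y + 2 * d).
    have -> : -1 * (psi t * cutoff x d t) + psi t * cutoff y d t = psi t * (cutoff y d t - cutoff x d t) by ring.
    have -> : c * (-1 * cutoff x d t + cutoff y d t) = c * (cutoff y d t - cutoff x d t) by ring.
    by rewrite ler_wpM2r ?subr_ge0// hc.
  move: h2; rewrite negb_and -!ltNge => /orP[h2|h2].
    by rewrite !cutoff1//; lra.
  by rewrite !cutoff0//; lra.
have key' (c : R) : (forall t, x + d <= t <= y + 2 * d -> c <= psi t) ->
    c * (q y d - q x d) <= p y d - p x d.
  move=> hc; rewrite -eB -eQ -[leLHS]addr0 -[X in _ + X]P0 -(P_linear c sQ (smooth_cst (0 : R))).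
  apply: (P_le (smoothD (smoothZ (a := c) sQ) (smooth_cst (0 : R))) sB).
  move=> t _ /=; rewrite addr0 !mul1r.
  have h1 : cutoff x d t <= cutoff y d t by apply: cutoff_le => //; lra.
  have [h2|h2] := boolP (x + d <= t <= y + 2 * d).
    have -> : -1 * (psi t * cutoff x d t) + psi t * cutoff y d t = psi t * (cutoff y d t - cutoff x d t) by ring.
    have -> : c * (-1 * cutoff x d t + cutoff y d t) = c * (cutoff y d t - cutoff x d t) by ring.
    by rewrite ler_wpM2r ?subr_ge0// hc.
  move: h2; rewrite negb_and -!ltNge => /orP[h2|h2].
    by rewrite !cutoff1//; lra.
  by rewrite !cutoff0//; lra.
have osc t : x + d <= t <= y + 2 * d -> `|psi t - psi x| <= K * (y - x + 2 * d).
  move=> /andP[h1 h2]; apply: (le_trans (hK _ _)); rewrite ler_wpM2l// ger0_norm; lra.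
have k1 : p y d - p x d <= (psi x + K * (y - x + 2 * d)) * (q y d - q x d).
  by apply: key => t /osc; rewrite ler_norml => /andP[_ h]; rewrite -lerBlDl.
have k2 : (psi x - K * (y - x + 2 * d)) * (q y d - q x d) <= p y d - p x d.
  by apply: key' => t /osc; rewrite ler_norml => /andP[h _]; move: h; lra.
rewrite ler_norml; apply/andP; split; move: k1 k2; move: (p y d - p x d) (q y d - q x d) => u v; lra.
Unshelve. all: by end_near. Qed.

(** [mass (fun=> 1)] is the distribution function of the measure. The mass of [psi] and its
    Stieltjes integral over []a, x]] have increments that agree to second order, so their difference
    [W] is the same at [a] and at [b]; []a, b]] contains [[- B, B]] and the support of [phi]. *)
Lemma Riesz_representation : exists2 nu : {measure set (measurableTypeR R) -> \bar R},
  is_Radon_measure nu & forall phi, test_function phi -> P phi = \int[nu]_t phi t.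
Proof.
have s1 : smooth (fun _ : R => 1 : R) := smooth_cst 1.
have ndG := mass_ndecr s1 (fun=> ler01); have rcG := mass_right_continuous s1 (fun=> ler01).
have [G GE] : exists G : cumulative R R, (G : R -> R) = mass (fun=> 1).
  pose G : cumulative R R := HB.pack (mass (fun=> 1))
    (isCumulative.Build R _ R (mass (fun=> 1)) ndG rcG).
  by exists G.
exists (stieltjes G); first exact: stieltjes_Radon.
move=> phi tphi; have [A [A0 vphi]] := test_vanishes_off tphi.
have [M [M0 hM]] := test_bounded tphi; have [K [K0 hK]] := test_lipschitz tphi.
have sphi := test_smooth tphi; have cphi := smooth_continuous sphi.
pose a := - (A + B + 1); pose b := A + B + 1.
have AB : 0 < A + B + 1 by rewrite ltr_wpDl ?ltr01// ltW// addr_gt0.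
have ab : a <= b by rewrite /a /b ge0_cp// ltW.
(* [mass_increment] needs a nonnegative function; the added constant is removed again by [e2] and
   [e3]. *)
pose psi t := phi t + M.
have spsi : smooth psi := smoothD sphi (smooth_cst M).
have cpsi := smooth_continuous spsi.
have psi0 t : 0 <= psi t by have := hM t; rewrite ler_norml => /andP[h _]; rewrite /psi; lra.
have psiK s t : `|psi s - psi t| <= K * `|s - t|.
  by have -> : psi s - psi t = phi s - phi t by rewrite /psi; ring.
have psiM t : `|psi t| <= M + M by rewrite (le_trans (ler_normD _ _))// lerD// ger0_norm.
pose V x := \int[stieltjes G]_(t in `]a, x]) psi t.
pose W x := mass psi x - V x.
have iV x y : a <= x -> x <= y -> V y - V x = \int[stieltjes G]_(t in `]x, y]) psi t.
  move=> ax xy; have ay := le_trans ax xy.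
  have e : `]a, y]%classic = `]a, x]%classic `|` `]x, y]%classic by apply: itv_bndbnd_setU.
  rewrite /V e Rintegral_setU.
  - by rewrite addrC addKr.
  - exact: measurable_itv.
  - exact: measurable_itv.
  - by rewrite -e; exact: stieltjes_integrable cpsi psiM ay.
  - apply/disj_setPS => t [] /=; rewrite !in_itv/= => /andP[_ h1] /andP[h2 _].
    by move: h1; rewrite leNgt h2.
have Wb : W b = W a.
  apply: (@second_order_increments _ W (mass (fun=> 1)) (K + K)) => //; first exact: addr_ge0.
  move=> x y ax xy; have h1 := mass_increment spsi psi0 K0 psiK xy.
  have h2 := stieltjes_increment G cpsi psiM K0 psiK xy; rewrite GE -iV// in h2.
  have eW (u1 u2 v1 v2 m : R) : (u1 - v1) - (u2 - v2) = (u1 - u2 - m) - (v1 - v2 - m) by ring.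
  rewrite /W (eW _ _ _ _ (psi x * (mass (fun=> 1) y - mass (fun=> 1) x))).
  apply: (le_trans (ler_normB _ _)); rewrite -[(K + K) * _ * _]mulrA [leRHS]mulrDl !mulrA.
  exact: lerD.
have aB : a < - B by rewrite /a; lra.
have bB : B <= b by rewrite /b; lra.
have Va : V a = 0 by rewrite /V -(iV a a (lexx _) (lexx _)) subrr.
have e1 : P psi = \int[stieltjes G]_(t in `]a, b]) psi t.
  have := Wb; rewrite /W (mass_left spsi psi0 aB) (mass_right spsi psi0 bB) Va /V; lra.
have e2 : P psi = M * P (fun=> 1) + P phi.
  by rewrite -(P_linear M s1 sphi); congr P; apply/funext => t; rewrite /psi mulr1 addrC.
have mI : measurable (`]a, b]%classic : set (measurableTypeR R)) by exact: measurable_itv.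
have iphi := stieltjes_integrable G cphi hM ab.
have icst : (stieltjes G).-integrable `]a, b]%classic (EFin \o (fun=> M)).
  by apply: (@stieltjes_integrable _ G (fun=> M) `|M|) => // t; exact: cvg_cst.
have e3 : \int[stieltjes G]_(t in `]a, b]) psi t = \int[stieltjes G]_(t in `]a, b]) phi t + M * P (fun=> 1).
  rewrite RintegralD// Rintegral_cst// stieltjes_itv//= GE.
  by rewrite (mass_left s1 (fun=> ler01) aB) (mass_right s1 (fun=> ler01) bB) subr0.
have inab (u : R) : - A <= u -> u <= A -> a < u <= b.
  by have B1 : 0 < B := B0; move=> h1 h2; rewrite /a /b; apply/andP; split; lra.
have e4 : \int[stieltjes G]_t phi t = \int[stieltjes G]_(t in `]a, b]) phi t.
  rewrite [RHS]Rintegral_mkcond; apply: eq_Rintegral => t _; rewrite patchE.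
  case: ifPn => // /negP h; apply: vphi; apply/negP => /andP[h1 h2]; apply: h.
  by rewrite inE/= in_itv/=; exact: inab.
by rewrite e4; move: e1; rewrite e2 e3; lra.
Qed.

End Riesz.

(** * The singular set *)

Section Topology.
Context {R : realType}.

Lemma closed_point (S : set R) (y : R) : closed S ->
  (forall e : R, 0 < e -> exists2 x, S x & `|y - x| < e) -> S y.
Proof.
move=> cS h; rewrite (iffLR (closure_id S) cS) => V /nbhs_ballP[e /= e0 eV].
by have [x Sx xy] := h e e0; exists x; split=> //; exact: eV.
Qed.

(** Nested intervals centred at points of [S]: if no [C n] contains a neighbourhood in [S], the
    interval of step [n + 1] can avoid [C n]. The common point is the supremum of the left ends, and
    lies in [S] because [S] is closed. *)
Lemma closed_Baire (S : set R) (C : nat -> set R) : closed S -> S !=set0 ->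
  (forall n, closed (C n)) -> (forall x, S x -> exists n, C n x) ->
  exists n x e, [/\ S x, 0 < e & forall t, S t -> `|t - x| < e -> C n t].
Proof.
move=> cS [s0 Ss0] cC cov; apply: contrapT => no.
(* A pair is a centre and a radius. The conditions on [p] are premises inside the existential, so
   that [choice] yields a total function. *)
have step (n : nat) (p : R * R) : exists q : R * R, S p.1 -> 0 < p.2 ->
    [/\ S q.1, 0 < q.2, q.2 <= p.2 / 2, `|q.1 - p.1| + q.2 <= p.2 &
       forall t, `|t - q.1| <= q.2 -> ~ C n t].
  have [[Sp p0]|np] := pselect (S p.1 /\ 0 < p.2); last by exists p => h1 h2; case: np.
  have [t [St tp nC]] : exists t, [/\ S t, `|t - p.1| < p.2 & ~ C n t].
    apply: contrapT => nt; apply: no; exists n, p.1, p.2; split=> // t St tp.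
    by apply: contrapT => nCt; apply: nt; exists t.
  have /nbhs_ballP[r /= r0 rC] : nbhs t (~` C n) by apply: open_nbhs_nbhs; split=> //; exact: closed_openC.
  pose r' := Num.min (r / 2) (Num.min (p.2 / 2) (p.2 - `|t - p.1|)).
  have r'0 : 0 < r' by rewrite !lt_min !divr_gt0//= subr_gt0.
  have r'1 : r' <= r / 2 by rewrite ge_min lexx.
  have r'2 : r' <= p.2 / 2 by rewrite !ge_min lexx orbT.
  have r'3 : r' <= p.2 - `|t - p.1| by rewrite !ge_min lexx !orbT.
  exists (t, r') => _ _; split=> //=; first by rewrite -lerBrDl.
  by move=> u ut; apply: rC; rewrite /ball/= distrC; lra.
have /choice[nx hnx] : forall np : nat * (R * R), exists q : R * R, S np.2.1 -> 0 < np.2.2 ->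
    [/\ S q.1, 0 < q.2, q.2 <= np.2.2 / 2, `|q.1 - np.2.1| + q.2 <= np.2.2 &
       forall t, `|t - q.1| <= q.2 -> ~ C np.1 t].
  by move=> [n p]; exact: step.
pose u := fix u (n : nat) : R * R := if n is m.+1 then nx (m, u m) else (s0, 1).
have uS n : S (u n).1 /\ 0 < (u n).2.
  by elim: n => [//|n [h1 h2]]; have [] := hnx (n, u n) h1 h2.
have uE n := hnx (n, u n) (uS n).1 (uS n).2.
have nest n : (u n).1 - (u n).2 <= (u n.+1).1 - (u n.+1).2 /\ (u n.+1).1 + (u n.+1).2 <= (u n).1 + (u n).2.
  have [_ _ _ + _] := uE n; rewrite -lerBrDr ler_norml => /andP[] /=.
  by move: (u n) (nx _) => p q h1 h2; split; lra.
have nestm n m : (u n).1 - (u n).2 <= (u (n + m)%N).1 - (u (n + m)%N).2 /\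
    (u (n + m)%N).1 + (u (n + m)%N).2 <= (u n).1 + (u n).2.
  elim: m => [|m [h1 h2]]; first by rewrite addn0.
  rewrite addnS; have [h3 h4] := nest (n + m)%N; split; first exact: le_trans h3.
  exact: le_trans h2.
pose L := [set (u n).1 - (u n).2 | n in [set: nat]].
have ubL n : ubound L ((u n).1 + (u n).2).
  move=> _ [m _ <-]; have [h1 _] := nestm m n; have [_ h2] := nestm n m.
  rewrite addnC in h1; have [_ h3] := uS (n + m)%N; move: h1 h2 h3.
  by move: (u m) (u n) (u _) => p q r; lra.
have supL : has_sup L.
  by split; [exists ((u 0%N).1 - (u 0%N).2); exists 0%N|exists ((u 0%N).1 + (u 0%N).2)].
pose y := sup L.
have yu n : `|y - (u n).1| <= (u n).2.
  rewrite ler_distl; apply/andP; split; first by apply: ub_le_sup; [case: supL|exists n].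
  by apply: ge_sup => //; case: supL.
have small n : (u n).2 <= 2^-1 ^+ n.
  elim: n => [|n IH]; first by rewrite expr0.
  have [_ _ h _ _] := uE n; rewrite /= in h *; rewrite exprS; apply: (le_trans h).
  by rewrite mulrC ler_wpM2l.
have Sy : S y.
  apply: closed_point => // e e0.
  have h1 : `|2^-1 : R| < 1 by rewrite ger0_norm// invf_lt1// ltr1n.
  have /cvgrPdist_lt/(_ _ e0)[n _ hn] := cvg_expr h1.
  have := hn n (leqnn n); rewrite /= sub0r normrN ger0_norm ?exprn_ge0// => h2.
  exists (u n).1; first by case: (uS n).
  by apply: le_lt_trans (yu n) _; exact: le_lt_trans (small n) _.
have [n Cy] := cov y Sy; have [_ _ _ _ /(_ y)] := uE n; apply=> //; exact: (yu n.+1).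
Qed.

Lemma gap_ends (S : set R) (a b x : R) : closed S -> S a -> S b -> a < x < b -> ~ S x ->
  exists c d, [/\ a <= c, d <= b, S c, S d & c < x < d /\ forall t, c < t < d -> ~ S t].
Proof.
move=> cS Sa Sb /andP[ax xb] nSx.
pose A := [set t | S t /\ t <= x]; pose B := [set t | S t /\ x <= t].
have supA : has_sup A by split; [exists a; split=> //; exact: ltW|exists x => t []].
have infB : has_inf B by split; [exists b; split=> //; exact: ltW|exists x => t []].
have Sc : S (sup A).
  apply: closed_point => // e e0; have [t At h] := sup_adherent e0 supA; have [St tx] := At.
  by exists t => //; have h2 := ub_le_sup supA.2 At; rewrite ger0_norm ?subr_ge0//; lra.
have Sd : S (inf B).
  apply: closed_point => // e e0; have [t Bt h] := inf_adherent e0 infB; have [St tx] := Bt.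
  by exists t => //; have h2 := ge_inf infB.2 Bt; rewrite ler0_norm ?subr_le0//; lra.
have cx : sup A < x.
  rewrite lt_neqAle; apply/andP; split; first by apply/eqP => h; apply: nSx; rewrite -h.
  by apply: ge_sup; [exact: supA.1|move=> t []].
have xd : x < inf B.
  rewrite lt_neqAle; apply/andP; split; first by apply/eqP => h; apply: nSx; rewrite h.
  by apply: lb_le_inf; [exact: infB.1|move=> t []].
exists (sup A), (inf B); split=> //.
- by apply: ub_le_sup; [exact: supA.2|split=> //; exact: ltW].
- by apply: ge_inf; [exact: infB.2|split=> //; exact: ltW].
split; first by rewrite cx.
move=> t /andP[ct td] St; have [tx|xt] := leP t x.
  by have := ub_le_sup supA.2 (conj St tx : A t); rewrite leNgt ct.
by have := ge_inf infB.2 (conj St (ltW xt) : B t); rewrite leNgt td.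
Qed.

End Topology.

(** * Emptiness of the singular set, and conclusion *)

Section Main.
Context {R : realType}.
Variables (H : R * R -> R) (f : (R -> R) -> R) (E : set R) (M : R -> R).
Local Notation mu := (@lebesgue_measure R).
Hypothesis H_harmonic : harmonic_on upper_half_plane H.
Hypothesis H_infty : vanishes_at_infinity_on upper_half_plane H.
Hypothesis f_compact : compact_distribution f.
Hypothesis H_limit : has_distr_boundary_limit H f.
Hypothesis f_scaling : forall a phi, test_function phi ->
  f (dilate a e phi) @[e --> (0 : R)^'] --> (0 : R).
Hypothesis H_limsup : {ae mu, forall x : R, (0 <= limsup_boundary H x)%E}.
Hypothesis E_countable : countable E.
Hypothesis H_liminf : forall x : R, ~ E x -> ((- M x)%:E <= liminf_boundary H x)%E.

Definition singular_set : set R := [set x | ~ exists2 e : R, 0 < e & pos_on f (x - e) (x + e)].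

Lemma regularP (x : R) : ~ singular_set x -> exists2 e : R, 0 < e & pos_on f (x - e) (x + e).
Proof. by move=> h; apply: contrapT. Qed.

Lemma closed_singular_set : closed singular_set.
Proof.
rewrite -[singular_set]setCK; apply: open_closedC; rewrite openE => x /= /regularP[e e0 fe].
apply/nbhs_ballP; exists (e / 2); first by rewrite /= divr_gt0.
move=> t; rewrite /ball/= ltr_distl => /andP[h1 h2]; apply; exists (e / 2); first by rewrite divr_gt0.
by apply: pos_onS fe; lra.
Qed.

(** Integrate the bound against [phi] at height [y] and let [y] tend to [0] in [H_limit]. *)
Lemma ge_on_lower_bound (C a b h0 : R) : 0 < h0 ->
  (forall x y, a < x < b -> 0 < y < h0 -> - C <= H (x, y)) -> ge_on f C a b.
Proof.
move=> h00 low phi sphi phi0 vphi; have tphi := vanishes_off_test sphi vphi.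
(* The bound on [H] is known on the open interval only; by continuity [phi] also vanishes at the end
   points. *)
have phiab t : ~~ (a < t < b) -> phi t = 0.
  move=> h; have cphi := smooth_continuous sphi.
  have [tab|tab] := boolP (a <= t <= b); last exact: vphi.
  apply/eqP/negPn/negP => nz.
  have e0 : 0 < `|phi t| by rewrite normr_gt0.
  have /cvgrPdist_lt/(_ _ e0)/nbhs_ballP[r /= r0 hr] := cphi t.
  have out s : ball t r s -> a <= s <= b.
    move=> /hr /=; apply: contraLR => sab; by rewrite (vphi s sab) subr0 ltxx.
  have r2 : `|r / 2| < r by rewrite gtr0_norm; lra.
  have /out/andP[h1 _] : ball t r (t - r / 2) by rewrite /ball/= opprB addrC subrK.
  have /out/andP[_ h2] : ball t r (t + r / 2) by rewrite /ball/= opprD addrA subrr sub0r normrN.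
  by move: h => /negP; apply; apply/andP; split; lra.
have hI y : 0 < y -> mu.-integrable setT (EFin \o (fun x => H (x, y) * phi x)).
  move=> y0; have [K hK] := slice_bounded H_harmonic H_infty y0.
  have [A [A0 vA]] := test_vanishes_off tphi.
  have cH : continuous (fun x => H (x, y)) := slice_continuous H_harmonic y0.
  have i1 : mu.-integrable `[- A, A] (EFin \o (fun x => H (x, y) * phi x)).
    apply: continuous_compact_integrable; first exact: segment_compact.
    apply: continuous_subspaceT => x; apply: cvgM; [exact: cH|exact: smooth_continuous].
  have := (iffLR (integrable_mkcond _ _)) i1; move=> /(_ (measurable_itv _)).
  apply: eq_integrable => // x _; rewrite patchE; case: ifPn => // /negP xab.
  rewrite /= vA ?mulr0//; apply/negP => h; apply: xab; by rewrite inE/= in_itv.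
have lim := H_limit tphi.
have cc : (fun _ : R => - (C * \int[mu]_t phi t)) @ (0 : R)^'+ --> - (C * \int[mu]_t phi t) by exact: cvg_cst.
apply: (ler_cvg_to cc lim); near=> y.
have y0 : 0 < y by near: y; exact: nbhs_right_gt.
have yh : y < h0 by near: y; exact: nbhs_right_lt.
rewrite -mulNr -Rintegral_testZ//; apply: le_Rintegral => //.
- exact: test_integrable (testZ _ tphi).
- exact: hI.
move=> x _; have [xab|/phiab ->] := boolP (a < x < b); last by rewrite !mulr0.
by rewrite ler_wpM2r// low// y0.
Unshelve. all: by end_near. Qed.

(* In each gap of the singular set the lower bound at the end points propagates inside by
   [gap_lower_bound]; the density argument then applies on the whole interval. *)
Lemma singular_bounded_isolated (x0 e C h0 : R) : 0 < e -> 0 < h0 -> h0 <= 1 ->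
  (forall t y, singular_set t -> `|t - x0| < e -> 0 < y <= h0 -> - C <= H (t, y)) ->
  ~ singular_set x0.
Proof.
move=> e0 h00 h01 low; have e20 : 0 < e / 2 by rewrite divr_gt0.
pose a := x0 - e / 2; pose b := x0 + e / 2.
have ab : a < b by rewrite /a /b; lra.
(* The points [a] and [b] may be regular; then the bound on their vertical comes from
   [local_lower_bound]. *)
have side t : a <= t <= b -> exists C' : R, forall y, 0 < y <= h0 -> - C' <= H (t, y).
  move=> tab; have [St|/regularP[r r0 fr]] := pselect (singular_set t).
    exists C => y; apply: low => //; rewrite /a /b in tab.
    by case/andP: tab => h1 h2; rewrite ltr_norml; apply/andP; split; lra.
  have tr1 : t - r < t by lra.
  have tr2 : t < t + r by lra.
  have [C' [C'0 hC']] := local_lower_bound H_harmonic H_infty f_compact H_limit fr tr1 tr2.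
  exists C' => y /andP[y0 yh].
  have tt : t <= (t, y).1 <= t by rewrite /= lexx.
  have y1 : (t, y).2 <= 1 by rewrite /= (le_trans yh).
  have := hC' (t, y) tt y0 y1; apply: le_trans; rewrite lerN2 ler_piMr//.
have [|Ca hCa] := side a; first by rewrite lexx ltW.
have [|Cb hCb] := side b; first by rewrite lexx ltW.
have [Ch hCh] := slice_bounded H_harmonic H_infty h00.
pose C1 := Num.max 1 (Num.max (Num.max C Ca) (Num.max Cb Ch)).
have C10 : 0 < C1 by rewrite lt_max ltr01.
have CC1 : C <= C1 by rewrite !le_max lexx !orbT.
have CaC1 : Ca <= C1 by rewrite !le_max lexx !orbT.
have CbC1 : Cb <= C1 by rewrite !le_max lexx !orbT.
have ChC1 : Ch <= C1 by rewrite !le_max lexx !orbT.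
(* With [a] and [b] added, every point outside [S'] lies in a gap both of whose ends carry the bound
   [C1]. *)
pose S' := (singular_set `&` `[a, b]%classic) `|` [set a; b].
have cS' : closed S'.
  apply: closedU; first by apply: closedI; [exact: closed_singular_set|exact: interval_closed].
  by apply: closedU; exact: closed_eq.
have lowS t : S' t -> forall y, 0 < y <= h0 -> - C1 <= H (t, y).
  move=> [[St tab]|[]/= ->] y hy; first last.
  - by apply: le_trans (hCb y hy); rewrite lerN2.
  - by apply: le_trans (hCa y hy); rewrite lerN2.
  move: tab; rewrite /= in_itv/= => tab; have te : `|t - x0| < e.
    by rewrite /a /b in tab; case/andP: tab => h1 h2; rewrite ltr_norml; apply/andP; split; lra.
  by apply: le_trans (low t y St te hy); rewrite lerN2.
have all x y : a < x < b -> 0 < y < h0 -> - C1 <= H (x, y).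
  move=> xab yh; have [S'x|nS'x] := pselect (S' x).
    by apply: lowS => //; case/andP: yh => -> /ltW.
  have Sa : S' a by right; left.
  have Sb : S' b by right; right.
  have [c [d [ac db Sc Sd [xcd gap]]]] := gap_ends cS' Sa Sb xab nS'x.
  have cd : c < d by case/andP: xcd => h1 h2; exact: lt_trans h2.
  apply: (gap_lower_bound H_harmonic H_infty f_compact H_limit (a := c) (b := d) (h0 := h0)) => //.
  - exact: ltW.
  - move=> t tcd; apply: regularP => St; apply: (gap t tcd); left; split=> //=.
    by case/andP: tcd => h1 h2; rewrite in_itv/=; apply/andP; split; lra.
  - by move=> t _; exact: f_scaling.
  - by move=> t [->|->]; exact: lowS.
  - move=> t _; have := hCh t; rewrite ler_norml => /andP[h _]; apply: le_trans h.
    by rewrite lerN2.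
have ge := ge_on_lower_bound h00 all.
apply; exists (e / 2) => //.
exact: (ge_on_pos H_harmonic H_infty f_compact H_limit H_limsup ge C10 ab).
Qed.

(** The closed sets covering the singular set are the [Low n] and the points of [E]. Baire makes one
    of them contain a neighbourhood in the singular set: [Low n] contradicts
    [singular_bounded_isolated], a single point contradicts [removable_point]. *)
Lemma singular_set0 (x : R) : ~ singular_set x.
Proof.
move=> Sx; have /countable_injP[g gI] := E_countable.
pose Low n := [set x | forall y, 0 < y <= n.+1%:R^-1 -> - n%:R <= H (x, y)].
(* The two sequences are interleaved: odd indices enumerate the points of [E], even ones the sets
   [Low]. *)
pose C n := if odd n then [set x | E x /\ g x = n./2] else Low n./2.
have cLow n : closed (Low n).
  have -> : Low n = \bigcap_(y in [set y : R | 0 < y <= n.+1%:R^-1]) [set x | - n%:R <= H (x, y)].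
    by apply/seteqP; split=> t h y hy; exact: h.
  apply: closed_bigI => y /andP[y0 _].
  have cH : continuous (fun x => H (x, y)) := slice_continuous H_harmonic y0.
  have -> : [set x | - n%:R <= H (x, y)] = (fun x => H (x, y)) @^-1` [set z | - n%:R <= z] by [].
  by apply: closed_comp => [t _|]; [exact: cH|exact: closed_ge].
have cC n : closed (C n).
  rewrite /C; case: ifP => _ //.
  have [[t [Et gt]]|no] := pselect (exists t, E t /\ g t = n./2); last first.
    have -> : [set x | E x /\ g x = n./2] = set0; last exact: closed0.
    by apply/seteqP; split=> // t h; apply: no; exists t.
  have -> : [set x | E x /\ g x = n./2] = [set t]; last exact: closed_eq.
  apply/seteqP; split=> [u [Eu gu]|u ->] //=.
  by apply: gI; rewrite ?inE// gu.
have cov t : singular_set t -> exists n, C n t.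
  move=> _; have [Et|nEt] := pselect (E t).
    exists ((g t).*2.+1); rewrite /C /= odd_double /=; split=> //.
    by rewrite uphalf_double.
  (* The extra [1] gives the strict inequality that [liminf_boundary_gt] needs. *)
  have lt1 : ((- (M t + 1))%:E < liminf_boundary H t)%E.
    apply: lt_le_trans (H_liminf nEt); rewrite lte_fin; lra.
  have [r /= r0 hr] := liminf_boundary_gt lt1.
  pose n := (Num.truncn (Num.max (M t + 1) r^-1)).+1.
  have nM : Num.max (M t + 1) r^-1 < n%:R := truncnS_gt _.
  exists n.*2; rewrite /C odd_double doubleK => y /andP[y0 yn].
  move: nM; rewrite gt_max => /andP[n1 n2].
  have yr : ball 0 r y.
    rewrite /ball/= sub0r normrN gtr0_norm// (le_lt_trans yn)//.
    by rewrite invf_plt ?posrE// (lt_trans n2)// ltr_nat.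
  by have := hr y yr y0; apply: le_trans; rewrite lerN2 ltW.
have [n [x0 [e [Sx0 e0 sub]]]] := closed_Baire closed_singular_set (ex_intro _ x Sx) cC cov.
move: sub; rewrite /C; case: ifP => _ sub.
  apply: (Sx0); apply: (removable_point f_compact.1 f_compact.2 (c := x0 - e) (d := x0 + e)).
  - by apply/andP; split; lra.
  - exact: f_scaling.
  move=> t te tx; apply: regularP => St.
  have te' : `|t - x0| < e by rewrite ltr_distl.
  have [Et gt] := sub t St te'.
  have x00 : `|x0 - x0| < e by rewrite subrr normr0.
  have [Ex0 gx0] := sub x0 Sx0 x00.
  by case/eqP: tx; apply: gI; rewrite ?inE// gt.
apply: (@singular_bounded_isolated x0 e (n./2)%:R (n./2).+1%:R^-1) => //.
  by rewrite invf_le1// ler1n.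
by move=> t y St te hy; exact: (sub t St te y hy).
Qed.

Lemma f_positive (a b : R) : pos_on f a b.
Proof. by apply: (pos_on_glue f_compact.1) => x _; apply: regularP; exact: singular_set0. Qed.

Lemma H_nonneg (x y : R) : 0 < y -> 0 <= H (x, y).
Proof.
move=> y0; have [A [A0 repr]] := boundary_representation H_harmonic H_infty f_compact H_limit.
pose chi := plateau (- (A + 1)) (- A) A (A + 1) : R -> R.
have a1 : - (A + 1) < - A by lra.
have a2 : A < A + 1 by lra.
have tchi : test_function chi := test_plateau a1 a2.
have chi1 t : `|t| < A -> chi t = 1.
  by rewrite ltr_norml => /andP[h1 h2]; apply: plateau1 => //; rewrite !ltW.
have zy : 0 < (x, y).2 by [].
rewrite -(pmulr_rge0 _ (pi_gt0 R)) (repr _ tchi chi1 _ zy).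
apply: (f_positive (a := - (A + 1)) (b := A + 1)).
- exact: test_smooth (testM tchi (smooth_pker zy)).
- by move=> t; rewrite mulr_ge0 ?plateau_ge0// ltW// pker_gt0.
- exact: vanishes_offMl (vanishes_off_plateau a1 a2).
Qed.

(** [Riesz_representation] wants a functional on all smooth functions, so it is applied to
    [f (chi * phi)]. The cutoff is [1] near the support of [f], so nothing changes on test
    functions, and positivity is needed only on [[- (A + 1), A + 1]]. *)
Lemma f_measure : is_measure_distribution f.
Proof.
have [df cf] := f_compact; have [A [A0 hA]] := compactly_supportedP cf.
pose chi := plateau (- (A + 1)) (- A) A (A + 1) : R -> R.
have a1 : - (A + 1) < - A by lra.
have a2 : A < A + 1 by lra.
have tchi : test_function chi := test_plateau a1 a2.
have vchi : vanishes_off (- (A + 1)) (A + 1) chi := vanishes_off_plateau a1 a2.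
have B0 : 0 < A + 1 by lra.
have tc phi : smooth phi -> test_function (fun t => chi t * phi t) by exact: testM.
have lin c phi psi : smooth phi -> smooth psi ->
    f (fun t => chi t * (c * phi t + psi t)) = c * f (fun t => chi t * phi t) + f (fun t => chi t * psi t).
  move=> s1 s2; rewrite -(distr_lin df c (tc phi s1) (tc psi s2)).
  by congr f; apply/funext => t; ring.
have pos phi : smooth phi -> (forall t, `|t| <= A + 1 -> 0 <= phi t) -> 0 <= f (fun t => chi t * phi t).
  move=> sphi phi0; apply: (f_positive (a := - (A + 1)) (b := A + 1)).
  - exact: test_smooth (tc _ sphi).
  - move=> t; have [h|h] := leP `|t| (A + 1); first by rewrite mulr_ge0 ?plateau_ge0// phi0.
    by rewrite vchi ?mul0r// -ler_norml -ltNge.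
  - exact: vanishes_offMl vchi.
have [nu nuR hnu] := @Riesz_representation R (fun phi => f (fun t => chi t * phi t)) (A + 1) B0 lin pos.
exists nu => // phi tphi; rewrite -hnu//.
apply/eqP; rewrite -subr_eq0 -(distrB df)//; last exact: tc (test_smooth tphi).
apply/eqP; apply: hA; first exact: testB tphi (tc _ (test_smooth tphi)).
move=> t; rewrite ltr_norml => /andP[h1 h2].
by rewrite /chi plateau1 ?mul1r ?subrr// !ltW.
Qed.

End Main.

Theorem theorem3p5 (R : realType) (H : R * R -> R) (f F : (R -> R) -> R)
    (E : set R) (M : R -> R)
    (H_harmonic : harmonic_on upper_half_plane H)
    (H_infty : vanishes_at_infinity_on upper_half_plane H)
    (f_compact : compact_distribution f)
    (H_limit : has_distr_boundary_limit H f)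
    (F_Lojasiewicz : Lojasiewicz_distribution F)
    (f_derivative : is_distr_derivative F f)
    (H_limsup : {ae (@lebesgue_measure R), forall x : R,
       (0 <= limsup_boundary H x)%E})
    (E_countable : countable E)
    (H_liminf : forall x : R, ~ E x ->
       ((- M x)%:E <= liminf_boundary H x)%E) :
  is_measure_distribution f /\
  (forall x y : R, 0 < y -> 0 <= H (x, y)).
Proof.
have scal := Lojasiewicz_scaling F_Lojasiewicz f_derivative; split.
  exact: (f_measure H_harmonic H_infty f_compact H_limit scal H_limsup E_countable H_liminf).
move=> x y; exact: (H_nonneg H_harmonic H_infty f_compact H_limit scal H_limsup E_countable H_liminf).
Qed.
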